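(* Set $v=q^2$ (so $q=v^{1/2}$). Let $\rho'\in\Lambda$ be a fixed element with $\rho-\rho'\in E_{\mathrm{co}}$. Let $\mu\in\Lambda$ with $\mu-\rho'\in\Lambda^+$, with decomposition $w_0\mu=\eta+\hat wc$ for some $\eta\in\Lambda^m$, $\hat w\in W^c$, $c\in\widetilde C^0_{\Lambda^m}$, and let $\theta\in W\cdot\widetilde C^0_{\Lambda^m}$. Then $w_0\big(\mathbf{y}^{\rho'-\theta}\tilde\phi^o_\theta(\mathbf{y};\varpi^{\rho'-\mu};v)\big)$ lies in $\mathbb{F}[\Lambda^m]$; it vanishes unless $w_0\theta=\tilde wc$ for some $\tilde w\in W$ with $w_0\tilde w\in W^c$, and in this case $$w_0\Big(\mathbf{y}^{\rho'-\theta}\tilde\phi^o_\theta(\mathbf{y};\varpi^{\rho'-\mu};v)\Big)=\frac{v^{l(w_0)}(-1)^{l(w_0\hat ww_0)}\,F^{-w_0c}_{\mathbf{1}^-}(w_0\tilde w^cw_0)}{h^{m,-w_0c}_v(w_0\hat ww_0)}\cdot\pi^m_v\big(T_{\tilde w^cw_0}\,\mathbf{1}^-_{W_{-w_0c}}\,T_{w_0\hat ww_0}^{-1}\big)\mathbf{y}^{w_0\eta},$$ where $F^{c'}_{\mathbf{1}^-}(u)=h^{m,c'}_v(u)\,v^{-l(w_0)/2+l(w_0(W_{c'}))}(-1)^{l(u)}$ for $c'\in C^0_{\Lambda^m}$ and $u\in W$.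
   Context: Let $E$ be a Euclidean space with dual $E^*$ and $\Phi\subset E^*$ a reduced irreducible root system (in its span); $E_{\mathrm{co}}=\bigcap_{\alpha\in\Phi}\ker\alpha$. For $\alpha\in\Phi$, $\alpha^\vee\in E$ is the vector with $\langle y,\alpha^\vee\rangle=2\alpha(y)/\|\alpha\|^2$ for all $y\in E$. Fix simple roots $\alpha_1,\dots,\alpha_r$ and positive roots $\Phi^+$; $\rho$ is the half sum of the positive coroots; $W$ is the finite Weyl group, with simple reflections $s_i$, acting on $E$ by $s_\alpha(y)=y-\alpha(y)\alpha^\vee$; $l$ is the length, $w_0$ the longest element, $\Pi(w)=\Phi^+\cap w^{-1}\Phi^-$. $Q^\vee$ is the coroot lattice. $\Lambda\in\mathcal{L}$, i.e. $\Lambda\subset E$ is a finitely generated abelian subgroup with $Q^\vee\subseteq\Lambda$ and $\alpha(\Lambda)\subseteq\mathbb{Z}$ for all $\alpha\in\Phi$; $\Lambda^+=\{\lambda\in\Lambda:\alpha_i(\lambda)\ge0\ \forall i\}$. $\mathbb{F}$ is a field containing a nonzero $v$ with fixed square root $v^{1/2}$; $\mathbb{F}[\Lambda]$ has basis $\mathbf{y}^\lambda$, $w\mathbf{y}^\lambda=\mathbf{y}^{w\lambda}$, $\iota(\mathbf{y}^\lambda)=\mathbf{y}^{-\lambda}$. Metaplectic data: $n\in\mathbb{Z}_{\ge1}$; $\mathbf{Q}:\Lambda\to\mathbb{Q}$ a nonzero $W$-invariant quadratic form, integer valued on $Q^\vee$; $\mathbf{B}(\lambda,\mu)=\mathbf{Q}(\lambda+\mu)-\mathbf{Q}(\lambda)-\mathbf{Q}(\mu)$,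 so $\mathbf{B}(\lambda,\alpha^\vee)=\mathbf{Q}(\alpha^\vee)\alpha(\lambda)$; $m(\alpha)=n/\gcd(n,\mathbf{Q}(\alpha^\vee))$; $\Lambda^m=\{\lambda\in\Lambda:m(\alpha)\mid\alpha(\lambda)\ \forall\alpha\in\Phi\}$. $\widetilde W_{\Lambda^m}=W\ltimes\Lambda^m$ acts on $E$ with $\Lambda^m$ acting by translations. $C^0_{\Lambda^m}$ is the set of $c\in\Lambda$ with $0\le\alpha(c)\le m(\alpha)$ for all $\alpha\in\Phi^+$ whose stabilizer in $\widetilde W_{\Lambda^m}$ equals its stabilizer $W_c$ in $W$. $\Omega_{\Lambda^m}$ is the group of elements of $\widetilde W_{\Lambda^m}$ preserving $C^{m+}=\{y\in E:0<\alpha(y)<m(\alpha)\ \forall\alpha\in\Phi^+\}$, and $\widetilde C^0_{\Lambda^m}$ is a fixed set of representatives of $C^0_{\Lambda^m}/\Omega_{\Lambda^m}$. $W^c$ is the set of minimal length representatives of $W/W_c$, $w_0(W_c)$ the longest element of $W_c$; for $w\in W$, $w=w^cw_c$ with $w^c\in W^c$, $w_c\in W_c$. (If $c\in C^0_{\Lambda^m}$ then $-w_0c\in C^0_{\Lambda^m}$.) Parameters $g_j\in\mathbb{F}^\times$ ($j\in\mathbb{Z}$): $g_j=-1$ if $n\mid j$; $g_{j+n}=g_j$; $g_jg_{n-j}=v^{-1}$ if $n\nmid j$. $h^{m,c}_v(w)=(-1)^{l(w)}v^{l(w)/2}\prod_{\alpha\in\Pi(w)}g_{-\mathbf{B}(c,\alpha^\vee)}$.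 Operators on $\mathbb{F}[\Lambda]$: $$\pi^m_v(T_i)\mathbf{y}^\lambda=-v^{1/2}g_{-\mathbf{B}(\lambda,\alpha_i^\vee)}\mathbf{y}^{s_i\lambda}+(v^{1/2}-v^{-1/2})\frac{1-\mathbf{y}^{(r_{m(\alpha_i)}(\alpha_i(\lambda))-\alpha_i(\lambda))\alpha_i^\vee}}{1-\mathbf{y}^{m(\alpha_i)\alpha_i^\vee}}\,\mathbf{y}^\lambda,$$ where $r_m(a)\in\{0,\dots,m-1\}$ is the residue of $a$ mod $m$; these satisfy the braid relations and $(T_i-v^{1/2})(T_i+v^{-1/2})=0$, so define $\pi^m_v$ on the finite Hecke algebra. $T_w=T_{i_1}\cdots T_{i_k}$ for a reduced expression. $\mathbf{1}^-_{W_{c}}=\sum_{w\in W_{c}}(-1)^{l(w)}v^{-l(w)/2}T_w$. Component metaplectic Whittaker functions: put $\mathcal{T}^m_{i,v}=-v^{1/2}\mathbf{y}^{\rho'}\pi^m_v(T_i)^{-1}\mathbf{y}^{-\rho'}$ (conjugation by $\mathbf{y}^{\rho}$ gives the same operator) and $\mathcal{T}^m_{w,v}=\mathcal{T}^m_{i_1,v}\cdots\mathcal{T}^m_{i_k,v}$ for a reduced expression. Then, for $\theta\in W\widetilde C^0_{\Lambda^m}$, $\tilde\phi^o_\theta(\mathbf{y};\varpi^{\rho'-\mu};v)$ is the component of $\sum_{w\in W}\iota\,\mathcal{T}^m_{w,v}\,\iota\,\mathbf{y}^{\mu-\rho'}\in\mathbb{F}[\Lambda]$ consisting of the terms with exponents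 in $\theta-\rho'+\Lambda^m$. *)

(* Defs.v *)
From HB Require Import structures.
From mathcomp Require Import all_boot all_order all_algebra.
From mathcomp Require Import finmap monalg.
From mathcomp Require Import boolp classical_sets fsbigop reals.

Set Implicit Arguments.
Unset Strict Implicit.
Unset Printing Implicit Defensive.

Import Order.TTheory GRing.Theory Num.Theory.

Local Open Scope classical_set_scope.
Local Open Scope ring_scope.

(* monalg puts a ring structure on {malg F[K]} only for monoids K without
   nontrivial units; for a group of exponents V we supply it here, on an alias.
   [expo x] is the basis element y^x.  For a subgroup L of V, the group algebra
   F[L] is the subspace [supported L] of F[V]; operators on F[L] are given below
   by formulas that make sense on all of F[V]. *)

Definition groupAlgebra (F : fieldType) (V : zmodType) : Type := {malg F[V]}.

Section GroupAlgebra.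
Variables (F : fieldType) (V : zmodType).
Local Notation A := (groupAlgebra F V).
Implicit Types (f g h : A) (x y : V).

HB.instance Definition _ := GRing.Lmodule.on A.

Definition expo x : A := << x >>.

(* The linear extension of a function given on the basis. *)
Definition linext (U : lmodType F) (t : V -> U) f : U :=
  \sum_(x <- msupp (f : {malg F[V]})) f@_x *: t x.

Definition gmul f g : A := linext (fun x => linext (fun y => expo (x + y)) g) f.

Lemma linextw (U : lmodType F) (t : V -> U) (d : {fset V}) f :
  (msupp (f : {malg F[V]}) `<=` d)%fset -> linext t f = \sum_(x <- d) f@_x *: t x.
Proof.
move=> le; rewrite /linext (big_fset_incl _ le) //=.
by move=> x _ /mcoeff_outdom ->; rewrite scale0r.
Qed.

Lemma linextD (U : lmodType F) (t : V -> U) f g :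
  linext t (f + g) = linext t f + linext t g.
Proof.
rewrite (linextw _ (msuppD_le f g)) (linextw _ (fsubsetUl _ (msupp g))).
rewrite (linextw _ (fsubsetUr (msupp f) _)) -big_split /=.
by apply: eq_bigr => x _; rewrite mcoeffD scalerDl.
Qed.

Lemma linextZ (U : lmodType F) (t : V -> U) c f :
  linext t (c *: f) = c *: linext t f.
Proof.
rewrite (linextw _ (msuppZ_le c f)) /linext scaler_sumr.
by apply: eq_bigr => x _; rewrite mcoeffZ scalerA.
Qed.

Lemma linext_expo (U : lmodType F) (t : V -> U) x : linext t (expo x) = t x.
Proof.
rewrite (linextw _ (msuppU_le : (msupp (expo x) `<=` [fset x])%fset)).
by rewrite big_seq_fset1 mcoeffUU scale1r.
Qed.

Lemma linext0 (U : lmodType F) (t : V -> U) : linext t 0 = 0.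
Proof. by rewrite /linext msupp0 big_seq_fset0. Qed.

Lemma linext_addfun (U : lmodType F) (t u : V -> U) f :
  linext (fun x => t x + u x) f = linext t f + linext u f.
Proof.
by rewrite /linext -big_split /=; apply: eq_bigr => x _; rewrite scalerDr.
Qed.

Lemma linext_scalefun (U : lmodType F) (t : V -> U) c f :
  linext (fun x => c *: t x) f = c *: linext t f.
Proof.
rewrite /linext scaler_sumr; apply: eq_bigr => x _.
by rewrite !scalerA mulrC.
Qed.

Lemma eq_linext (U : lmodType F) (t u : V -> U) f :
  (forall x, t x = u x) -> linext t f = linext u f.
Proof. by move=> tu; apply: eq_bigr => x _; rewrite tu. Qed.

Lemma linext_id f : linext expo f = f.
Proof.
rewrite {2}(monalgE (f : {malg F[V]})); apply: eq_bigr => x _.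
by apply/malgP => k; rewrite mcoeffZ !mcoeffU mulrnAr mulr1.
Qed.

Lemma gA_ind (P : A -> Prop) :
  P 0 -> (forall f g, P f -> P g -> P (f + g)) ->
  (forall c f, P f -> P (c *: f)) -> (forall x, P (expo x)) -> forall f, P f.
Proof.
move=> P0 PD PZ Px f; rewrite -(linext_id f).
by apply: (big_ind P) => // x _; apply/PZ/Px.
Qed.

Lemma gmulDl : left_distributive gmul +%R.
Proof. by move=> f g h; rewrite /gmul linextD. Qed.

Lemma gmulDr : right_distributive gmul +%R.
Proof.
move=> f g h; rewrite /gmul -linext_addfun.
by apply: eq_linext => x; rewrite linextD.
Qed.

Lemma gmulZl c f g : gmul (c *: f) g = c *: gmul f g.
Proof. by rewrite /gmul linextZ. Qed.

Lemma gmulZr c f g : gmul f (c *: g) = c *: gmul f g.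
Proof.
by rewrite /gmul -linext_scalefun; apply: eq_linext => x; rewrite linextZ.
Qed.

Lemma gmul0l g : gmul 0 g = 0.
Proof. by rewrite /gmul linext0. Qed.

Lemma gmul0r f : gmul f 0 = 0.
Proof. by have := gmulZr 0 f 0; rewrite !scale0r. Qed.

Lemma gmul_expo x y : gmul (expo x) (expo y) = expo (x + y).
Proof. by rewrite /gmul !linext_expo. Qed.

Lemma gmulA : associative gmul.
Proof.
move=> f g h; elim/gA_ind: f => [|f f' IH IH'|c f IH|x].
- by rewrite !gmul0l.
- by rewrite !gmulDl IH IH'.
- by rewrite !gmulZl IH.
elim/gA_ind: g => [|f f' IH IH'|c f IH|y].
- by rewrite !(gmul0l, gmul0r).
- by rewrite !(gmulDl, gmulDr) IH IH'.
- by rewrite !(gmulZl, gmulZr) IH.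
elim/gA_ind: h => [|f f' IH IH'|c f IH|z].
- by rewrite !(gmul0l, gmul0r).
- by rewrite !(gmulDl, gmulDr) IH IH'.
- by rewrite !(gmulZl, gmulZr) IH.
by rewrite !gmul_expo addrA.
Qed.

Lemma gmulC : commutative gmul.
Proof.
move=> f g; elim/gA_ind: f => [|f f' IH IH'|c f IH|x].
- by rewrite gmul0l gmul0r.
- by rewrite gmulDl gmulDr IH IH'.
- by rewrite gmulZl gmulZr IH.
elim/gA_ind: g => [|f f' IH IH'|c f IH|y].
- by rewrite gmul0l gmul0r.
- by rewrite gmulDl gmulDr IH IH'.
- by rewrite gmulZl gmulZr IH.
by rewrite !gmul_expo addrC.
Qed.

Lemma gmul1l : left_id (expo 0) gmul.
Proof.
move=> g; rewrite /gmul linext_expo -[RHS]linext_id.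
by apply: eq_linext => x; rewrite add0r.
Qed.

Lemma expo0_neq0 : expo 0 != 0.
Proof.
apply/eqP => /malgP/(_ 0); rewrite mcoeffUU mcoeff0.
by move/eqP; rewrite oner_eq0.
Qed.

HB.instance Definition _ := GRing.Zmodule_isComNzRing.Build A
  gmulA gmulC gmul1l gmulDl expo0_neq0.

HB.instance Definition _ := GRing.Lmodule_isLalgebra.Build F A
  (fun c f g => esym (gmulZl c f g)).

HB.instance Definition _ := GRing.Lalgebra_isComAlgebra.Build F A.

Lemma expoM x y : expo x * expo y = expo (x + y).
Proof. exact: gmul_expo. Qed.

Lemma expo1 : expo 0 = 1.
Proof. by []. Qed.

Lemma expoX x k : expo x ^+ k = expo (x *+ k).
Proof. by elim: k => [|k IH]; rewrite ?expr0 // exprS IH expoM mulrS. Qed.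

Definition supported (L : set V) f : Prop :=
  forall x, x \in msupp (f : {malg F[V]}) -> L x.

Definition component (L : set V) f : A :=
  linext (fun x => if `[< L x >] then expo x else 0) f.

Lemma mcoeff_mulexpo f y z :
  (f * expo y : {malg F[V]})@_z = (f : {malg F[V]})@_(z - y).
Proof.
elim/gA_ind: f => [|f g IH IH'|c f IH|x].
- by rewrite mul0r !mcoeff0.
- by rewrite mulrDl !mcoeffD IH IH'.
- by rewrite -scalerAl !mcoeffZ IH.
by rewrite expoM !mcoeffU [in RHS]eq_sym subr_eq eq_sym.
Qed.

(* The quotient f / g; it is unique when g = 1 - expo x with x of infinite order
   (see gdivP), the only case in which it is used. *)
Definition gdiv f g : A := xget 0 [set d : A | d * g = f].

Lemma sub1_expo_reg x f : (forall k, x *+ k = 0 -> k = 0%N) ->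
  f * (1 - expo x) = 0 -> f = 0.
Proof.
move=> xinf /eqP; rewrite mulrBr mulr1 subr_eq0 => /eqP fx.
have fxk k : f = f * expo (x *+ k).
  by elim: k => [|k IH]; rewrite ?mulr0n ?mulr1 // mulrSr -expoM mulrA -IH.
apply/malgP => z; rewrite mcoeff0; apply/eqP; apply: contraT => fz.
pose s := [seq z - x *+ k | k <- iota 0 #|` msupp (f : {malg F[V]})|.+1].
have us : uniq s.
  rewrite map_inj_uniq ?iota_uniq // => i j /addrI/oppr_inj.
  wlog le : i j / (i <= j)%N => [hw|] eij.
    by case/orP: (leq_total i j) => le; [|symmetry]; apply: hw.
  have /xinf : x *+ (j - i) = 0 by rewrite mulrnBr // eij subrr.
  by move/eqP; rewrite subn_eq0 => le'; apply/eqP; rewrite eqn_leq le le'.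
suff /(uniq_leq_size us) : {subset s <= msupp (f : {malg F[V]})}.
  by rewrite size_map size_iota ltnn.
move=> _ /mapP [k _ ->]; rewrite -mcoeff_neq0 -mcoeff_mulexpo -fxk.
exact: fz.
Qed.

Lemma gdivP x f g : (forall k, x *+ k = 0 -> k = 0%N) ->
  g * (1 - expo x) = f -> gdiv f (1 - expo x) = g.
Proof.
move=> xinf gf; have /= df : [set d : A | d * (1 - expo x) = f] (gdiv f (1 - expo x)).
  exact: (xgetI _ gf).
apply/eqP; rewrite -subr_eq0; apply/eqP/(sub1_expo_reg xinf).
by rewrite mulrBl df gf subrr.
Qed.

Lemma gdiv_expoP x k : (forall k, x *+ k = 0 -> k = 0%N) ->
  gdiv (1 - expo (x *+ k)) (1 - expo x) = \sum_(i < k) expo (x *+ i).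
Proof.
move=> xinf; apply: gdivP => //.
rewrite -expoX; under eq_bigr do rewrite -expoX.
by rewrite mulrC -[1 - expo x]opprB mulNr -subrX1 opprB.
Qed.

Lemma gdiv_expoN x k : (forall k, x *+ k = 0 -> k = 0%N) ->
  gdiv (1 - expo (- (x *+ k))) (1 - expo x) =
  - \sum_(i < k) expo (- (x *+ i.+1)).
Proof.
move=> xinf; apply: gdivP => //; rewrite -mulNrn -expoX.
under eq_bigr do rewrite -mulNrn -expoX exprS.
rewrite -mulr_sumr mulNr mulrAC mulrBr mulr1 expoM addNr expo1.
by rewrite -subrX1 opprB.
Qed.

End GroupAlgebra.

Section Euclidean.
Variables (R : realType) (E : vectType R) (dot : {dot E for idfun}).
Implicit Types (a b : 'Hom(E, R^o)) (x y : E).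

(* The norm on the dual of E is transported from E by the Riesz isomorphism. *)
Definition riesz a : E := xget 0 [set t | forall y, dot y t = a y].

Lemma rieszP a y : dot y (riesz a) = a y.
Proof.
pose fl t : {linear E -> R^o} := HB.pack (fun y : E => dot y t : R^o)
  (GRing.isLinear.Build R E R^o *:%R (fun y : E => dot y t : R^o)
     (fun c x z => linearPl dot t c x z)).
have lin : linear (fun t => linfun (fl t)).
  move=> c s t; apply/lfunP => x; rewrite add_lfunE scale_lfunE !lfunE /=.
  exact: linearPr.
pose F : {linear E -> 'Hom(E, R^o)} :=
  HB.pack (fun t => linfun (fl t)) (GRing.isLinear.Build _ _ _ _ _ lin).
have Fker : lker (linfun F) == 0%VS.
  rewrite -subv0; apply/subvP => t; rewrite memv_ker lfunE memv0 => /eqP Ft.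
  apply: contraT => /(neq0_dnorm_gt0 (s := dot)).
  by have := lfunE (fl t) t; rewrite [linfun _]Ft zero_lfunE /= => <-; rewrite ltxx.
have /memv_imgP[t _ ->] : a \in limg (linfun F).
  suff -> : limg (linfun F) = fullv by rewrite memvf.
  apply/eqP; rewrite eqEdim subvf /= -[X in (_ <= X)%N]add0n.
  have := limg_ker_dim (linfun F) fullv.
  by rewrite (eqP Fker) capv0 dimv0 => ->; rewrite !dimvf /dim /= muln1.
have Pt : [set u | forall x, dot x u = linfun F t x] t.
  by move=> x; rewrite (lfunE F) (lfunE (fl t)).
exact: (xgetI _ Pt).
Qed.

Definition dual_dot a b : R := dot (riesz a) (riesz b).

Definition coroot a : E := (2 / dual_dot a a) *: riesz a.

Lemma corootP a y : dot y (coroot a) = 2 * a y / dual_dot a a.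
Proof.
rewrite mulrAC -rieszP.
exact: (linearZr_LR dot y (2 / dual_dot a a) (riesz a)).
Qed.

Definition reflection a : 'End(E) := linfun (fun y => y - (a y : R) *: coroot a).

Lemma reflectionE a y : reflection a y = y - (a y : R) *: coroot a.
Proof.
have lin : linear (fun y => y - (a y : R) *: coroot a).
  move=> c x z; rewrite linearP (scalerDl _ (c * a x : R)) -scalerA.
  by rewrite scalerBr opprD addrACA.
pose l := GRing.isLinear.Build _ _ _ _ _ lin.
pose f : {linear E -> E} := HB.pack (fun y => y - (a y : R) *: coroot a) l.
exact: (lfunE f).
Qed.

Record rootSystem := RootSystem {
  rootset : {fset 'Hom(E, R^o)};
  rank : nat;
  simples : rank.-tuple 'Hom(E, R^o);
  roots_neq0 : 0 \notin rootset;
  roots_reflection : forall a b, a \in rootset -> b \in rootset ->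
    b - (b (coroot a) : R) *: a \in rootset;
  roots_integral : forall a b, a \in rootset -> b \in rootset ->
    (b (coroot a) : R) \is a Num.int;
  roots_reduced : forall a (c : R), a \in rootset -> c *: a \in rootset ->
    c = 1 \/ c = -1;
  roots_nonempty : rootset != fset0;
  roots_irreducible : forall A : {fset 'Hom(E, R^o)},
    (A `<=` rootset)%fset -> A != fset0 -> A != rootset ->
    exists a b, [/\ a \in A, b \in (rootset `\` A)%fset & dual_dot a b != 0];
  simple_roots : {subset simples <= rootset};
  simple_free : free simples;
  simple_base : forall a, a \in rootset -> exists k : 'I_rank -> nat,
    a = \sum_i tnth simples i *+ k i \/ a = - \sum_i tnth simples i *+ k i
}.

Variable Phi : rootSystem.
Implicit Types (w u : 'End(E)).

Definition posroots : {fset 'Hom(E, R^o)} :=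
  [fset a in rootset Phi |
    `[< exists k : 'I_(rank Phi) -> nat, a = \sum_i tnth (simples Phi) i *+ k i >]]%fset.

Definition negroots : {fset 'Hom(E, R^o)} := (rootset Phi `\` posroots)%fset.

Definition Eco : set E := [set y | forall a, a \in rootset Phi -> a y = 0].

Definition rho : E := 2^-1 *: \sum_(a <- posroots) coroot a.

Definition coroot_lattice : set E :=
  [set x | exists k : 'Hom(E, R^o) -> int, x = \sum_(a <- rootset Phi) coroot a *~ k a].

Definition weyl : set 'End(E) :=
  [set w | exists2 s : seq 'Hom(E, R^o), {subset s <= rootset Phi} &
    w = foldr (fun a u => (reflection a \o u)%VF) \1%VF s].

Definition simple_reflection (i : 'I_(rank Phi)) : 'End(E) :=
  reflection (tnth (simples Phi) i).

Definition word (s : seq 'I_(rank Phi)) : 'End(E) :=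
  foldr (fun i u => (simple_reflection i \o u)%VF) \1%VF s.

Definition is_reduced (s : seq 'I_(rank Phi)) : Prop :=
  forall t, word t = word s -> (size s <= size t)%N.

Definition reduced_word w : seq 'I_(rank Phi) :=
  xget [::] [set s | word s = w /\ is_reduced s].

Definition len w : nat := size (reduced_word w).

Definition longest (G : set 'End(E)) : 'End(E) :=
  xget \1%VF [set w | G w /\ forall u, G u -> (len u <= len w)%N].

Definition w0 : 'End(E) := longest weyl.

(* W acts on the dual by (w a)(y) = a (w^-1 y). *)
Definition inversions w : {fset 'Hom(E, R^o)} :=
  [fset a in posroots | (a \o w^-1)%VF \in negroots]%fset.

Definition stab y : set 'End(E) := [set w | weyl w /\ w y = y].

(* W^c, for c = y *)
Definition minreps y : set 'End(E) :=
  [set w | weyl w /\ forall u, stab y u -> (len w <= len (w \o u)%VF)%N].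

(* the factor w^c of w = w^c w_c, for c = y *)
Definition minrep y w : 'End(E) :=
  xget \1%VF [set u | minreps y u /\ exists2 x, stab y x & w = (u \o x)%VF].

Record metaplecticDatum := MetaplecticDatum {
  lattice : set E;
  lattice_fg : exists e : seq E, lattice =
    [set x | exists k : nat -> int, x = \sum_(i < size e) e`_i *~ k i];
  lattice_coroot : coroot_lattice `<=` lattice;
  lattice_integral : forall a x, a \in rootset Phi -> lattice x ->
    (a x : R) \is a Num.int;
  deg : nat;
  deg_gt0 : (0 < deg)%N;
  (* Only the values of Qform on the lattice matter. *)
  Qform : E -> rat;
  Bform x y : rat := Qform (x + y) - Qform x - Qform y;
  Qform_scale : forall x (k : int), lattice x ->
    Qform (x *~ k) = k%:~R ^+ 2 * Qform x;
  Bform_add : forall x y z, lattice x -> lattice y -> lattice z ->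
    Bform (x + y) z = Bform x z + Bform y z;
  Qform_neq0 : exists2 x, lattice x & Qform x != 0;
  Qform_weyl : forall w x, weyl w -> lattice x -> Qform (w x) = Qform x;
  Qform_int : forall x, coroot_lattice x -> Qform x \is a Num.int
}.

Variable M : metaplecticDatum.
Notation L := (lattice M).

Definition dominant : set E :=
  [set x | L x /\ forall i, 0 <= (tnth (simples Phi) i x : R)].

(* m(a) *)
Definition mult a : nat :=
  (deg M %/ gcdn (deg M) `|Num.floor (Qform M (coroot a))|)%N.

Definition mlattice : set E :=
  [set x | L x /\ forall a, a \in rootset Phi ->
    exists k : int, a x = (k * (mult a)%:Z)%:~R].

(* The pair (w, x) stands for the element y |-> w y + x of the semidirect
   product of W and mlattice. *)
Definition affweyl : set ('End(E) * E) :=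
  [set t | weyl t.1 /\ mlattice t.2].

Definition affact (t : 'End(E) * E) y : E := t.1 y + t.2.

Definition alcove : set E :=
  [set y | forall a, a \in posroots -> 0 < (a y : R) < (mult a)%:R].

Definition C0 : set E :=
  [set c | [/\ L c,
     forall a, a \in posroots -> 0 <= (a c : R) <= (mult a)%:R &
     [set t | affweyl t /\ affact t c = c] = [set (w, 0) | w in stab c]]].

Definition Omega : set ('End(E) * E) :=
  [set t | affweyl t /\ affact t @` alcove = alcove].

(* C is a set of representatives of C0 modulo Omega. *)
Definition orbit_representatives (C : set E) : Prop :=
  C `<=` C0 /\
  forall c, C0 c -> exists! c', C c' /\ exists2 t, Omega t & affact t c = c'.

Variable F : fieldType.

(* qq is the fixed square root of v, and gg j is g_j. *)
Record parameters := MetaplecticParams {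
  qq : F;
  qq_neq0 : qq != 0;
  gg : int -> F;
  gg_neq0 : forall j, gg j != 0;
  gg_dvd : forall j, ((deg M)%:Z %| j)%Z -> gg j = -1;
  gg_period : forall j, gg (j + (deg M)%:Z) = gg j;
  gg_inv : forall j, ~~ ((deg M)%:Z %| j)%Z ->
    gg j * gg ((deg M)%:Z - j) = (qq ^+ 2)^-1
}.

Variable P : parameters.
Notation q := (qq P).
Notation A := (groupAlgebra F E).
Implicit Types (f : A).

(* The index -B(x, coroot a) of g; it is an integer for x in the lattice. *)
Definition gB x a : F := gg P (- Num.floor (Bform M x (coroot a))).

(* h^{m,c}_v(w) *)
Definition hh c w : F :=
  (-1) ^+ len w * q ^+ len w * \prod_(a <- inversions w) gB c a.

Definition wact w f : A := linext (fun x => expo F (w x)) f.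

Definition iota f : A := linext (fun x => expo F (- x)) f.

(* pi^m_v(T_i) *)
Definition piT (i : 'I_(rank Phi)) f : A :=
  linext (fun x =>
    let a := tnth (simples Phi) i in
    let ax := Num.floor (a x : R) in
    let m := (mult a)%:Z in
    - q * gB x a *: expo F (simple_reflection i x)
    + (q - q^-1) *: (gdiv (1 - expo F (coroot a *~ ((ax %% m)%Z - ax)))
                          (1 - expo F (coroot a *~ m)) * expo F x)) f.

(* The braid relations make the choice of reduced word irrelevant. *)
Definition piTw w f : A := foldr piT f (reduced_word w).

(* The inverse of an operator T that is bijective on F[L]. *)
Definition opinv (T : A -> A) f : A :=
  xget 0 [set f' : A | supported L f' /\ T f' = f].

(* The action of 1^-_{W_c}.  Sums over subsets of W are the finitely supported
   sums of fsbigop; W is finite. *)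
Definition antisym c f : A :=
  \sum_(w \in stab c) ((-1) ^+ len w * q ^- len w) *: piTw w f.

(* F^c_{1^-}(u) *)
Definition FF c u : F :=
  hh c u * (q ^- len w0 * (q ^+ 2) ^+ len (longest (stab c))) * (-1) ^+ len u.

Variable rho' : E.

(* The operator T^m_{i,v} of the component Whittaker functions *)
Definition Tau (i : 'I_(rank Phi)) f : A :=
  - q *: (expo F rho' * opinv (piT i) (expo F (- rho') * f)).

Definition Tauw w f : A := foldr Tau f (reduced_word w).

(* The component Whittaker function at varpi^{rho'-mu} *)
Definition whittaker theta mu : A :=
  component [set theta - rho' + x | x in mlattice]
    (\sum_(w \in weyl) iota (Tauw w (iota (expo F (mu - rho'))))).

End Euclidean.

(* Main.v *)
Require Import Defs.
From HB Require Import structures.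
From mathcomp Require Import all_boot all_order all_algebra.
From mathcomp Require Import finmap monalg.
From mathcomp Require Import boolp classical_sets fsbigop reals.
From mathcomp Require Import ring lra zify.

Set Implicit Arguments.
Unset Strict Implicit.
Unset Printing Implicit Defensive.

Import Order.TTheory GRing.Theory Num.Theory.

Local Open Scope classical_set_scope.
Local Open Scope ring_scope.

(* The operators pi^m_v(T_i) are studied through a module on which the relations of the
   affine Hecke algebra are visible. Let H be the finite Hecke algebra and let F[E] (x) H, with
   coordinates indexed by W, be the module on which T_i acts by the Bernstein relation. For c in
   the closed alcove, the evaluation y^nu (x) T_w |-> h(w) y^(nu + w c) intertwines T_i with
   pi^m_v(T_i), so identities for the latter may be proved in the module.

   The braid relations hold there on F[L^m] (x) H: the difference D of the two sides satisfies
   D T_i = - T_l^-1 D, it carries translation by a fundamental coweight to another translation,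
   and it kills every 1 (x) T_w by induction on the length of w. Hence D = 0.

   The sum over W defining the Whittaker function becomes the antisymmetrizer
   S = sum_w (-q)^l(w) T_(i_1)^-1 ... T_(i_k)^-1 over reduced words. As T_i S = S T_i = - q^-1 S,
   the factor T_w' of y^(-mu) can be moved through S to the scalar side, and S (f (x) 1) is
   determined by its coordinate at w_0, which only the summand w_0 reaches. Two points of the closed
   alcove that are congruent modulo W and L^m are conjugate under Omega, so the component at theta
   is a sum over one coset of the stabilizer of - w_0 c, and the coset sum is evaluated by the
   eigenvector property of the antisymmetrizer of the stabilizer. *)

(** * Roots and words *)

(** Every T_w is defined along a chosen reduced word, so already splitting T_w along a factorization
    of w requires the braid relations. They are proved in the module because there F[L^m] and H are
    separate coordinates and no g_j occurs: all g_j enter through the weight h, whose product over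
    inversions accumulates the factor - q g that pi(T_i) produces at each step up in W. The
    coefficients of the module are F[E] and not F[L^m], because the fundamental coweight that tests
    the braid defect D is a real combination of two coroots and need not lie in L^m. The rule D T_i
    = - T_l^-1 D uses the quadratic relation alone. That D carries this coweight to a translation
    holds because moving it through half of a braid word replaces each T by its inverse, and D is
    unchanged by that replacement. The point - w_0 c and the element w_0 w' w_0 come from applying
    w_0 to the decomposition of w_0 mu and changing sign. Inversion followed by w_0 sends y^x to
    y^(- w_0 x) and commutes with pi(T_i) up to a permutation of the simple roots, which inversion
    alone does not. *)

Section Reflections.
Variables (R : realType) (E : vectType R) (dot : {dot E for idfun}).
Implicit Types (a b : 'Hom(E, R^o)) (x y : E).

Lemma lfunZ (V : vectType R) (f : 'Hom(E, V)) (k : R) x : f (k *: x) = k *: f x.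
Proof. exact: linearZ. Qed.

Lemma dotC x y : dot x y = dot y x.
Proof. by rewrite hermC expr0 mul1r. Qed.

Lemma eq_dotr x y : (forall t, dot t x = dot t y) -> x = y.
Proof.
move=> h; apply/eqP; rewrite -subr_eq0; apply: contraT => /(neq0_dnorm_gt0 (s := dot)).
by have /= -> := linearBr dot (x - y) x y; rewrite (h (x - y)) subrr ltxx.
Qed.

Lemma dual_dot_gt0 a : a != 0 -> 0 < dual_dot dot a a.
Proof.
move=> a0; apply: neq0_dnorm_gt0; apply: contra a0 => /eqP r0.
by apply/eqP/lfunP => y; rewrite zero_lfunE -(rieszP dot) r0 linear0r.
Qed.

Lemma coroot_self a : a != 0 -> a (coroot dot a) = 2 :> R.
Proof.
move=> /dual_dot_gt0/lt0r_neq0 h; rewrite -(rieszP dot) dotC corootP.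
by rewrite -(rieszP dot) -/(dual_dot dot a a) mulfK.
Qed.

Lemma comp_reflection a b :
  (a \o reflection dot b)%VF = a - (a (coroot dot b) : R) *: b.
Proof.
apply/lfunP => y; rewrite comp_lfunE reflectionE linearB linearZ !lfunE /=.
by rewrite opp_lfunE scale_lfunE; congr (_ - _); apply: mulrC.
Qed.

Lemma reflection_self a : a != 0 -> (a \o reflection dot a)%VF = - a.
Proof. by move=> a0; rewrite comp_reflection coroot_self // scaler_nat mulr2n opprD addrA subrr
  sub0r. Qed.

Lemma reflectionKx a x : a != 0 -> reflection dot a (reflection dot a x) = x.
Proof.
move=> a0; rewrite reflectionE.
have -> : a (reflection dot a x) = - a x.
  by rewrite -comp_lfunE reflection_self // opp_lfunE.
by rewrite scaleNr opprK reflectionE addrNK.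
Qed.

Lemma reflectionK a : a != 0 -> (reflection dot a \o reflection dot a)%VF = \1%VF.
Proof. by move=> a0; apply/lfunP => x; rewrite comp_lfunE reflectionKx // id_lfunE. Qed.

Lemma reflection_adj a x y : dot (reflection dot a x) y = dot x (reflection dot a y).
Proof.
rewrite !reflectionE linearBl linearBr; congr (_ - _).
rewrite (linearZl_LR dot y (a x : R)) (linearZr_LR dot x (a y : R)) /=.
by rewrite corootP dotC corootP /=; ring.
Qed.

Lemma riesz_comp a b :
  riesz dot (a \o reflection dot b)%VF = reflection dot b (riesz dot a).
Proof. by apply: eq_dotr => t; rewrite rieszP comp_lfunE -reflection_adj rieszP. Qed.

Lemma coroot_comp a b : b != 0 ->
  coroot dot (a \o reflection dot b)%VF = reflection dot b (coroot dot a).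
Proof.
move=> b0; rewrite /coroot linearZ /= -riesz_comp /dual_dot.
by rewrite !riesz_comp reflection_adj reflectionKx.
Qed.

Lemma reflection_conj a b : b != 0 ->
  reflection dot (a \o reflection dot b)%VF =
  (reflection dot b \o reflection dot a \o reflection dot b)%VF.
Proof.
move=> b0; apply/lfunP => y.
rewrite reflectionE coroot_comp // !comp_lfunE.
by rewrite [reflection dot a _]reflectionE linearB /= [in RHS]lfunZ reflectionKx.
Qed.

Lemma rieszD a b : riesz dot (a + b) = riesz dot a + riesz dot b.
Proof. apply: eq_dotr => t; have /= -> := linearDr dot t (riesz dot a) (riesz dot b).
by rewrite !rieszP add_lfunE. Qed.

Lemma rieszZ (k : R) a : riesz dot (k *: a) = k *: riesz dot a.
Proof.
apply: eq_dotr => t.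
by rewrite (linearZr_LR dot t k) !rieszP /= rieszP scale_lfunE.
Qed.

Lemma rieszN a : riesz dot (- a) = - riesz dot a.
Proof. by rewrite -scaleN1r rieszZ scaleN1r. Qed.

Lemma dual_dotE a b : dual_dot dot a b = a (riesz dot b).
Proof. by rewrite /dual_dot dotC rieszP. Qed.

Lemma dual_dotC a b : dual_dot dot a b = dual_dot dot b a.
Proof. exact: dotC. Qed.

Lemma apply_coroot a b : a (coroot dot b) = 2 * dual_dot dot a b / dual_dot dot b b :> R.
Proof. by rewrite /coroot linearZ /= -dual_dotE mulrAC. Qed.

Lemma corootN a : coroot dot (- a) = - coroot dot a.
Proof.
by rewrite /coroot /dual_dot rieszN linearNl linearNr opprK scalerN.
Qed.

Lemma reflectionN a : reflection dot (- a) = reflection dot a.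
Proof.
by apply/lfunP => x; rewrite !reflectionE corootN opp_lfunE scalerN scaleNr opprK.
Qed.

End Reflections.

Section Roots.
Variables (R : realType) (E : vectType R) (dot : {dot E for idfun}).
Variable Phi : rootSystem dot.
Implicit Types (a b : 'Hom(E, R^o)) (x y : E) (w u : 'End(E)) (i j k : 'I_(rank Phi)).
Local Notation sr i := (tnth (simples Phi) i).
Local Notation Root := (rootset Phi).

Lemma root_neq0 a : a \in Root -> a != 0.
Proof. by move=> ra; apply: contraNneq (roots_neq0 Phi) => <-. Qed.

Lemma simple_root i : sr i \in Root.
Proof. by apply: simple_roots; apply: mem_tnth. Qed.

Lemma simple_neq0 i : sr i != 0.
Proof. exact: root_neq0 (simple_root i). Qed.

Lemma root_comp a b : a \in Root -> b \in Root ->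
  (a \o reflection dot b)%VF \in Root.
Proof. by move=> ra rb; rewrite comp_reflection roots_reflection. Qed.

Lemma rootN a : a \in Root -> - a \in Root.
Proof. by move=> ra; rewrite -(reflection_self dot) ?root_neq0 // root_comp. Qed.

(** Linear in the root: positivity becomes the sign of one real number ([pos_ht]), and this survives
    composition with elements of W ([ht_natcomp]). *)
Definition height a : R := \sum_i coord (simples Phi) i a.

Lemma htD a b : height (a + b) = height a + height b.
Proof. by rewrite /height -big_split; apply: eq_bigr => i _; rewrite linearD. Qed.

Lemma htZ (k : R) a : height (k *: a) = k * height a.
Proof. by rewrite /height mulr_sumr; apply: eq_bigr => i _; rewrite linearZ. Qed.

Lemma ht_natcomp (k : 'I_(rank Phi) -> nat) w :
  height ((\sum_i sr i *+ k i) \o w)%VF = \sum_i (k i)%:R * height (sr i \o w)%VF.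
Proof.
have -> : ((\sum_i sr i *+ k i) \o w)%VF = \sum_i (k i)%:R *: (sr i \o w)%VF.
  apply/lfunP => y; rewrite comp_lfunE !sum_lfunE; apply: eq_bigr => i _.
  by rewrite -scaler_nat !scale_lfunE comp_lfunE.
elim/big_ind2: _ => [|b x b' x' <- <-|i _]; last exact: htZ.
  by rewrite /height big1 // => i _; rewrite linear0.
by rewrite htD.
Qed.

Lemma htN a : height (- a) = - height a.
Proof. by rewrite -scaleN1r htZ mulN1r. Qed.

Lemma coord_simple i j : coord (simples Phi) j (sr i) = (i == j)%:R.
Proof. by rewrite (tnth_nth 0) coord_free // simple_free. Qed.

Lemma ht_simple i : height (sr i) = 1.
Proof.
rewrite /height (bigD1 i) //= coord_simple eqxx big1 ?addr0 // => j ji.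
by rewrite coord_simple eq_sym (negbTE ji).
Qed.

Lemma simple_inj i j : sr i = sr j -> i = j.
Proof.
move=> h; have := coord_simple i j; rewrite h coord_simple eqxx.
by case: eqP => // _ /eqP; rewrite oner_eq0.
Qed.

Lemma coord_natsum (k : 'I_(rank Phi) -> nat) j :
  coord (simples Phi) j (\sum_i sr i *+ k i) = (k j)%:R.
Proof.
rewrite linear_sum (bigD1 j) //= raddfMn /= coord_simple eqxx big1 ?addr0 // => i ij.
by rewrite raddfMn /= coord_simple (negbTE ij) mul0rn.
Qed.

Lemma ht_natsum (k : 'I_(rank Phi) -> nat) :
  height (\sum_i sr i *+ k i) = (\sum_i k i)%:R.
Proof. by rewrite /height natr_sum; apply: eq_bigr => j _; rewrite coord_natsum. Qed.

Lemma posrootP a : reflect (a \in Root /\ exists k : 'I_(rank Phi) -> nat,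
    a = \sum_i sr i *+ k i) (a \in posroots Phi).
Proof.
rewrite /posroots !inE /=; apply: (iffP andP) => [[ra /asboolP h]|[ra h]]; split => //.
exact/asboolP.
Qed.

Lemma pos_root a : a \in posroots Phi -> a \in Root.
Proof. by case/posrootP. Qed.

Lemma root_natsum_gt0 (k : 'I_(rank Phi) -> nat) :
  \sum_i sr i *+ k i != 0 -> (0 < \sum_i k i)%N.
Proof.
apply: contraR; rewrite -leqNgt leqn0 sum_nat_eq0 => /forallP k0.
by rewrite big1 // => i _; rewrite (eqP (k0 i)).
Qed.

Lemma pos_ht a : (a \in posroots Phi) = (a \in Root) && (0 < height a).
Proof.
apply/posrootP/andP => -[ra].
  move=> [k ak]; split=> //; rewrite ak ht_natsum ltr0n root_natsum_gt0 //.
  by rewrite -ak root_neq0.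
move=> h; split=> //; have [k [->|ak]] := simple_base ra; first by exists k.
by move: h; rewrite ak htN ht_natsum oppr_gt0 ltrn0.
Qed.

Lemma neg_ht a : (a \in negroots Phi) = (a \in Root) && (height a < 0).
Proof.
rewrite /negroots inE pos_ht andbC; case ra: (a \in Root) => //=.
rewrite -leNgt le_eqVlt; case: eqP => //= h.
have [k [ak|ak]] := simple_base ra.
  by have := pos_ht a; move: h; rewrite ak ht_natsum => /eqP; rewrite pnatr_eq0 -leqn0 leqNgt
    root_natsum_gt0 // -ak root_neq0.
move: h; rewrite ak htN ht_natsum => /eqP; rewrite oppr_eq0 pnatr_eq0 -leqn0 leqNgt.
by rewrite root_natsum_gt0 // -oppr_eq0 -ak root_neq0.
Qed.

Lemma root_ht a : a \in Root -> (0 < height a) || (height a < 0).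
Proof.
move=> ra; have := neg_ht a; rewrite /negroots inE pos_ht ra andbT /= => <-.
by rewrite orbN.
Qed.

Lemma pos_simple i : sr i \in posroots Phi.
Proof. by rewrite pos_ht simple_root ht_simple ltr01. Qed.

Lemma pos_ht_ge1 a : a \in posroots Phi -> 1 <= height a.
Proof.
move=> pa; have := pa; rewrite pos_ht => /andP[_].
by case/posrootP: pa => _ [k ->]; rewrite ht_natsum ltr0n -(ler_nat R).
Qed.

Lemma posN a : a \in Root -> (- a \in posroots Phi) = (a \notin posroots Phi).
Proof.
move=> ra; rewrite !pos_ht ra rootN //= htN oppr_gt0.
by have := root_ht ra; case: ltgtP.
Qed.

Lemma negE a : a \in Root -> (a \in negroots Phi) = (a \notin posroots Phi).
Proof. by move=> ra; rewrite /negroots inE ra andbT. Qed.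

(** The reflection changes only the coordinate at i, so a positive coordinate elsewhere keeps the
    root positive. With none elsewhere, reducedness leaves only [sr i] itself. *)
Lemma pos_simple_comp i a : a \in posroots Phi -> a != sr i ->
  (a \o simple_reflection i)%VF \in posroots Phi.
Proof.
move=> pa ai; have ra := pos_root pa; case/posrootP: (pa) => _ [k ak].
have rb : (a \o simple_reflection i)%VF \in Root by rewrite root_comp // simple_root.
have [[j ji kj]|h] := pselect (exists2 j, j != i & (0 < k j)%N).
  have cj : coord (simples Phi) j (a \o simple_reflection i)%VF = (k j)%:R.
    rewrite comp_reflection linearB linearZ /= coord_simple eq_sym (negbTE ji).
    by rewrite mulr0 subr0 ak coord_natsum.
  case: (simple_base rb) => l [bl|bl].
    by apply/posrootP; split=> //; exists l.
  move: cj; rewrite bl raddfN /= coord_natsum => /eqP.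
  by rewrite -subr_eq0 -opprD oppr_eq0 -natrD pnatr_eq0 addn_eq0 (gtn_eqF kj) andbF.
have ak' : a = (k i)%:R *: sr i.
  rewrite ak (bigD1 i) //= big1 ?addr0 ?scaler_nat // => j ji.
  by case: (posnP (k j)) => [->|kj] //; case: h; exists j.
have rk : (k i)%:R *: sr i \in Root by rewrite -ak'.
have [k1|k1] := roots_reduced (simple_root i) rk.
  by move: ai; rewrite ak' k1 scale1r eqxx.
by have := ler0n R (k i); rewrite k1 lerNr oppr0 ler10.
Qed.

Lemma comp_simpleK i a : ((a \o simple_reflection i) \o simple_reflection i)%VF = a.
Proof. by rewrite -comp_lfunA reflectionK ?simple_neq0 // comp_lfun1r. Qed.

Lemma simple_comp_self i : (sr i \o simple_reflection i)%VF = - sr i.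
Proof. by rewrite reflection_self // simple_neq0. Qed.

Lemma pos_simple_comp_eq i a : a \in Root -> a != sr i -> a != - sr i ->
  ((a \o simple_reflection i)%VF \in posroots Phi) = (a \in posroots Phi).
Proof.
move=> ra ai aNi; apply/idP/idP => [h|h]; last exact: pos_simple_comp.
rewrite -(comp_simpleK i a); apply: pos_simple_comp => //.
apply: contra aNi => /eqP h2; rewrite -simple_comp_self -h2 comp_simpleK //.
Qed.

End Roots.

(** * Words, length, inversions and the exchange condition *)

Section Words.
Variables (R : realType) (E : vectType R) (dot : {dot E for idfun}).
Variable Phi : rootSystem dot.
Implicit Types (a b : 'Hom(E, R^o)) (x y : E) (w u : 'End(E)) (i j k : 'I_(rank Phi)).
Implicit Types (s t : seq 'I_(rank Phi)).
Local Notation sr i := (tnth (simples Phi) i).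
Local Notation Root := (rootset Phi).
Local Notation pos := (posroots Phi).
Local Notation sS := (@simple_reflection R E dot Phi).

Local Notation len := (len Phi).
Local Notation reduced_word := (reduced_word Phi).

Lemma simpleK i : (sS i \o sS i)%VF = \1%VF.
Proof. by rewrite reflectionK // simple_neq0. Qed.

Lemma simpleKl i u : (sS i \o (sS i \o u))%VF = u.
Proof. by rewrite comp_lfunA simpleK comp_lfun1l. Qed.

Lemma word_cons i s : word (i :: s) = (sS i \o word s)%VF.
Proof. by []. Qed.

Lemma word_cat s t : word (s ++ t) = (word s \o word t)%VF.
Proof. by elim: s => [|i s IH]; rewrite ?comp_lfun1l //= IH comp_lfunA. Qed.

Lemma word1 i : word [:: i] = sS i.
Proof. by rewrite word_cons comp_lfun1r. Qed.

Lemma word_rcons s i : word (rcons s i) = (word s \o sS i)%VF.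
Proof. by rewrite -cats1 word_cat word1. Qed.

Lemma word_revK s : (word (rev s) \o word s)%VF = \1%VF.
Proof.
elim: s => [|i s IH]; first by rewrite comp_lfun1l.
by rewrite rev_cons word_rcons word_cons -comp_lfunA simpleKl.
Qed.

Lemma word_Krev s : (word s \o word (rev s))%VF = \1%VF.
Proof. by rewrite -{1}(revK s) word_revK. Qed.

Lemma word_rev_inv s u : word s = u -> u^-1%VF = word (rev s).
Proof.
move=> <-; have li : lker (word s) == 0%VS.
  apply/lker0P => x y h.
  by rewrite -(id_lfunE x) -(id_lfunE y) -(word_revK s) !comp_lfunE h.
by rewrite -[RHS](lker0_compKf li) word_Krev comp_lfun1r.
Qed.

Lemma root_word a s : a \in Root -> (a \o word s)%VF \in Root.
Proof.
elim: s a => [|i s IH] a ra; first by rewrite comp_lfun1r.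
by rewrite word_cons comp_lfunA IH // root_comp // simple_root.
Qed.

Lemma coroot_word a s : coroot dot (a \o word s)%VF = word (rev s) (coroot dot a).
Proof.
elim: s a => [|i s IH] a; first by rewrite comp_lfun1r id_lfunE.
rewrite word_cons comp_lfunA IH rev_cons word_rcons comp_lfunE coroot_comp //.
exact: simple_neq0.
Qed.

Lemma reflection_word a s : reflection dot (a \o word s)%VF =
  (word (rev s) \o reflection dot a \o word s)%VF.
Proof.
elim: s a => [|i s IH] a; first by rewrite !comp_lfun1r comp_lfun1l.
rewrite word_cons comp_lfunA IH rev_cons word_rcons reflection_conj ?simple_neq0 //.
by rewrite !comp_lfunA.
Qed.

Definition isW w := exists s, word s = w.

Lemma isW_word s : isW (word s). Proof. by exists s. Qed.
Lemma isW1 : isW \1%VF. Proof. by exists [::]. Qed.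
Lemma isW_simple i : isW (sS i). Proof. by exists [:: i]; rewrite word1. Qed.
Lemma isWM w u : isW w -> isW u -> isW (w \o u)%VF.
Proof. by move=> [s <-] [t <-]; exists (s ++ t); rewrite word_cat. Qed.
Lemma isWV w : isW w -> isW (w^-1)%VF.
Proof. by move=> [s sw]; exists (rev s); rewrite (word_rev_inv sw). Qed.
Lemma isW_KV w : isW w -> (w \o w^-1)%VF = \1%VF.
Proof. by move=> [s <-]; rewrite (word_rev_inv erefl) word_Krev. Qed.
Lemma isW_VK w : isW w -> (w^-1 \o w)%VF = \1%VF.
Proof. by move=> [s <-]; rewrite (word_rev_inv erefl) word_revK. Qed.
Lemma isW_simpleM i w : isW w -> isW (sS i \o w)%VF.
Proof. exact/isWM/isW_simple. Qed.
Lemma isW_root a w : isW w -> a \in Root -> (a \o w)%VF \in Root.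
Proof. by move=> [s <-]; apply: root_word. Qed.
Lemma isW_invV w : isW w -> (w^-1^-1)%VF = w.
Proof. by move=> [s <-]; rewrite (word_rev_inv erefl) (word_rev_inv erefl) revK. Qed.
Lemma isW_invM w u : isW w -> isW u -> ((w \o u)^-1)%VF = (u^-1 \o w^-1)%VF.
Proof.
move=> [s <-] [t <-]; rewrite -word_cat !(word_rev_inv erefl).
by rewrite rev_cat word_cat.
Qed.
Lemma simple_inv i : (sS i)^-1%VF = sS i.
Proof. by rewrite (word_rev_inv (word1 i)) word1. Qed.

(** As b has positive norm, some simple coroot pairs positively with it, and reflecting there lowers
    the height. It follows that the simple reflections generate W ([weylE]). *)
Lemma posroot_simple b : b \in pos -> exists s i, b = (sr i \o word s)%VF.
Proof.
move=> pb; have [n hn] : exists n : nat, height Phi b = n%:R.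
  by case/posrootP: pb => _ [k ->]; rewrite ht_natsum; eexists.
elim/ltn_ind: n b pb hn => n IH b pb hn.
have [[i bi]|ns] := pselect (exists i, b = sr i).
  by exists [::], i; rewrite comp_lfun1r.
have rb := pos_root pb; case/posrootP: (pb) => _ [k bk].
have [i hi] : exists i, 0 < (b (coroot dot (sr i)) : R).
  apply: contrapT => h; have := dual_dot_gt0 dot (root_neq0 rb).
  rewrite {1}bk dual_dotE sum_lfunE ltNge => /negP; apply.
  apply: sumr_le0 => i _; rewrite -scaler_nat scale_lfunE /=.
  rewrite -dual_dotE dual_dotC.
  apply: mulr_ge0_le0; first by rewrite ler0n.
  rewrite leNgt; apply/negP => h2; apply: h; exists i.
  rewrite apply_coroot divr_gt0 ?dual_dot_gt0 ?simple_neq0 //.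
  by rewrite mulr_gt0.
have pbi : (b \o sS i)%VF \in pos.
  by apply: pos_simple_comp => //; apply: contra_notN ns => /eqP ->; exists i.
have hb : height Phi (b \o sS i)%VF = height Phi b - b (coroot dot (sr i)).
  by rewrite comp_reflection -scaleNr htD htZ ht_simple mulr1.
have [n' hn'] : exists n' : nat, height Phi (b \o sS i)%VF = n'%:R.
  by case/posrootP: (pbi) => _ [l ->]; rewrite ht_natsum; eexists.
have nn : (n' < n)%N by rewrite -(ltr_nat R) -hn' -hn hb ltrBlDr ltrDl.
have [s [j e]] := IH _ nn _ pbi hn'.
by exists (rcons s i), j; rewrite word_rcons comp_lfunA -e comp_simpleK.
Qed.

Lemma isW_reflection b : b \in Root -> isW (reflection dot b).
Proof.
move=> rb; wlog pb : b rb / b \in pos => [hw|].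
  have [pb|] := boolP (b \in pos); first exact: hw.
  by rewrite -posN // => pb; rewrite -reflectionN; apply: hw; rewrite ?rootN.
have [s [i ->]] := posroot_simple pb; rewrite reflection_word.
by do 2?[apply: isWM]; [exact: isW_word|exact: isW_simple|exact: isW_word].
Qed.

Lemma weylE w : weyl Phi w <-> isW w.
Proof.
split.
  move=> [s hs ->]; elim: s hs => [|b s IH] hs; first exact: isW1.
  apply: isWM; first by apply: isW_reflection; apply: hs; rewrite mem_head.
  by apply: IH => c cs; apply: hs; rewrite inE cs orbT.
move=> [s <-]; exists [seq sr i | i <- s].
  by move=> a /mapP[i _ ->]; apply: simple_root.
by elim: s => //= i s <-.
Qed.

(** Roots are moved by precomposition, so for w in W these are the [inversions] of the inverse of w.
    In this form left multiplication by a letter acts on the set directly. *)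
Definition left_inversions w := [fset a in pos | (a \o w)%VF \notin pos]%fset.

Definition num_left_inversions w : nat := #|` left_inversions w|.

Lemma in_negset w a : (a \in left_inversions w) = (a \in pos) && ((a \o w)%VF \notin pos).
Proof. by rewrite /left_inversions; move: pos => p; rewrite !inE. Qed.

Lemma nneg1 : num_left_inversions \1%VF = 0%N.
Proof.
apply/eqP; rewrite cardfs_eq0; apply/eqP/fsetP => a; rewrite in_negset comp_lfun1r andbN.
by rewrite in_fset0.
Qed.

(** The reflection s_i carries the set for w bijectively onto the set for s_i w without its one new
    member, the simple root itself. *)
Lemma nneg_up i w : isW w -> (sr i \o w)%VF \in pos -> num_left_inversions (sS i \o w)%VF =
  (num_left_inversions w).+1.
Proof.
move=> Ww pi; rewrite /num_left_inversions.
pose f (a : 'Hom(E, R^o)) := (a \o sS i)%VF.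
have fK : involutive f by move=> a; apply: comp_simpleK.
have -> : left_inversions (sS i \o w)%VF = (sr i |` [fset f a | a in left_inversions w])%fset.
  apply/fsetP => a; rewrite in_fset1U in_negset comp_lfunA -/(f a).
  have -> : (a \in [fset f a | a in left_inversions w])%fset =
            (f a \in pos) && ((f a \o w)%VF \notin pos).
    apply/imfsetP/idP => [[b /=]|h]; last by exists (f a); rewrite ?fK //= in_negset.
    by rewrite in_negset => h ->; rewrite fK.
  have [->|ai] := eqVneq a (sr i) => /=.
    rewrite pos_simple /= /f simple_comp_self comp_lfunNl posN; last exact: isW_root (simple_root
      i).
    by rewrite pi.
  apply/andP/andP => -[h1 h2]; split=> //; first exact: pos_simple_comp.
  rewrite -(fK a); apply: pos_simple_comp => //; apply: contra h2 => /eqP ->; exact: pi.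
rewrite cardfsU1; have -> : (sr i \notin [fset f a | a in left_inversions w])%fset.
  apply/negP => /imfsetP[b /=]; rewrite in_negset => /andP[pb _] e.
  have : f (sr i) = b by rewrite e fK.
  by rewrite /f simple_comp_self => e2; move: pb; rewrite -e2 posN ?simple_root // pos_simple.
by rewrite card_imfset //; apply: inv_inj.
Qed.

Lemma nneg_down i w : isW w -> (sr i \o w)%VF \notin pos -> num_left_inversions w =
  (num_left_inversions (sS i \o w)%VF).+1.
Proof.
move=> Ww pi; rewrite -{1}(simpleKl i w) nneg_up //; first exact: isW_simpleM.
by rewrite comp_lfunA simple_comp_self comp_lfunNl posN // isW_root // simple_root.
Qed.

Lemma nneg_word s : (num_left_inversions (word s) <= size s)%N.
Proof.
elim: s => [|i s IH]; first by rewrite nneg1.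
rewrite word_cons; have [pi|pi] := boolP ((sr i \o word s)%VF \in pos).
  by rewrite nneg_up //; exact: isW_word.
by have := nneg_down (isW_word s) pi; move: IH => /=; lia.
Qed.

Lemma cat_cut (T : Type) (s1 s2 t t' : seq T) (k : T) : s1 ++ s2 = t ++ k :: t' ->
  (exists r, s1 = t ++ k :: r /\ t' = r ++ s2) \/
  (exists r, t = s1 ++ r /\ s2 = r ++ k :: t').
Proof.
elim: s1 t => [|x s1 IH] [|y t] /= e; try by right; eexists.
  by case: e => -> <-; left; exists s1.
case: e => -> /IH[[r [-> ->]]|[r [-> ->]]]; first by left; exists r.
by right; exists r.
Qed.

Lemma simple_word_conj i k s : (sr i \o word s)%VF = sr k ->
  (sS i \o word s)%VF = (word s \o sS k)%VF.
Proof.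
move=> h; have := reflection_word (sr i) s; rewrite h -/(sS k) => ->.
by rewrite !comp_lfunA word_Krev comp_lfun1l.
Qed.

(** Carried through the word, the simple root first turns negative at some letter k, just before
    which it equals [sr k]. There s_i passes the prefix as s_k and cancels that letter. *)
Lemma exchange i s : (sr i \o word s)%VF \notin pos ->
  exists t k t', s = t ++ k :: t' /\ (sS i \o word s)%VF = word (t ++ t').
Proof.
elim/last_ind: s => [|s k IH]; first by rewrite comp_lfun1r pos_simple.
rewrite word_rcons comp_lfunA.
have [pi|/IH[t [l [t' [-> e]]]]] := boolP ((sr i \o word s)%VF \in pos).
  move=> h; have e : (sr i \o word s)%VF = sr k.
    by apply/eqP; apply: contraR h => h; apply: pos_simple_comp.
  exists s, k, [::]; split; first by rewrite cats1.
  by rewrite cats0 comp_lfunA (simple_word_conj e) -comp_lfunA simpleK comp_lfun1r.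
move=> _; exists t, l, (rcons t' k); split; first by rewrite rcons_cat.
by rewrite comp_lfunA e -word_rcons rcons_cat.
Qed.

Lemma reduced_exists s : exists t, word t = word s /\ size t = num_left_inversions (word s).
Proof.
elim: s => [|i s [t [et st]]]; first by exists [::]; rewrite nneg1.
rewrite word_cons; have [pi|pi] := boolP ((sr i \o word s)%VF \in pos).
  by exists (i :: t); rewrite word_cons et nneg_up //= ?st //; exact: isW_word.
rewrite -et in pi *; have [u [k [u' [tu e]]]] := exchange pi.
exists (u ++ u'); split; first by rewrite -e.
have := nneg_down (isW_word t) pi; rewrite et -st tu !size_cat /=; lia.
Qed.

Lemma reducedE s : is_reduced s <-> size s = num_left_inversions (word s).
Proof.
split=> [h|h t e]; last by rewrite h -e nneg_word.
have [t [e st]] := reduced_exists s; apply/eqP; rewrite eqn_leq nneg_word andbT.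
by rewrite -st; apply: h.
Qed.

Lemma reduced_wordP w : isW w -> word (reduced_word w) = w /\ size (reduced_word w) =
  num_left_inversions w.
Proof.
move=> [s sw]; have [t [et st]] := reduced_exists s.
have : [set s | word s = w /\ is_reduced s] t.
  by split; [rewrite et|apply/reducedE; rewrite et].
by move=> /(xgetI [::]) [e /reducedE]; rewrite e.
Qed.

Lemma word_reduced w : isW w -> word (reduced_word w) = w.
Proof. by case/reduced_wordP. Qed.

Lemma lenE w : isW w -> len w = num_left_inversions w.
Proof. by case/reduced_wordP. Qed.

Lemma len_word s : (len (word s) <= size s)%N.
Proof. by rewrite lenE ?nneg_word //; exact: isW_word. Qed.

Lemma reduced_len s : is_reduced s <-> size s = len (word s).
Proof. by rewrite lenE; [exact: reducedE|exact: isW_word]. Qed.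

Lemma len1 : len (\1%VF : 'End(E)) = 0%N.
Proof. by rewrite (lenE isW1) nneg1. Qed.

Lemma len_up i w : isW w -> (sr i \o w)%VF \in pos -> len (sS i \o w)%VF = (len w).+1.
Proof. by move=> Ww pi; rewrite !lenE ?nneg_up //; apply: isW_simpleM. Qed.

Lemma len_down i w : isW w -> (sr i \o w)%VF \notin pos -> len w = (len (sS i \o w)%VF).+1.
Proof. by move=> Ww pi; rewrite !lenE -?nneg_down //; apply: isW_simpleM. Qed.

Lemma lenV w : isW w -> len (w^-1)%VF = len w.
Proof.
have le u : isW u -> (len (u^-1)%VF <= len u)%N.
  move=> Wu; have [e h] := reduced_wordP Wu.
  by rewrite (word_rev_inv e) (leq_trans (len_word _)) // size_rev.
move=> Ww; apply/eqP; rewrite eqn_leq le //=.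
by rewrite -{1}(isW_invV Ww) le //; apply: isWV.
Qed.

Lemma reduced_cons i s : is_reduced (i :: s) <-> is_reduced s /\ (sr i \o word s)%VF \in pos.
Proof.
rewrite !reducedE word_cons /=.
have [pi|pi] := boolP ((sr i \o word s)%VF \in pos).
  rewrite nneg_up //; [|exact: isW_word]; split=> [[]|[->]] //.
have := nneg_down (isW_word s) pi; have := nneg_word s.
by move=> h1 h2; split=> [h|[]//]; lia.
Qed.

Lemma isW_simple_pos w : isW w -> (forall i, (sr i \o w)%VF \in pos) -> w = \1%VF.
Proof.
move=> Ww h; have [e _] := reduced_wordP Ww; have := e.
case er : (reduced_word w) => [|i s] // ew; have : is_reduced (i :: s).
  by apply/reducedE; rewrite ew -er; case: (reduced_wordP Ww).
move=> /reduced_cons[_ p]; have := h i; rewrite -ew word_cons comp_lfunA simple_comp_self.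
by rewrite comp_lfunNl posN ?root_word ?simple_root // p.
Qed.

Lemma pos_up i w : isW w -> ((sr i \o w)%VF \in pos) = (len w < len (sS i \o w)%VF)%N.
Proof.
move=> Ww; have [pi|pi] := boolP ((sr i \o w)%VF \in pos).
  by rewrite len_up // ltnS leqnn.
by rewrite (len_down Ww pi) ltnNge leqnSn.
Qed.

Lemma reduced_reduced_word w : isW w -> is_reduced (reduced_word w).
Proof. by move=> Ww; apply/reducedE; have [-> ->] := reduced_wordP Ww. Qed.

End Words.

(** * Pairs of simple roots, the longest element, stabilizers of dominant points *)

Section Parabolic.
Variables (R : realType) (E : vectType R) (dot : {dot E for idfun}).
Variable Phi : rootSystem dot.
Implicit Types (a b : 'Hom(E, R^o)) (x y : E) (w u : 'End(E)) (i j k : 'I_(rank Phi)).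
Implicit Types (s t : seq 'I_(rank Phi)).
Local Notation sr i := (tnth (simples Phi) i).
Local Notation Root := (rootset Phi).
Local Notation pos := (posroots Phi).
Local Notation sS := (@simple_reflection R E dot Phi).
Local Notation len := (len Phi).
Local Notation reduced_word := (reduced_word Phi).
Local Notation isW := (isW Phi).

Definition cartan i k : R := sr i (coroot dot (sr k)).

Lemma cart_self i : cartan i i = 2.
Proof. by rewrite /cartan coroot_self // simple_neq0. Qed.

Lemma simple_comp i k : (sr i \o sS k)%VF = sr i - cartan i k *: sr k.
Proof. exact: comp_reflection. Qed.

Lemma cart_le0 i k : i != k -> exists p : nat, cartan i k = - p%:R.
Proof.
move=> ik; have p : (sr i \o sS k)%VF \in pos.
  by apply: pos_simple_comp; [exact: pos_simple|apply: contra ik => /eqP/simple_inj ->].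
case/posrootP: p => _ [l e]; exists (l k).
rewrite -coord_natsum -e simple_comp linearB linearZ /= !coord_simple eqxx.
by rewrite (negbTE ik) mulr1 sub0r opprK.
Qed.

(** The bound p q < 4 is the strict Cauchy-Schwarz inequality, and p and q vanish together. *)
Lemma cart_pairs i k : i != k -> exists p q : nat,
  [/\ cartan i k = - p%:R, cartan k i = - q%:R &
   (p, q) \in [:: (0, 0); (1, 1); (1, 2); (2, 1); (1, 3); (3, 1)]%N].
Proof.
move=> ik; have [p hp] := cart_le0 ik; have := ik; rewrite eq_sym => /cart_le0[q hq].
exists p, q; split=> //.
have gi := dual_dot_gt0 dot (simple_neq0 i); have gk := dual_dot_gt0 dot (simple_neq0 k).
move: hp hq; rewrite /cartan !apply_coroot (dual_dotC dot (sr k)) => hp hq.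
set d := dual_dot dot (sr i) (sr k) in hp hq.
set A := dual_dot dot (sr i) (sr i) in gi hp hq.
set B := dual_dot dot (sr k) (sr k) in gk hp hq.
have hd1 : 2 * d = - p%:R * B by rewrite -hp mulfVK ?gt_eqF.
have hd2 : 2 * d = - q%:R * A by rewrite -hq mulfVK ?gt_eqF.
have lt : d * d < A * B.
  (* The part of [sr i] orthogonal to [sr k]; the positivity of its norm is the strict
     inequality. *)
  have z0 : sr i - (d / B) *: sr k != 0.
    apply/eqP => /(congr1 (coord (simples Phi) i)).
    rewrite linearB linearZ /= !coord_simple eqxx eq_sym (negbTE ik) mulr0 subr0 linear0.
    by move/eqP; rewrite oner_eq0.
  have := dual_dot_gt0 dot z0.
  rewrite dual_dotE !lfun_simp rieszD rieszN rieszZ !linearB !linearZ /= -!dual_dotE.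
  rewrite (dual_dotC dot (sr k)) -/A -/B -/d => h.
  suff : 0 < (A - (d / B) * d) * B by rewrite mulrBl mulrAC mulfVK ?gt_eqF // subr_gt0.
  rewrite mulr_gt0 //; apply: lt_le_trans h _.
  rewrite le_eqVlt; apply/orP; left; apply/eqP.
  change (A + d / B * - d + (d / B * - d + d / B * (d / B * - - B)) = A - d / B * d).
  by field; rewrite gt_eqF.
have pq : (p * q < 4)%N.
  rewrite -(ltr_nat R) natrM -(ltr_pM2r (mulr_gt0 gi gk)).
  have -> : p%:R * q%:R * (A * B) = 4 * (d * d) by transitivity ((2 * d) * (2 * d)); [rewrite
    {1}hd1 hd2|]; ring.
  by rewrite ltr_pM2l.
have z1 : p = 0%N -> q = 0%N.
  move=> p0; move: hd1 hd2; rewrite p0 mulr0n oppr0 mul0r => -> /eqP.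
  by rewrite eq_sym mulf_eq0 (gt_eqF gi) orbF oppr_eq0 pnatr_eq0 => /eqP.
have z2 : q = 0%N -> p = 0%N.
  move=> p0; move: hd2 hd1; rewrite p0 mulr0n oppr0 mul0r => -> /eqP.
  by rewrite eq_sym mulf_eq0 (gt_eqF gk) orbF oppr_eq0 pnatr_eq0 => /eqP.
case: p z1 z2 pq {hp hd1} => [|[|[|[|p]]]]; case: q {hq hd2} => [|[|[|[|q]]]] //=; lia.
Qed.

(* Every element of W has a reduced word of length at most the number of positive roots. *)
Definition weyl_seq : seq 'End(E) :=
  locked (undup [seq word (val t) | t : #|` pos|.-bseq 'I_(rank Phi)]).

Lemma wlistP w : w \in weyl_seq <-> isW w.
Proof.
rewrite /weyl_seq -lock mem_undup; split=> [/mapP[t _ ->]|Ww]; first exact: isW_word.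
have [e h] := reduced_wordP Ww.
have le : (size (reduced_word w) <= #|` pos|)%N.
  rewrite h; apply: fsubset_leq_card; apply/fsubsetP => a.
  by rewrite in_negset => /andP[].
by apply/mapP; exists (Bseq le); rewrite ?mem_enum.
Qed.

(* W as a finite type, sealed: conversion would otherwise enumerate the words. *)
Lemma weyl_fintype : {T : finType & {f : T -> 'End(E) & {g : 'End(E) -> T |
  cancel f g & (forall w, isW w -> f (g w) = w) /\ forall u : T, isW (f u)}}}.
Proof.
have h1 : \1%VF \in weyl_seq by apply/wlistP/isW1.
exists (seq_sub weyl_seq), (@ssval _ weyl_seq), (insubd (SeqSub h1)); first exact: valKd.
split=> [w /wlistP h|w]; first by rewrite (insubdK (SeqSub h1)).
by apply/wlistP; apply: ssvalP.
Qed.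

Definition weylT : finType := projT1 weyl_fintype.
Definition weyl_val : weylT -> 'End(E) := projT1 (projT2 weyl_fintype).
Definition weyl_of : 'End(E) -> weylT := s2val (projT2 (projT2 weyl_fintype)).
Local Notation wv := weyl_val.
Local Notation mkW := weyl_of.

Lemma wvK : cancel wv mkW.
Proof. exact: s2valP. Qed.
Lemma mkWK w : isW w -> wv (mkW w) = w.
Proof. exact: (proj1 (s2valP' (projT2 (projT2 weyl_fintype)))). Qed.
Lemma isW_wv (w : weylT) : isW (wv w).
Proof. exact: (proj2 (s2valP' (projT2 (projT2 weyl_fintype)))). Qed.
Lemma wv_inj : injective wv.
Proof. exact: can_inj wvK. Qed.

Lemma sum_subW (V : zmodType) (G : set 'End(E)) (f : 'End(E) -> V) :
  (forall w, G w -> isW w) ->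
  \sum_(w \in G) f w = \sum_(w : weylT | `[< G (wv w) >]) f (wv w).
Proof.
move=> GW; pose r := [seq wv u | u : weylT <- enum weylT & `[< G (wv u) >]].
have ur : uniq r by rewrite map_inj_uniq; [exact/filter_uniq/enum_uniq|exact: wv_inj].
have Gr : G = [set` r].
  apply/seteqP; split=> w /=.
    move=> Gw; apply/mapP; exists (mkW w); rewrite ?mkWK //; try exact: GW.
    by rewrite mem_filter mem_enum andbT mkWK; [exact/asboolP|exact: GW].
  by move=> /mapP[u]; rewrite mem_filter => /andP[/asboolP h _ ->].
by rewrite {1}Gr -fsbig_seq // /r big_map big_filter big_enum_cond.
Qed.

Lemma lenbound w : isW w -> (len w <= #|` pos|)%N.
Proof.
move=> Ww; rewrite lenE //; apply: fsubset_leq_card; apply/fsubsetP => a.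
by rewrite in_negset => /andP[].
Qed.

Lemma longestP (G : set 'End(E)) : (forall w, G w -> isW w) -> G !=set0 ->
  G (longest Phi G) /\ forall u, G u -> (len u <= len (longest Phi G))%N.
Proof.
move=> GW [w Gw]; rewrite /longest.
suff [u hu] : exists u, [set w | G w /\ forall u, G u -> (len u <= len w)%N] u.
  exact: (xgetI _ hu).
have [n] := ubnP (#|` pos| - len w)%N; elim: n => // n IH in w Gw *.
move=> hn; have [h|] := pselect (forall u, G u -> (len u <= len w)%N); first by exists w.
move=> /existsNP[u /not_implyP[Gu /negP]]; rewrite -ltnNge => lt.
by apply: (IH u) => //; have := lenbound (GW _ Gu); lia.
Qed.

Local Notation w0 := (w0 Phi).

Lemma w0P : isW w0 /\ forall u, isW u -> (len u <= len w0)%N.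
Proof.
have [||/weylE h1 h2] := @longestP (weyl Phi).
- by move=> w /weylE.
- by exists \1%VF; apply/weylE/isW1.
by split=> // u /weylE; apply: h2.
Qed.

Lemma isW_w0 : isW w0. Proof. by case: w0P. Qed.

Lemma w0_simple i : (sr i \o w0)%VF \notin pos.
Proof.
apply/negP => pi; have := (w0P.2 _ (isW_simpleM i isW_w0)).
by rewrite len_up // ?ltnn //; exact: isW_w0.
Qed.

Lemma neg_comp w : isW w -> (forall i, (sr i \o w)%VF \notin pos) ->
  forall a, a \in pos -> (a \o w)%VF \notin pos.
Proof.
move=> Ww h a pa; have ra := isW_root Ww (pos_root pa).
rewrite pos_ht ra /= -leNgt; case/posrootP: pa => _ [k ->].
rewrite ht_natcomp; apply: sumr_le0 => i _; rewrite mulr_ge0_le0 ?ler0n //.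
by have := h i; rewrite pos_ht isW_root ?simple_root //= -leNgt.
Qed.

Lemma pos_w0 a : a \in Root -> ((a \o w0)%VF \in pos) = (a \notin pos).
Proof.
have key b : b \in pos -> (b \o w0)%VF \notin pos by apply: neg_comp w0_simple _; exact: isW_w0.
move=> ra; have [pa|na] := boolP (a \in pos); first by rewrite (negbTE (key _ pa)).
have := key (- a); rewrite posN // => /(_ na).
by rewrite comp_lfunNl posN ?isW_root //; [rewrite negbK|exact: isW_w0].
Qed.

Lemma w0K : (w0 \o w0)%VF = \1%VF.
Proof.
apply: isW_simple_pos => [|i]; first by apply: isWM isW_w0 isW_w0.
by rewrite comp_lfunA pos_w0 ?isW_root ?simple_root ?w0_simple //; exact: isW_w0.
Qed.

Lemma w0Kx x : w0 (w0 x) = x.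
Proof. by rewrite -comp_lfunE w0K id_lfunE. Qed.

Lemma w0V : (w0^-1)%VF = w0.
Proof. by rewrite -[RHS]comp_lfun1l -(isW_VK isW_w0) -comp_lfunA w0K comp_lfun1r. Qed.

(** Composition with w0 on the right exchanges positive and negative roots, so the set of inversions
    is replaced by its complement. *)
Lemma len_Mw0 w : isW w -> (len (w \o w0)%VF + len w)%N = len w0.
Proof.
have W0 := isW_w0.
have e u : isW u -> (num_left_inversions Phi (u \o w0)%VF + num_left_inversions Phi u)%N = #|` pos|.
  move=> Wu; rewrite /num_left_inversions.
  have -> : left_inversions Phi (u \o w0)%VF = (pos `\` left_inversions Phi u)%fset.
    apply/fsetP => a; rewrite [LHS]in_negset [RHS]in_fsetD.
    have -> : (a \notin left_inversions Phi u) = ~~ ((a \in pos) && ((a \o u)%VF \notin pos)).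
      by congr (~~ _); exact: in_negset.
    rewrite comp_lfunA andbC; case pa: (a \in pos); rewrite ?andbF //= !andbT.
    by rewrite pos_w0 // isW_root // pos_root.
  have sub : (left_inversions Phi u `<=` pos)%fset.
    by apply/fsubsetP => a; rewrite in_negset => /andP[].
  by rewrite cardfsDS // subnK // fsubset_leq_card.
move=> Ww; rewrite !lenE //; last exact: isWM.
rewrite e //; have := e _ (isW1 Phi); rewrite comp_lfun1l nneg1 addn0 => ->.
by [].
Qed.

Lemma len_w0M w : isW w -> (len (w0 \o w)%VF + len w)%N = len w0.
Proof.
move=> Ww; have W0 := isW_w0; rewrite -lenV; last exact: isWM.
by rewrite (isW_invM W0 Ww) w0V -(lenV Ww) len_Mw0 //; exact: isWV.
Qed.

(** The involution a to - a w0 preserves positive roots. Expand the image of [sr i] in simple roots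
    and apply the involution again: 1 is then a sum with multiplicities k_j of heights that are at
    least 1, so exactly one k_j is nonzero and it equals 1. *)
Lemma star_exists i : exists j, sr j = - (sr i \o w0)%VF.
Proof.
have W0 := isW_w0; pose n a := - (a \o w0)%VF.
have nn a : n (n a) = a by rewrite /n comp_lfunNl opprK -comp_lfunA w0K comp_lfun1r.
have pn a : a \in pos -> n a \in pos.
  by move=> pa; rewrite posN ?isW_root ?(pos_root pa) // pos_w0 ?pa // pos_root.
have := pn _ (pos_simple i); case/posrootP => _ [k e].
have : \sum_j (k j)%:R * height Phi (n (sr j)) = 1.
  have := ht_simple i; rewrite -{1}(nn (sr i)) e {1}/n htN ht_natcomp => {2}<-.
  by rewrite -sumrN; apply: eq_bigr => j _; rewrite /n htN mulrN.
have [j kj|k0] := pickP (fun j => (0 < k j)%N); last first.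
  rewrite big1 => [/eqP|j _]; first by rewrite eq_sym oner_eq0.
  by have := k0 j; rewrite lt0n => /negbFE/eqP ->; rewrite mul0r.
rewrite (bigD1 j) //= => h.
have ge l : (k l)%:R <= (k l)%:R * height Phi (n (sr l)).
  by rewrite ler_peMr ?ler0n // pos_ht_ge1 // pn // pos_simple.
have hs : (k j)%:R + \sum_(l | l != j) (k l)%:R <= (1 : R).
  rewrite -[X in _ <= X]h; apply: lerD; first exact: ge.
  by apply: ler_sum => l _; exact: ge.
move: hs; rewrite -natr_sum -natrD -[1 in X in _ <= X]/(1%:R) ler_nat => hs.
exists j; rewrite -[RHS]/(n _) e (bigD1 j) //= big1 ?addr0.
  by have -> : k j = 1%N by lia.
move=> l lj; have -> : k l = 0%N; last by [].
by move: hs; rewrite (bigD1 l) //=; lia.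
Qed.

Definition star i : 'I_(rank Phi) := xget i [set j | sr j = - (sr i \o w0)%VF].

Lemma starE i : sr (star i) = - (sr i \o w0)%VF.
Proof. have [j h] := star_exists i.
by have := xgetI i (h : [set j | sr j = - (sr i \o w0)%VF] j). Qed.

Lemma star_reflection i : sS (star i) = (w0 \o sS i \o w0)%VF.
Proof.
rewrite /simple_reflection starE reflectionN.
have [s e] : isW w0 := isW_w0.
by rewrite -{1}e reflection_word -(word_rev_inv e) w0V e.
Qed.

Lemma word_star s : word [seq star i | i <- s] = (w0 \o word s \o w0)%VF.
Proof.
elim: s => [|i s IH]; first by rewrite /= comp_lfun1r w0K.
rewrite /= IH star_reflection !comp_lfunA; congr (_ \o _ \o _)%VF.
by rewrite -(comp_lfunA _ w0 w0) w0K comp_lfun1r.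
Qed.

Lemma len_conj_w0 w : isW w -> len (w0 \o w \o w0)%VF = len w.
Proof.
move=> Ww; have := len_Mw0 (isWM isW_w0 Ww); have := len_w0M Ww; lia.
Qed.

Lemma reduced_star s : is_reduced s -> is_reduced [seq star i | i <- s].
Proof.
by rewrite !reduced_len size_map word_star len_conj_w0 //; exact: isW_word.
Qed.

Section Stabilizer.
Variable c : E.
Hypothesis cdom : forall i, 0 <= (sr i c : R).

Lemma pos_dom a : a \in pos -> 0 <= (a c : R).
Proof.
case/posrootP => _ [k ->]; rewrite sum_lfunE; apply: sumr_ge0 => i _.
by rewrite -scaler_nat scale_lfunE mulr_ge0.
Qed.

Lemma stabE u : stab Phi c u <-> isW u /\ u c = c.
Proof. by rewrite /stab /=; split=> -[/weylE]. Qed.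

Lemma stab1 : stab Phi c \1%VF.
Proof. by apply/stabE; split; [exact: isW1|rewrite id_lfunE]. Qed.

Lemma stabM u w : stab Phi c u -> stab Phi c w -> stab Phi c (u \o w)%VF.
Proof.
move=> /stabE[Wu uc] /stabE[Ww wc]; apply/stabE; split; first exact: isWM.
by rewrite comp_lfunE wc uc.
Qed.

Lemma stabV u : stab Phi c u -> stab Phi c (u^-1)%VF.
Proof.
move=> /stabE[Wu uc]; apply/stabE; split; first exact: isWV.
by rewrite -{1}uc -comp_lfunE (isW_VK Wu) id_lfunE.
Qed.

Lemma stab_simple i : (sr i c : R) = 0 -> stab Phi c (sS i).
Proof.
move=> h; apply/stabE; split; first exact: isW_simple.
by rewrite reflectionE h scale0r subr0.
Qed.

Lemma stab_descent u i : stab Phi c u -> (sr i \o u)%VF \notin pos -> (sr i c : R) = 0.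
Proof.
move=> /stabE[Wu uc] h; apply/eqP; rewrite eq_le cdom andbT.
have ri := isW_root Wu (simple_root i).
by move: h; rewrite -posN // => /pos_dom; rewrite opp_lfunE comp_lfunE uc oppr_ge0.
Qed.

(** By dominance a left descent of a stabilizing element vanishes at c ([stab_descent]), so
    descending along reduced words never leaves the stabilizer. *)
Lemma stab_ind (Q : 'End(E) -> Prop) : Q \1%VF ->
  (forall i u, (sr i c : R) = 0 -> stab Phi c u -> (sr i \o u)%VF \in pos -> Q u ->
     Q (sS i \o u)%VF) ->
  forall u, stab Phi c u -> Q u.
Proof.
move=> Q1 QS u; have [n] := ubnP (len u); elim: n => // n IH in u *.
move=> hn su; have [Wu uc] := (stabE u).1 su.
have [all|] := pselect (forall i, (sr i \o u)%VF \in pos).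
  by rewrite (isW_simple_pos Wu all).
move=> /existsNP[i /negP hi]; have ci := stab_descent su hi.
have su' : stab Phi c (sS i \o u)%VF by apply: stabM => //; exact: stab_simple.
have Wi := isW_simpleM i Wu.
rewrite -(simpleKl i u); apply: QS => //.
  rewrite comp_lfunA simple_comp_self comp_lfunNl posN // isW_root // simple_root //.
by apply: IH => //; have := len_down Wu hi; lia.
Qed.

(** If a letter failed to raise the length, exchange would delete a letter of u, against its ascent,
    or a letter of p, and then a stabilizer translate of p would be shorter than p. *)
Lemma lmin_len p : isW p -> (forall u, stab Phi c u -> (len p <= len (u \o p)%VF)%N) ->
  forall x : 'End(E), stab Phi c x -> len (x \o p)%VF = (len x + len p)%N.
Proof.
move=> Wp pmin; apply: stab_ind => [|i u ci su ui IH]; first by rewrite comp_lfun1l len1.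
have [Wu uc] := (stabE u).1 su; have Wup := isWM Wu Wp.
have [h|h] := boolP ((sr i \o (u \o p))%VF \in pos).
  by rewrite -comp_lfunA !len_up // IH.
have [eu hu] := reduced_wordP Wu; have [ep hp] := reduced_wordP Wp.
have := @exchange _ _ _ Phi i (reduced_word u ++ reduced_word p).
rewrite word_cat eu ep => /(_ h) [t [k [t' [e e2]]]].
have [[r [ru rt]]|[r [rt rp]]] := cat_cut e.
  move: e2; rewrite rt catA word_cat ep comp_lfunA => /(congr1 (fun f => f \o p^-1)%VF).
  rewrite -!comp_lfunA (isW_KV Wp) !comp_lfun1r => e3.
  have := len_up Wu ui; rewrite e3 (lenE Wu) -hu ru => h2.
  have := len_word (t ++ r).
  by rewrite h2 !size_cat /=; lia.
(* The deleted letter lies in p: conjugating s_i by u turns the deletion into left multiplication of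
   p by a stabilizing element. *)
have st : stab Phi c (u^-1 \o sS i \o u)%VF.
  by apply: stabM => //; apply: stabM; [exact: stabV|exact: stab_simple].
move: e2; rewrite rt -catA word_cat eu => e2.
have := pmin _ st; have -> : (u^-1 \o sS i \o u \o p)%VF = word (r ++ t').
  by rewrite -!comp_lfunA e2 comp_lfunA (isW_VK Wu) comp_lfun1l.
have := len_word (r ++ t').
rewrite (lenE Wp) -hp rp !size_cat /=; lia.
Qed.

(** A positive root that vanishes at a dominant point involves only simple roots vanishing there,
    and none of these is a left descent of the minimal p. *)
Lemma lmin_pos p a : isW p -> (forall u, stab Phi c u -> (len p <= len (u \o p)%VF)%N) ->
  a \in pos -> (a c : R) = 0 -> (a \o p)%VF \in pos.
Proof.
move=> Wp pmin pa ac; rewrite pos_ht isW_root ?pos_root //=.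
have := isW_root Wp (pos_root pa) => /root_ht/orP[] //; apply: contraLR => _; rewrite -leNgt.
case/posrootP: pa => _ [k ak]; rewrite ak ht_natcomp; apply: sumr_ge0 => i _.
have [->|ki] := posnP (k i); first by rewrite mul0r.
rewrite mulr_ge0 ?ler0n //.
have ci : (sr i c : R) = 0.
  move: ac; rewrite ak sum_lfunE => /eqP; rewrite psumr_eq0 => [/allP h|j _]; last first.
    by rewrite -scaler_nat scale_lfunE mulr_ge0.
  have := h i (mem_index_enum _); rewrite -scaler_nat scale_lfunE => /implyP/(_ isT).
  by rewrite mulf_eq0 pnatr_eq0 (gtn_eqF ki) => /eqP.
have : (sr i \o p)%VF \in pos.
  apply: contraT => h; have := pmin _ (stab_simple ci).
  by rewrite (len_down Wp h) ltnn.
by rewrite pos_ht => /andP[_ /ltW].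
Qed.

Lemma minrepsE w : minreps Phi c w <->
  isW w /\ forall u, stab Phi c u -> (len w <= len (w \o u)%VF)%N.
Proof. by rewrite /minreps /=; split=> -[/weylE]. Qed.

Lemma minreps_len w (x : 'End(E)) : minreps Phi c w -> stab Phi c x ->
  len (w \o x)%VF = (len w + len x)%N.
Proof.
move=> /minrepsE[Ww wm] sx; have [Wx xc] := (stabE x).1 sx.
rewrite -lenV; last exact: isWM.
rewrite (isW_invM Ww Wx) (@lmin_len (w^-1)%VF) ?lenV 1?addnC //; last exact: stabV.
  exact: isWV.
move=> u su; have [Wu _] := (stabE u).1 su.
rewrite -(isW_invV Wu) -(isW_invM Ww (isWV Wu)).
by rewrite lenV; [apply/wm/stabV|apply/isWM/isWV].
Qed.

Lemma minreps_exists w : isW w -> exists2 x, stab Phi c x & minreps Phi c (w \o x)%VF.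
Proof.
have [n] := ubnP (len w); elim: n => // n IH in w * => hn Ww.
have [h|] := pselect (forall u, stab Phi c u -> (len w <= len (w \o u)%VF)%N).
  by exists \1%VF; [exact: stab1|rewrite comp_lfun1r; apply/minrepsE].
move=> /existsNP[u /not_implyP[su /negP]]; rewrite -ltnNge => lt.
have [Wu _] := (stabE u).1 su.
have [|x sx hx] := IH (w \o u)%VF _ (isWM Ww Wu); first by lia.
by exists (u \o x)%VF; [exact: stabM|rewrite comp_lfunA].
Qed.

Lemma minrepP w : isW w -> minreps Phi c (minrep Phi c w) /\
  exists2 x, stab Phi c x & w = (minrep Phi c w \o x)%VF.
Proof.
move=> Ww; have [x sx hx] := minreps_exists Ww.
have h : [set u | minreps Phi c u /\ exists2 x, stab Phi c x & w = (u \o x)%VF] (w \o x)%VF.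
  split=> //; exists (x^-1)%VF; first exact: stabV.
  by have [Wx _] := (stabE x).1 sx; rewrite -comp_lfunA (isW_KV Wx) comp_lfun1r.
by have := xgetI \1%VF h.
Qed.

End Stabilizer.

End Parabolic.

(** * The lattice and its group algebra *)

Section Lattice.
Variables (R : realType) (E : vectType R) (dot : {dot E for idfun}).
Variables (Phi : rootSystem dot) (M : metaplecticDatum Phi).
Implicit Types (a b : 'Hom(E, R^o)) (x y : E) (w u : 'End(E)) (i j : 'I_(rank Phi)).
Local Notation Root := (rootset Phi).
Local Notation isW := (isW Phi).
Local Notation L := (lattice M).
Local Notation Lm := (mlattice M).
Local Notation m := (mult M).

Lemma lattice0 : L 0.
Proof.
have [e ->] := lattice_fg M; exists (fun=> 0).
by rewrite big1 // => i _; rewrite mulr0z.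
Qed.

Lemma latticeD x y : L x -> L y -> L (x + y).
Proof.
have [e ->] := lattice_fg M => -[k ->] [l ->]; exists (fun n => k n + l n).
by rewrite -big_split; apply: eq_bigr => i _; rewrite mulrzDr.
Qed.

Lemma latticeN x : L x -> L (- x).
Proof.
have [e ->] := lattice_fg M => -[k ->]; exists (fun n => - k n).
by rewrite -sumrN; apply: eq_bigr => i _; rewrite mulrNz.
Qed.

Lemma latticeB x y : L x -> L y -> L (x - y).
Proof. by move=> Lx /latticeN; apply: latticeD. Qed.

Lemma lattice_mulz x (k : int) : L x -> L (x *~ k).
Proof.
move=> Lx; case: k => n; last rewrite NegzE mulrNz; try apply: latticeN;
  rewrite -pmulrn; elim: {n}_.+1 || elim: n; by [rewrite mulr0n; exact: lattice0
  |move=> n IH; rewrite mulrS; exact: latticeD].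
Qed.

Lemma coroot_in_lattice a : a \in Root -> coroot_lattice Phi (coroot dot a).
Proof.
move=> ra; exists (fun b => (b == a)%:Z).
rewrite (big_fsetD1 a) //= eqxx mulr1z big_seq big1 ?addr0 // => b.
by rewrite !inE => /andP[/negbTE -> _]; rewrite mulr0z.
Qed.

Lemma lattice_root a : a \in Root -> L (coroot dot a).
Proof. by move=> ra; apply: lattice_coroot; exact: coroot_in_lattice. Qed.

Lemma lattice_int a x : a \in Root -> L x -> exists n : int, a x = n%:~R :> R.
Proof. by move=> ra Lx; exact/intrP/(lattice_integral ra Lx). Qed.

Lemma lattice_reflection a x : a \in Root -> L x -> L (reflection dot a x).
Proof.
move=> ra Lx; have [n hn] := lattice_int ra Lx; rewrite reflectionE hn scaler_int.
by apply: latticeB => //; apply: lattice_mulz; exact: lattice_root.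
Qed.

Lemma lattice_isW w x : isW w -> L x -> L (w x).
Proof.
move=> [s <-] Lx; elim: s => [|i s IH]; first by rewrite id_lfunE.
by rewrite /= comp_lfunE; apply: lattice_reflection => //; exact: simple_root.
Qed.

Lemma BformC x y : Bform M x y = Bform M y x.
Proof. by rewrite /Bform [x + y]addrC addrAC. Qed.

Lemma Bform0 z : L z -> Bform M 0 z = 0.
Proof.
move=> Lz; have := Bform_add lattice0 lattice0 Lz; rewrite addr0 => /eqP.
by rewrite -subr_eq0 opprD addrA subrr sub0r oppr_eq0 => /eqP.
Qed.

Lemma BformN x z : L x -> L z -> Bform M (- x) z = - Bform M x z.
Proof.
move=> Lx Lz; apply/eqP; rewrite -addr_eq0 -Bform_add ?addNr ?Bform0 //.
exact: latticeN.
Qed.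

Lemma Bform_mulz x z (k : int) : L x -> L z -> Bform M (x *~ k) z = k%:~R * Bform M x z.
Proof.
move=> Lx Lz; have nat (n : nat) : Bform M (x *+ n) z = n%:R * Bform M x z.
  elim: n => [|n IH]; first by rewrite mulr0n Bform0 // mul0r.
  rewrite mulrS Bform_add // ?IH; last by have := lattice_mulz n Lx.
  by rewrite -[in RHS]add1n natrD mulrDl mul1r.
case: k => n; first by rewrite -pmulrn nat.
rewrite NegzE mulrNz BformN //; last exact: (lattice_mulz n.+1).
by rewrite -pmulrn nat mulrNz mulNr.
Qed.

Lemma Bform_isW w x y : isW w -> L x -> L y -> Bform M (w x) (w y) = Bform M x y.
Proof.
move=> Ww Lx Ly; have /weylE Ww' := Ww.
by rewrite /Bform -linearD !Qform_weyl //; exact: latticeD.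
Qed.

Definition Qcoroot a : int := Num.floor (Qform M (coroot dot a)).

Lemma QcE a : a \in Root -> Qform M (coroot dot a) = (Qcoroot a)%:~R.
Proof.
move=> ra; have /intrP[k hk] := Qform_int M (coroot_in_lattice ra).
by rewrite /Qcoroot hk intrKfloor.
Qed.

(** Reflecting in a negates the coroot, so invariance gives 2 B(x, a^v) = a(x) B(a^v, a^v), and
    B(a^v, a^v) = 2 Q(a^v). *)
Lemma Bform_coroot a x (n : int) : a \in Root -> L x -> a x = n%:~R :> R ->
  Bform M x (coroot dot a) = (n * Qcoroot a)%:~R.
Proof.
move=> ra Lx hn; have La := lattice_root ra.
have /weylE Wr : isW (reflection dot a) by exact: isW_reflection.
have := Bform_isW ((weylE Phi _).1 Wr) Lx La.
have -> : reflection dot a (coroot dot a) = - coroot dot a.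
  by rewrite reflectionE coroot_self ?(root_neq0 ra) // scaler_nat mulr2n opprD addrA subrr sub0r.
rewrite reflectionE hn scaler_int BformC BformN //; last first.
  by apply: latticeB => //; exact: lattice_mulz.
rewrite BformC Bform_add //; last by apply: latticeN; exact: lattice_mulz.
rewrite BformN //; last exact: lattice_mulz.
rewrite Bform_mulz //.
have -> : Bform M (coroot dot a) (coroot dot a) = 2 * Qform M (coroot dot a).
  rewrite /Bform -mulr2n; have := @Qform_scale _ _ _ _ M (coroot dot a) 2 La.
  by rewrite -pmulrn => ->; rewrite mulr2n; ring.
by rewrite QcE // rmorphM /= => h; lra.
Qed.

Lemma mult_gt0 a : (0 < m a)%N.
Proof.
rewrite /mult divn_gt0; last by rewrite gcdn_gt0 deg_gt0.
by rewrite dvdn_leq ?deg_gt0 // dvdn_gcdl.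
Qed.

(** After cancelling the gcd the remaining factors are coprime. This translates divisibility of an
    index of g by n into divisibility of a root value by m(a). *)
Lemma multP a (k : int) : ((deg M)%:Z %| k * Qcoroot a)%Z = ((m a)%:Z %| k)%Z.
Proof.
rewrite !dvdzE /= abszM /mult -/(Qcoroot a); set n := deg M; set Q := absz (Qcoroot a).
have g0 : (0 < gcdn n Q)%N by rewrite gcdn_gt0 deg_gt0.
rewrite -[X in (X %| _)%N](divnK (dvdn_gcdl n Q)) -[X in (_ %| _ * X)%N](divnK (dvdn_gcdr n Q)).
rewrite mulnA dvdn_pmul2r // Gauss_dvdl // /coprime -(eqn_pmul2r g0) mul1n muln_gcdl.
by rewrite !divnK ?dvdn_gcdl ?dvdn_gcdr.
Qed.

Lemma Qform_comp a w : isW w -> a \in Root ->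
  Qform M (coroot dot (a \o w)%VF) = Qform M (coroot dot a).
Proof.
move=> [s <-] ra; rewrite coroot_word Qform_weyl //; last exact: lattice_root.
exact/weylE/isW_word.
Qed.

Lemma mult_comp a w : isW w -> a \in Root -> m (a \o w)%VF = m a.
Proof. by move=> Ww ra; rewrite /mult Qform_comp. Qed.

Lemma multN a : a \in Root -> m (- a) = m a.
Proof.
move=> ra; rewrite -(reflection_self dot (root_neq0 ra)) mult_comp //.
exact: isW_reflection.
Qed.

(** Symmetry of B gives b(a^v) Q(b^v) = a(b^v) Q(a^v), and n divides m(a) Q(a^v). The outcome is
    that m(a) a^v lies in [Lm]. *)
Lemma mult_coroot a b : a \in Root -> b \in Root ->
  exists k : int, (b (coroot dot a) : R) *+ m a = (k * m b)%:~R.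
Proof.
move=> ra rb; have [n hn] := lattice_int rb (lattice_root ra).
have [n' hn'] := lattice_int ra (lattice_root rb).
have e : n * Qcoroot b = n' * Qcoroot a.
  have := Bform_coroot rb (lattice_root ra) hn; rewrite BformC.
  by rewrite (Bform_coroot ra (lattice_root rb) hn') => /eqP; rewrite eqr_int => /eqP.
have : ((m b)%:Z %| (m a)%:Z * n)%Z.
  by rewrite -multP -mulrA e mulrCA dvdz_mull // multP.
by case/dvdzP => k hk; exists k; rewrite -hk hn rmorphM /= mulr_natl.
Qed.

Lemma mlattice0 : Lm 0.
Proof.
by split=> [|a ra]; [exact: lattice0|exists 0; rewrite linear0 mul0r].
Qed.

Lemma mlatticeD x y : Lm x -> Lm y -> Lm (x + y).
Proof.
move=> [Lx hx] [Ly hy]; split=> [|a ra]; first exact: latticeD.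
have [k hk] := hx a ra; have [l hl] := hy a ra.
by exists (k + l); rewrite linearD /= hk hl -intrD mulrDl.
Qed.

Lemma mlatticeN x : Lm x -> Lm (- x).
Proof.
move=> [Lx hx]; split=> [|a ra]; first exact: latticeN.
by have [k hk] := hx a ra; exists (- k); rewrite linearN /= hk mulNr rmorphN.
Qed.

Lemma mlatticeB x y : Lm x -> Lm y -> Lm (x - y).
Proof. by move=> hx /mlatticeN; apply: mlatticeD. Qed.

Lemma mlattice_isW w x : isW w -> Lm x -> Lm (w x).
Proof.
move=> Ww [Lx hx]; split=> [|a ra]; first exact: lattice_isW.
have [k hk] := hx _ (isW_root Ww ra).
by exists k; rewrite -comp_lfunE hk mult_comp.
Qed.

Lemma mlattice_coroot a : a \in Root -> Lm (coroot dot a *+ m a).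
Proof.
move=> ra; split=> [|b rb]; first exact/(lattice_mulz (m a))/lattice_root.
have [k hk] := mult_coroot ra rb; exists k; rewrite -hk.
by rewrite raddfMn.
Qed.

End Lattice.

(** * Supports and geometric quotients *)

Section LinearExtension.
Variables (F : fieldType) (V : zmodType).
Local Notation A := (groupAlgebra F V).
Implicit Types (f g h : A) (x y : V) (c : F).

Lemma msupp_expo x y : (y \in msupp (expo F x : {malg F[V]})) = (y == x).
Proof. by rewrite msuppU oner_eq0 inE. Qed.

Lemma supported_expo (G : set V) x : G x -> supported G (expo F x).
Proof. by move=> Gx y; rewrite msupp_expo => /eqP ->. Qed.

Lemma supported0 (G : set V) : supported G (0 : A).
Proof. by move=> x; rewrite msupp0 inE. Qed.

Lemma supportedD (G : set V) f g : supported G f -> supported G g -> supported G (f + g).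
Proof.
move=> hf hg x; rewrite -mcoeff_neq0 mcoeffD => h.
have [/eqP|] := boolP (x \in msupp (f : {malg F[V]})); first by move=> /eqP; exact: hf.
move=> /mcoeff_outdom f0; move: h; rewrite f0 add0r mcoeff_neq0; exact: hg.
Qed.

Lemma supportedZ (G : set V) c f : supported G f -> supported G (c *: f).
Proof.
move=> hf x; rewrite -mcoeff_neq0 mcoeffZ mulf_eq0 negb_or mcoeff_neq0 => /andP[_].
exact: hf.
Qed.

Lemma supportedN (G : set V) f : supported G f -> supported G (- f).
Proof. by rewrite -scaleN1r; exact: supportedZ. Qed.

Lemma supported_sum (G : set V) I (r : seq I) (Q : pred I) (f : I -> A) :
  (forall i, Q i -> supported G (f i)) -> supported G (\sum_(i <- r | Q i) f i).
Proof.
move=> h; apply: (big_ind (fun f => supported G f)) => //; first exact: supported0.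
exact: supportedD.
Qed.

Lemma supported_ind (G : set V) (Q : A -> Prop) :
  Q 0 -> (forall f g, Q f -> Q g -> Q (f + g)) -> (forall (c : F) f, Q f -> Q (c *: f)) ->
  (forall x, G x -> Q (expo F x)) -> forall f, supported G f -> Q f.
Proof.
move=> Q0 QD QZ Qx f hf; rewrite -(linext_id f) /linext big_seq.
by apply: (big_ind Q) => // x xf; apply/QZ/Qx/hf.
Qed.

Variable beta : V.
Hypothesis binf : forall k, beta *+ k = 0 -> k = 0%N.

Lemma sub1_expo_inj f g : f * (1 - expo F beta) = g * (1 - expo F beta) -> f = g.
Proof.
move=> h; apply/eqP; rewrite -subr_eq0; apply/eqP/(sub1_expo_reg binf).
by rewrite mulrBl h subrr.
Qed.

(** With k the integer part of alpha_i(x) / m, this is the fraction in pi(T_i), since r_m(a) - a = -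
    m k. *)
Definition geom_quot (k : int) : A := gdiv (1 - expo F (- (beta *~ k))) (1 - expo F beta).

Lemma geomP k : geom_quot k * (1 - expo F beta) = 1 - expo F (- (beta *~ k)).
Proof.
suff [g hg] : exists g, g * (1 - expo F beta) = 1 - expo F (- (beta *~ k)).
  by rewrite /geom_quot (gdivP binf hg).
have nat (n : nat) : exists g, g * (1 - expo F beta) = 1 - expo F (beta *+ n).
  exists (\sum_(i < n) expo F (beta *+ i)).
  rewrite -expoX; under eq_bigr do rewrite -expoX.
  by rewrite mulrC -[1 - expo F beta]opprB mulNr -subrX1 opprB.
case: k => n; last by rewrite NegzE mulrNz opprK -pmulrn; exact: nat.
have [g hg] := nat n; exists (- expo F (- (beta *+ n)) * g).
by rewrite -mulrA hg mulNr -pmulrn mulrBr mulr1 expoM addNr expo1 opprB.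
Qed.

End LinearExtension.

Section LinearExtensionMaps.
Variables (F : fieldType) (V W : zmodType).

Lemma supported_linext (G : set V) (H : set W) (t : V -> groupAlgebra F W) (f : groupAlgebra F V) :
  (forall x, G x -> supported H (t x)) -> supported G f -> supported H (linext t f).
Proof.
move=> height.
apply: (supported_ind (Q := fun f => supported H (linext t f))) => [|g h hg hh|c g hg|x Gx].
- by rewrite linext0; exact: supported0.
- by rewrite linextD; exact: supportedD.
- by rewrite linextZ; exact: supportedZ.
by rewrite linext_expo; exact: height.
Qed.

End LinearExtensionMaps.

Section SupportProduct.
Variables (F : fieldType) (V : zmodType).
Implicit Types (f g : groupAlgebra F V).

Lemma supportedM (G H K : set V) f g : (forall x y, G x -> H y -> K (x + y)) ->
  supported G f -> supported H g -> supported K (f * g).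
Proof.
move=> GHK hf hg; apply: supported_linext hf => x Gx.
by apply: supported_linext hg => y Hy; apply: supported_expo; exact: GHK.
Qed.

End SupportProduct.

(** * Divided differences with denominator 1 - Y *)

Section DividedDifference.
Variables (A : comPzRingType) (Y Yi : A) (s d : A -> A).
Hypothesis YYi : Y * Yi = 1.
Hypothesis Yreg : forall f g, f * (1 - Y) = g * (1 - Y) -> f = g.
Hypothesis sB : forall f g, s (f - g) = s f - s g.
Hypothesis sK : forall f, s (s f) = f.
Hypothesis sY : forall f, s (Y * f) = Yi * s f.
Hypothesis dP : forall f, d f * (1 - Y) = f - s f.

Lemma divdiff_s f : d (s f) = - d f.
Proof. by apply: Yreg; rewrite mulNr !dP sK opprB. Qed.

(** Under s the numerator changes sign and the denominator becomes 1 - Y^-1 = - Y^-1 (1 - Y), whence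
    the factor Y. *)
Lemma s_divdiff f : s (d f) = Y * d f.
Proof.
apply: Yreg; have h := congr1 s (dP f).
rewrite mulrBr mulr1 sB [_ * Y]mulrC sY sB sK in h.
have h2 := congr1 ( *%R Y) h; rewrite mulrBr mulrA YYi mul1r in h2.
rewrite -mulrA dP -(opprB f) mulrN in h2 *.
have -> : Y * (f - s f) = - (Y * s (d f) - s (d f)) by rewrite h2 opprK.
ring.
Qed.

Lemma divdiffK f : d (d f) = d f.
Proof. by apply: Yreg; rewrite dP s_divdiff mulrBr mulr1 [Y * _]mulrC. Qed.

Lemma divdiff_mul e e' g f : g * (1 - Y) = 1 - e' -> s (e * f) = e * e' * s f ->
  d (e * f) = e * e' * d f + g * e * f.
Proof.
move=> hg he; apply: Yreg; rewrite dP he mulrDl -[e * e' * d f * _]mulrA dP.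
have -> : g * e * f * (1 - Y) = e * f * (g * (1 - Y)) by ring.
rewrite hg; ring.
Qed.

End DividedDifference.

Section DemazureOperators.
Variables (R : realType) (E : vectType R) (dot : {dot E for idfun}).
Variables (Phi : rootSystem dot) (M : metaplecticDatum Phi) (F : fieldType).
Implicit Types (a b : 'Hom(E, R^o)) (x y nu : E) (w u : 'End(E)) (i j : 'I_(rank Phi)).
Local Notation A := (groupAlgebra F E).
Implicit Types (f g h : A) (c : F).
Local Notation sr i := (tnth (simples Phi) i).
Local Notation Lm := (mlattice M).
Local Notation m := (mult M).

Definition rescaled_coroot i : E := coroot dot (sr i) *+ m (sr i).
Local Notation bet := rescaled_coroot.

Lemma bet_inf i (k : nat) : bet i *+ k = 0 -> k = 0%N.
Proof.
rewrite /bet -mulrnA -scaler_nat => /eqP; rewrite scaler_eq0 pnatr_eq0 muln_eq0.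
have m0 : (m (sr i) == 0%N) = false by rewrite gtn_eqF // mult_gt0.
rewrite m0 /= => /orP[/eqP //|/eqP c0].
have := coroot_self dot (simple_neq0 i); rewrite c0 linear0 => /eqP.
by rewrite eq_sym (pnatr_eq0 R 2).
Qed.

Lemma simple_bet i : sr i (bet i) = (2 * (m (sr i))%:Z)%:~R :> R.
Proof.
rewrite /bet raddfMn /= coroot_self ?simple_neq0 //.
by rewrite rmorphM /= mulr_natr.
Qed.

Definition root_quotient i x : int := (Num.floor (sr i x : R) %/ (m (sr i))%:Z)%Z.
Local Notation kk := root_quotient.

Lemma kk_shift i x nu (j : int) : sr i nu = (j * (m (sr i))%:Z)%:~R :> R ->
  kk i (nu + x) = j + kk i x.
Proof.
move=> h; rewrite /kk linearD /= h addrC floorDrz ?intr_int // intrKfloor addrC divzMDl //.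
by rewrite eqz_nat gtn_eqF // mult_gt0.
Qed.

Lemma kk_mlattice i nu (j : int) : sr i nu = (j * (m (sr i))%:Z)%:~R :> R -> kk i nu = j.
Proof.
move=> h; rewrite -[nu]addr0 (kk_shift _ h) /kk linear0 floor0 div0z addr0 //.
Qed.

(** The pairing of alpha_i with the rescaled coroot is 2 m, so removing k copies lowers the integer
    part by 2 k. This makes the rounded reflection an involution. *)
Lemma kk_reflect i x : kk i (x - bet i *~ kk i x) = - kk i x.
Proof.
have h : sr i (- (bet i *~ kk i x)) = ((- (2 * kk i x)) * (m (sr i))%:Z)%:~R :> R.
  rewrite linearN /= raddfMz /= simple_bet -mulrzl -intrM -rmorphN /=; congr (_%:~R); ring.
by rewrite addrC (kk_shift _ h); lia.
Qed.

Fact demazure_key : unit. Proof. by []. Qed.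

(* The action of s_i on F[Lm], extended to F[E] by rounding alpha_i to a multiple of
   m(alpha_i), so that the identities below need no integrality assumption. *)
Definition lattice_refl i : A -> A :=
  locked_with demazure_key (linext (fun x => expo F (x - bet i *~ kk i x))).

Definition geom_term i k : A := locked_with demazure_key (geom_quot F (bet i) k).

Definition divdiff i : A -> A :=
  locked_with demazure_key (linext (fun x => geom_term i (kk i x) * expo F x)).

Local Notation Y i := (expo F (bet i)).

Lemma spD i f g : lattice_refl i (f + g) = lattice_refl i f + lattice_refl i g.
Proof. rewrite /lattice_refl unlock; exact: linextD. Qed.
Lemma spZ i c f : lattice_refl i (c *: f) = c *: lattice_refl i f.
Proof. rewrite /lattice_refl unlock; exact: linextZ. Qed.
Lemma dmD i f g : divdiff i (f + g) = divdiff i f + divdiff i g.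
Proof. rewrite /divdiff unlock; exact: linextD. Qed.
Lemma dmZ i c f : divdiff i (c *: f) = c *: divdiff i f.
Proof. rewrite /divdiff unlock; exact: linextZ. Qed.

Lemma gmE i k : geom_term i k = geom_quot F (bet i) k.
Proof. by rewrite /geom_term unlock. Qed.

Lemma gmP i k : geom_term i k * (1 - Y i) = 1 - expo F (- (bet i *~ k)).
Proof. rewrite gmE; apply: geomP; exact: bet_inf. Qed.

Lemma sp_expo i x : lattice_refl i (expo F x) = expo F (x - bet i *~ kk i x).
Proof. rewrite /lattice_refl unlock; exact: linext_expo. Qed.

Lemma dm_expo i x : divdiff i (expo F x) = geom_term i (kk i x) * expo F x.
Proof. rewrite /divdiff unlock; exact: linext_expo. Qed.

Lemma Yinj i f g : f * (1 - Y i) = g * (1 - Y i) -> f = g.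
Proof. exact/sub1_expo_inj/bet_inf. Qed.

Lemma supported_gm i k : supported Lm (geom_term i k).
Proof.
have bL (n : nat) : Lm (bet i *+ n).
  elim: n => [|n IH]; first by rewrite mulr0n; exact: mlattice0.
  by rewrite mulrS; apply: mlatticeD => //; apply: mlattice_coroot; exact: simple_root.
rewrite gmE /geom_quot; case: k => n.
  rewrite -pmulrn gdiv_expoN; last exact: bet_inf.
  apply: supportedN; apply: supported_sum => j _; apply: supported_expo.
  by apply: mlatticeN; exact: bL.
rewrite NegzE mulrNz opprK -pmulrn gdiv_expoP; last exact: bet_inf.
by apply: supported_sum => j _; apply: supported_expo; exact: bL.
Qed.

End DemazureOperators.

Section QuadraticRelation.
Variables (F : fieldType) (A : comAlgType F) (y yi : A).
Hypothesis yyi : y * yi = 1.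
Hypothesis yreg : forall f g : A, f * (1 - y) = g * (1 - y) -> f = g.
Variables (q : F).
Hypothesis q0 : q != 0.
Let z := q - q^-1.

(* a = y^x, b = y^(s x), u = Y^k, d = (1 - Y^-k)/(1 - Y), s and dd are the images of d
   under s_i and the divided difference, and d' plays the role of d for s x. *)
Lemma quadratic_aux (a b d d' s dd u ui : A) (g g' : F) :
  u * ui = 1 -> d * (1 - y) = 1 - ui -> s * (1 - yi) = 1 - u -> dd * (1 - y) = d - s ->
  (g = -1 /\ g' = -1 /\ b = ui * a /\ d' * (1 - y) = 1 - u) \/
  (g * g' = (q ^+ 2)^-1 /\ d' * (1 - y) = 1 - y * u) ->
  (- q * g) *: ((- q * g') *: a + z *: (d' * b)) +
  z *: (s * ((- q * g) *: b + z *: (d * a)) + z *: (dd * a)) =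
  a + z *: ((- q * g) *: b + z *: (d * a)).
Proof.
move=> uui hd hs hdd hcase.
have qq1 : q%:A * q^-1%:A = 1 :> A by rewrite -scalerAl mul1r scalerA mulfV // scale1r.
have e : 1 - y = - y * (1 - yi).
  by have -> : - y * (1 - yi) = - y + y * yi; [ring|rewrite yyi addrC].
have hsui : s * ui = y * d.
  apply: yreg.
  rewrite -[y * d * _]mulrA hd {1}e.
  have -> : s * ui * (- y * (1 - yi)) = - (y * ui) * (s * (1 - yi)) by ring.
  have -> : y * (1 - ui) = - (y * ui) + y * (u * ui) by rewrite uui; ring.
  rewrite hs; ring.
(* Reduces the coefficient of z^2 to d, eliminating the divided difference. *)
have hsd : s * d + dd = d.
  apply: yreg; rewrite mulrDl -mulrA hd hdd.
  have -> : s * (1 - ui) + (d - s) = d - s * ui by ring.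
  by rewrite hsui -hd; ring.
have hs' : s * (1 - y) = - y * (1 - u).
  by rewrite e mulrCA hs.
(* The scalars become elements of the algebra, so that what remains is an identity in a commutative
   ring modulo the relations above. *)
have lin : forall G G' Z Q : A, Q = q%:A -> Z = z%:A -> G = g%:A -> G' = g'%:A ->
   - Q * G * (- Q * G' * a + Z * (d' * b)) + Z * (s * (- Q * G * b + Z * (d * a)) + Z * (dd * a)) =
   a + Z * (- Q * G * b + Z * (d * a)).
  move=> G G' Z Q eQ eZ eG eG'.
  have eQ2 : Q * Q - Q * Z = 1.
    rewrite eQ eZ /z -mulrBr -scalerBl opprB addrCA subrr addr0 //.
  have -> : - Q * G * (- Q * G' * a + Z * (d' * b)) + Z * (s * (- Q * G * b + Z * (d * a)) + Z *
    (dd * a)) =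
     Q * Q * (G * G') * a - Q * Z * G * ((d' + s) * b) + Z * Z * (s * d + dd) * a by ring.
  (* Of d' and s only the sum matters: it is 1 - u in the first case and 1 in the second. *)
  rewrite hsd; case: hcase => [[hg [hg' [hb hd']]]|[hg hd']].
    have -> : d' + s = 1 - u by apply: yreg; rewrite mulrDl hd' hs'; ring.
    have -> : G = -1 by rewrite eG hg scaleN1r.
    have -> : G' = -1 by rewrite eG' hg' scaleN1r.
    have -> : (1 - u) * b = (ui - u * ui) * a by rewrite hb; ring.
    rewrite uui hb; have -> : Z * (- Q * -1 * (ui * a) + Z * (d * a)) = Q * Z * (ui * a) + Z * Z *
      (d * a) by ring.
    have -> : Q * Q * (-1 * -1) * a - Q * Z * -1 * ((ui - 1) * a) + Z * Z * d * a =
      (Q * Q - Q * Z) * a + (Q * Z * (ui * a) + Z * Z * (d * a)) by ring.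
    by rewrite eQ2 mul1r.
  have -> : d' + s = 1 by apply: yreg; rewrite mulrDl hd' hs'; ring.
  have -> : Q * Q * (G * G') = 1.
    rewrite eQ eG eG' -!(scalerAl, scalerAr) !mulr1 !scalerA hg -expr2 mulfV ?scale1r //.
    by rewrite expf_neq0.
  ring.
have := lin _ _ _ _ erefl erefl erefl erefl.
have m2 (h : F) x : - q%:A * h%:A * x = (- q * h) *: x.
  by rewrite !mulNr -mulrA !mulr_algl scalerA scaleNr.
by rewrite !m2 !mulr_algl.
Qed.

End QuadraticRelation.

Section LinearMaps.
Variables (F : fieldType) (U V : lmodType F).

Definition lin (f : U -> V) :=
  (forall x y, f (x + y) = f x + f y) /\ (forall (c : F) x, f (c *: x) = c *: f x).

Lemma linD f g : lin f -> lin g -> lin (fun x => f x + g x).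
Proof.
move=> [fD fZ] [gD gZ]; split=> [x y|c x]; first by rewrite fD gD addrACA.
by rewrite fZ gZ scalerDr.
Qed.

Lemma linZ (k : F) f : lin f -> lin (fun x => k *: f x).
Proof.
move=> [fD fZ]; split=> [x y|c x]; first by rewrite fD scalerDr.
by rewrite fZ !scalerA mulrC.
Qed.

End LinearMaps.

Section LinearMapsTheory.
Variables (F : fieldType).

Lemma lin_comp (U V W : lmodType F) (f : V -> W) (g : U -> V) :
  lin f -> lin g -> lin (fun x => f (g x)).
Proof. by move=> [fD fZ] [gD gZ]; split=> [x y|c x]; rewrite (gD, gZ) (fD, fZ). Qed.

Lemma lin_id (U : lmodType F) : lin (fun x : U => x).
Proof. by []. Qed.

Lemma lin_mull (A : comAlgType F) (U : lmodType F) (a : A) (f : U -> A) :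
  lin f -> lin (fun x => a * f x).
Proof. by move=> [fD fZ]; split=> [x y|c x]; rewrite (fD, fZ) (mulrDr, scalerAr). Qed.

Lemma lin_mulr (A : comAlgType F) (U : lmodType F) (a : A) (f : U -> A) :
  lin f -> lin (fun x => f x * a).
Proof. by move=> [fD fZ]; split=> [x y|c x]; rewrite (fD, fZ) (mulrDl, scalerAl). Qed.

Lemma lin0 (U V : lmodType F) (f : U -> V) : lin f -> f 0 = 0.
Proof. by case=> _ fZ; rewrite -(scale0r 0) fZ scale0r. Qed.

Lemma linB (U V : lmodType F) (f : U -> V) x y : lin f -> f (x - y) = f x - f y.
Proof. by case=> fD fZ; rewrite -scaleN1r fD fZ scaleN1r. Qed.

Lemma linN (U V : lmodType F) (f : U -> V) x : lin f -> f (- x) = - f x.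
Proof. by case=> fD fZ; rewrite -scaleN1r fZ scaleN1r. Qed.

Lemma lin_sum (U V : lmodType F) (f : U -> V) (I : Type) (r : seq I) (Q : pred I) (g : I -> U) :
  lin f -> f (\sum_(i <- r | Q i) g i) = \sum_(i <- r | Q i) f (g i).
Proof. by move=> lf; apply: (big_morph f (proj1 lf) (lin0 lf)). Qed.

End LinearMapsTheory.

(** * The parameters g along the lattice *)

Section Metaplectic.
Variables (R : realType) (E : vectType R) (dot : {dot E for idfun}).
Variables (Phi : rootSystem dot) (M : metaplecticDatum Phi).
Variables (F : fieldType) (P : parameters M F).
Implicit Types (a b : 'Hom(E, R^o)) (x y nu : E) (w u : 'End(E)) (i j : 'I_(rank Phi)).
Local Notation A := (groupAlgebra F E).
Implicit Types (f g h : A) (c : F).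
Local Notation sr i := (tnth (simples Phi) i).
Local Notation Root := (rootset Phi).
Local Notation sS := (@simple_reflection R E dot Phi).
Local Notation isW := (isW Phi).
Local Notation L := (lattice M).
Local Notation m := (mult M).
Local Notation gB := (gB P).
Local Notation q := (qq P).
Local Notation z := (q - q^-1).
Local Notation kk := (root_quotient M).
Local Notation geom_term := (geom_term M F).
Local Notation bet := (rescaled_coroot M).

Lemma gg_shift (j k : int) : gg P (j + k * (deg M)%:Z) = gg P j.
Proof.
have nat (n : nat) l : gg P (l + n%:Z * (deg M)%:Z) = gg P l.
  elim: n l => [|n IH] l; first by rewrite mul0r addr0.
  by rewrite intS mulrDl mul1r addrA -addrA -[RHS]gg_period -[RHS](IH) addrAC addrA addrAC.
case: k => n; first exact: nat.
by rewrite -[in RHS](subrK (n.+1%:Z * (deg M)%:Z) j) nat NegzE mulNr.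
Qed.

Lemma gB_val x a (n : int) : a \in Root -> L x -> a x = n%:~R :> R ->
  gB x a = gg P (- (n * Qcoroot M a)).
Proof. by move=> ra Lx hn; rewrite /Defs.gB (Bform_coroot ra Lx hn) intrKfloor. Qed.

(** Shifting a(x) by a multiple of m(a) moves the index of g by a multiple of n. So g is constant on
    cosets of [Lm], the source of the Bernstein relation [T_mul]. *)
Lemma gB_shift x y a (k : int) : a \in Root -> L x -> L y -> a y = (k * (m a)%:Z)%:~R :> R ->
  gB (y + x) a = gB x a.
Proof.
move=> ra Lx Ly hy; have [n hn] := lattice_int ra Lx.
rewrite (gB_val ra Lx hn) (@gB_val _ _ (k * (m a)%:Z + n)) //; last 2 first.
- exact: latticeD.
- by rewrite linearD /= hy hn -intrD.
have /dvdzP[l hl] : ((deg M)%:Z %| k * (m a)%:Z * Qcoroot M a)%Z.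
  by rewrite multP dvdz_mull.
have -> : - ((k * (m a)%:Z + n) * Qcoroot M a) = - (n * Qcoroot M a) + (- l) * (deg M)%:Z.
  by rewrite mulrDl hl; ring.
exact: gg_shift.
Qed.

Lemma gB_one x a (k : int) : a \in Root -> L x -> a x = (k * (m a)%:Z)%:~R :> R -> gB x a = -1.
Proof.
move=> ra Lx hn; rewrite (gB_val ra Lx hn) gg_dvd //.
by rewrite dvdzE abszN -dvdzE multP dvdz_mull.
Qed.

(** Passing from x to s_i x negates the index, so up to the period the product is g_j g_(n-j). *)
Lemma gB_inv x i (n : int) : L x -> sr i x = n%:~R :> R -> ~~ ((m (sr i))%:Z %| n)%Z ->
  gB x (sr i) * gB (sS i x) (sr i) = (q ^+ 2)^-1.
Proof.
move=> Lx hn nd; have ri := simple_root i.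
have hs : sr i (sS i x) = (- n)%:~R :> R.
  by rewrite -comp_lfunE simple_comp_self opp_lfunE hn rmorphN.
rewrite (gB_val ri Lx hn) (gB_val ri (lattice_reflection ri Lx) hs) mulNr opprK.
have nd' : ~~ ((deg M)%:Z %| - (n * Qcoroot M (sr i)))%Z.
  by rewrite dvdzE abszN -dvdzE multP.
rewrite -(gg_inv P nd') opprK addrC -[X in gg P X]add0r; congr (_ * _).
by rewrite gg_period.
Qed.

Lemma gB_comp x a w : isW w -> a \in Root -> L x -> gB x (a \o w)%VF = gB (w x) a.
Proof.
move=> Ww ra Lx; rewrite /Defs.gB; congr (gg P (- Num.floor _)).
have [s e] := Ww; rewrite -{1}e coroot_word -(word_rev_inv e).
rewrite -(Bform_isW Ww Lx); last by apply: lattice_isW; [exact: isWV|exact: lattice_root].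
by rewrite -[w (_ (coroot _ _))]comp_lfunE (isW_KV Ww) id_lfunE.
Qed.

Lemma piT_expo i x : piT P i (expo F x) =
  (- q * gB x (sr i)) *: expo F (sS i x) + z *: (geom_term i (kk i x) * expo F x).
Proof.
have e1 : coroot dot (sr i) *~ (m (sr i))%:Z = bet i by rewrite -pmulrn.
have e2 : coroot dot (sr i) *~ ((Num.floor (sr i x : R) %% (m (sr i))%:Z)%Z - Num.floor (sr i x :
  R)) = - (bet i *~ kk i x).
  rewrite /root_quotient /rescaled_coroot pmulrn -mulrzA -mulrNz; congr (_ *~ _).
  by rewrite {2}(divz_eq (Num.floor (sr i x : R)) (m (sr i))%:Z); ring.
by rewrite /piT linext_expo e1 e2 gmE.
Qed.

End Metaplectic.

(* Conversion on [groupAlgebra] unfolds the multiplication of [malg]; what is needed of the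
   group algebra and of its operators is therefore collected in an interface, and the Hecke
   algebra computations are carried out over it. *)
Record metaplecticAlgebra (R : realType) (E : vectType R) (dot : {dot E for idfun})
    (Phi : rootSystem dot) (M : metaplecticDatum Phi) (F : fieldType) (P : parameters M F) := {
  car : comAlgType F;
  ex : E -> car;
  supp : set E -> car -> Prop;
  spa : 'I_(rank Phi) -> car -> car;
  dma : 'I_(rank Phi) -> car -> car;
  gma : 'I_(rank Phi) -> int -> car;
  Ta : 'I_(rank Phi) -> car -> car;
  wa : (E -> E) -> car -> car;
  comp : set E -> car -> car;
  exM : forall x y, ex x * ex y = ex (x + y);
  ex0 : ex 0 = 1;
  suppT : forall f, supp setT f;
  supp_lin_eq : forall (G : set E) (f g : car -> car), lin f -> lin g ->
    (forall x, G x -> f (ex x) = g (ex x)) -> forall h, supp G h -> f h = g h;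
  supp_lin : forall (G H : set E) (f : car -> car), lin f ->
    (forall x, G x -> supp H (f (ex x))) -> forall h, supp G h -> supp H (f h);
  supp_ex : forall (G : set E) x, G x -> supp G (ex x);
  supp0 : forall G : set E, supp G 0;
  suppD : forall (G : set E) f g, supp G f -> supp G g -> supp G (f + g);
  suppZ : forall (G : set E) c f, supp G f -> supp G (c *: f);
  suppM : forall (G H K : set E) f g, (forall x y, G x -> H y -> K (x + y)) ->
    supp G f -> supp H g -> supp K (f * g);
  lin_spa : forall i, lin (spa i);
  lin_dma : forall i, lin (dma i);
  lin_Ta : forall i, lin (Ta i);
  lin_wa : forall t, lin (wa t);
  lin_compo : forall G, lin (comp G);
  wa_ex : forall t x, wa t (ex x) = ex (t x);
  comp_ex : forall (G : set E) x, comp G (ex x) = if `[< G x >] then ex x else 0;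
  spa_ex : forall i x, spa i (ex x) = ex (x - rescaled_coroot M i *~ root_quotient M i x);
  dma_ex : forall i x, dma i (ex x) = gma i (root_quotient M i x) * ex x;
  gmaP : forall i k, gma i k * (1 - ex (rescaled_coroot M i)) = 1 - ex (- (rescaled_coroot M i *~
    k));
  supp_gma : forall i k, supp (mlattice M) (gma i k);
  bet_reg : forall i f g, f * (1 - ex (rescaled_coroot M i)) = g * (1 - ex (rescaled_coroot M i))
    -> f = g;
  Ta_ex : forall i x, Ta i (ex x) =
    (- qq P * gB P x (tnth (simples Phi) i)) *: ex (simple_reflection i x) +
    (qq P - (qq P)^-1) *: (gma i (root_quotient M i x) * ex x)
}.

Arguments ex {R E dot Phi M F P} X x : rename.
Arguments supp {R E dot Phi M F P} X G f : rename.
Arguments spa {R E dot Phi M F P} X i f : rename.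
Arguments dma {R E dot Phi M F P} X i f : rename.
Arguments gma {R E dot Phi M F P} X i k : rename.
Arguments Ta {R E dot Phi M F P} X i f : rename.
Arguments wa {R E dot Phi M F P} X t f : rename.
Arguments comp {R E dot Phi M F P} X G f : rename.

Section ConcreteAlgebra.
Variables (R : realType) (E : vectType R) (dot : {dot E for idfun}).
Variables (Phi : rootSystem dot) (M : metaplecticDatum Phi).
Variables (F : fieldType) (P : parameters M F).

Definition GA : comAlgType F := groupAlgebra F E.

Lemma GA_lin_linext (t : E -> GA) : @lin F GA GA (linext t).
Proof. by split=> [f g|c f]; [exact: linextD|exact: linextZ]. Qed.

Lemma GA_supp_lin_eq (G : set E) (f g : GA -> GA) : lin f -> lin g ->
  (forall x, G x -> f (expo F x) = g (expo F x)) -> forall h, supported G h -> f h = g h.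
Proof.
move=> lf lg e; apply: supported_ind => [|h h' e1 e2|c h e1|x Gx]; last exact: e.
- exact: (etrans (lin0 lf) (esym (lin0 lg))).
- exact: (etrans (proj1 lf h h') (etrans (congr2 +%R e1 e2) (esym (proj1 lg h h')))).
exact: (etrans (proj2 lf c h) (etrans (congr1 ( *:%R c) e1) (esym (proj2 lg c h)))).
Qed.

Lemma GA_supp_lin (G H : set E) (f : GA -> GA) : lin f ->
  (forall x, G x -> supported H (f (expo F x))) ->
  forall h, supported G h -> supported H (f h).
Proof.
move=> lf e; apply: supported_ind => [|h h' e1 e2|c h e1|x Gx]; last exact: e.
- exact: (eq_ind _ (supported H) (@supported0 F E H) _ (esym (lin0 lf))).
- exact: (eq_ind _ (supported H) (supportedD e1 e2) _ (esym (proj1 lf h h'))).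
have e2 : f (c *: h) = c *: f h := proj2 lf c h.
by rewrite e2; exact: supportedZ.
Qed.

Lemma GA_comp_ex (G : set E) x :
  component G (expo F x) = if `[< G x >] then expo F x else 0.
Proof. exact: linext_expo. Qed.

Lemma GA_wa_ex (t : E -> E) x : linext (fun x => expo F (t x)) (expo F x) = expo F (t x).
Proof. exact: linext_expo. Qed.

(** Transparent, so that statements over the interface convert to statements about [groupAlgebra]
    and [piT]. *)
Definition concreteAlgebra : metaplecticAlgebra P.
Proof.
refine (@Build_metaplecticAlgebra R E dot Phi M F P GA (@expo F E) (@supported F E)
  (@lattice_refl R E dot Phi M F) (@divdiff R E dot Phi M F) (@geom_term R E dot Phi M F)
  (@piT R E dot Phi M F P) (fun t => linext (fun x => expo F (t x))) (@component F E)
  _ _ _ _ _ _ _ _ _ _ _ _ _ _ _ _ _ _ _ _ _ _ _).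
- exact: expoM.
- exact: expo1.
- by [].
- exact: GA_supp_lin_eq.
- exact: GA_supp_lin.
- exact: supported_expo.
- exact: supported0.
- exact: supportedD.
- exact: supportedZ.
- exact: supportedM.
- by move=> i; split=> [f g|c f]; [exact: spD|exact: spZ].
- by move=> i; split=> [f g|c f]; [exact: dmD|exact: dmZ].
- by move=> i; exact: GA_lin_linext.
- by move=> i; exact: GA_lin_linext.
- by move=> i; exact: GA_lin_linext.
- exact: GA_wa_ex.
- exact: GA_comp_ex.
- exact: sp_expo.
- exact: dm_expo.
- exact: gmP.
- exact: supported_gm.
- exact: Yinj.
exact: piT_expo.
Defined.

End ConcreteAlgebra.

(** * The Bernstein and quadratic relations for pi(T_i) *)

Section HeckeAlgebra.
Variables (R : realType) (E : vectType R) (dot : {dot E for idfun}).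
Variables (Phi : rootSystem dot) (M : metaplecticDatum Phi).
Variables (F : fieldType) (P : parameters M F) (X : metaplecticAlgebra P).
Local Notation A := (car X).
Local Notation e := (ex X).
Local Notation sr i := (tnth (simples Phi) i).
Local Notation pos := (posroots Phi).
Local Notation sS := (@simple_reflection R E dot Phi).
Local Notation L := (lattice M).
Local Notation Lm := (mlattice M).
Local Notation m := (mult M).
Local Notation q := (qq P).
Local Notation z := (q - q^-1).
Local Notation bet := (rescaled_coroot M).
Local Notation kk := (root_quotient M).
Local Notation W := (weylT Phi).
Local Notation wv := (@weyl_val R E dot Phi).
Local Notation mkW := (@weyl_of R E dot Phi).
Local Notation len := (len Phi).
Local Notation hh := (hh P).
Local Notation word := (word (Phi := Phi)).
Local Notation rword := (reduced_word Phi).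
Local Notation w0 := (w0 Phi).
Local Notation isW := (isW Phi).
Local Notation is_reduced := (is_reduced (Phi := Phi)).
Local Notation supp := (supp X).
Local Notation Y_reg i := (@bet_reg _ _ _ _ _ _ _ X i).
Local Notation stab := (stab Phi).
Implicit Types (i j k l : 'I_(rank Phi)) (r t : seq 'I_(rank Phi)) (f g h : A).

Section AbstractOperators.
Implicit Types (x y nu : E) (w u : 'End(E)) (c : F).
Local Notation s := (spa X).
Local Notation d := (dma X).
Local Notation geom_term := (gma X).
Local Notation T := (Ta X).
Local Notation Y i := (e (bet i)).

Lemma lin_ext (f g : A -> A) : lin f -> lin g -> (forall x, f (e x) = g (e x)) -> f =1 g.
Proof.
move=> lf lg h a; apply: (supp_lin_eq (G := setT)) => //; exact: suppT.
Qed.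

Lemma ex_mulVK x f : e (- x) * (e x * f) = f.
Proof. by rewrite mulrA exM addNr ex0 mul1r. Qed.

Lemma kk_eq i nu (j : int) : sr i nu = (j * (m (sr i))%:Z)%:~R :> R -> kk i nu = j.
Proof. exact: kk_mlattice. Qed.

Lemma sD i f g : s i (f + g) = s i f + s i g.
Proof. exact: (proj1 (lin_spa X i)). Qed.
Lemma sZ i c f : s i (c *: f) = c *: s i f.
Proof. exact: (proj2 (lin_spa X i)). Qed.
Lemma sB i f g : s i (f - g) = s i f - s i g.
Proof. exact/linB/lin_spa. Qed.
Lemma s0 i : s i 0 = 0.
Proof. exact/lin0/lin_spa. Qed.
Lemma dD i f g : d i (f + g) = d i f + d i g.
Proof. exact: (proj1 (lin_dma X i)). Qed.
Lemma dZ i c f : d i (c *: f) = c *: d i f.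
Proof. exact: (proj2 (lin_dma X i)). Qed.
Lemma d0 i : d i 0 = 0.
Proof. exact/lin0/lin_dma. Qed.

Lemma dP i f : d i f * (1 - Y i) = f - s i f.
Proof.
move: f; apply: lin_ext => [||x].
- exact/lin_mulr/lin_dma.
- apply: linD => //; split=> [f g|c f]; first by rewrite sD opprD.
  by rewrite sZ scalerN.
by rewrite dma_ex spa_ex mulrAC gmaP mulrBl mul1r exM [- _ + x]addrC.
Qed.

Lemma sK i f : s i (s i f) = f.
Proof.
move: f; apply: lin_ext => [||x] //; first exact: lin_comp (lin_spa X i) (lin_spa X i).
by rewrite !spa_ex kk_reflect mulrNz opprK subrK.
Qed.

Lemma s_mulex i nu (j : int) f : sr i nu = (j * (m (sr i))%:Z)%:~R :> R ->
  s i (e nu * f) = e (nu - bet i *~ j) * s i f.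
Proof.
move=> h; move: f; apply: lin_ext => [||x].
- by apply: lin_comp (lin_spa X i) _; apply: lin_mull.
- exact/lin_mull/lin_spa.
rewrite exM !spa_ex exM (kk_shift _ h) mulrzDr; congr (e _).
by rewrite opprD addrACA.
Qed.

Lemma s_Y i f : s i (Y i * f) = e (- bet i) * s i f.
Proof.
rewrite (s_mulex _ (simple_bet M i)); congr (e _ * _).
by rewrite -pmulrn mulr2n opprD addrA subrr sub0r.
Qed.

Lemma Y_inv i : Y i * e (- bet i) = 1.
Proof. by rewrite exM addrN ex0. Qed.

Lemma d_s i f : d i (s i f) = - d i f.
Proof. exact: (divdiff_s (Y_reg i) (sK i) (dP i)). Qed.

Lemma s_d i f : s i (d i f) = Y i * d i f.
Proof. exact: (s_divdiff (Y_inv i) (Y_reg i) (sB i) (sK i) (s_Y i) (dP i)). Qed.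

Lemma d_d i f : d i (d i f) = d i f.
Proof. exact: (divdiffK (Y_inv i) (Y_reg i) (sB i) (sK i) (s_Y i) (dP i)). Qed.

Lemma d_mulex i nu (j : int) f : sr i nu = (j * (m (sr i))%:Z)%:~R :> R ->
  d i (e nu * f) = e (nu - bet i *~ j) * d i f + geom_term i j * e nu * f.
Proof.
move=> h; have es := s_mulex f h; rewrite -exM in es *.
exact: (divdiff_mul (Y_reg i) (dP i) (gmaP X i j) es).
Qed.

Lemma gm0 i : geom_term i 0 = 0.
Proof. by apply: (Y_reg i); rewrite gmaP mulr0z oppr0 ex0 subrr mul0r. Qed.

Lemma gm1 i : geom_term i 1 = - e (- bet i).
Proof.
apply: (Y_reg i).
by rewrite gmaP mulr1z mulNr mulrBr mulr1 exM addNr ex0 opprB.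
Qed.

Lemma gm2 i : geom_term i 2 = - e (- bet i) - e (- (bet i *~ 2)).
Proof.
apply: (Y_reg i).
rewrite gmaP mulrBl !mulNr !mulrBr !mulr1 !exM addNr ex0.
have -> : - (bet i *~ 2) + bet i = - bet i by rewrite -pmulrn mulr2n opprD addrNK.
by rewrite !opprB; ring.
Qed.

Lemma ss_bet i nu (k : int) : sr i nu = (k * (m (sr i))%:Z)%:~R :> R -> sS i nu = nu - bet i *~ k.
Proof.
by move=> hk; rewrite reflectionE hk scaler_int /rescaled_coroot [k * _]mulrC mulrzA -pmulrn.
Qed.

Lemma s_ex i x : Lm x -> s i (e x) = e (sS i x).
Proof.
move=> [_ /(_ _ (simple_root i))[k hk]].
by rewrite spa_ex (kk_eq hk) (ss_bet hk).
Qed.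

Lemma s_1 i : s i 1 = 1.
Proof. by rewrite -(ex0 X) s_ex ?linear0 //; exact: mlattice0. Qed.

Lemma d_1 i : d i 1 = 0.
Proof.
apply: (Y_reg i); by rewrite dP s_1 subrr mul0r.
Qed.

Lemma supp_s i f : supp Lm f -> supp Lm (s i f).
Proof.
apply: supp_lin => [|x hx]; first exact: lin_spa.
rewrite s_ex //; apply: supp_ex; apply: mlattice_isW => //; exact: isW_simple.
Qed.

Lemma supp_d i f : supp Lm f -> supp Lm (d i f).
Proof.
apply: supp_lin => [|x hx]; first exact: lin_dma.
rewrite dma_ex; apply: (suppM (G := Lm) (H := Lm)) => [y t||]; first exact: mlatticeD.
  exact: supp_gma.
exact: supp_ex.
Qed.

(** A factor in F[L^m] does not affect g ([gB_shift]), and the divided difference is a twisted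
    derivation; the metaplectic twist is therefore confined to h. *)
Lemma T_mul i f h : supp Lm f -> supp L h ->
  T i (f * h) = s i f * T i h + z *: (d i f * h).
Proof.
move=> hf; move: h; have lT := lin_Ta X i; have lid := @lin_id F A.
apply: supp_lin_eq => [||x Lx].
- by apply: lin_comp => //; apply: lin_mull.
- by apply: linD; [exact: lin_mull|apply: linZ; exact: lin_mull].
move: f hf; apply: supp_lin_eq => [||nu hnu].
- by apply: lin_comp => //; apply: lin_mulr.
- apply: linD; first exact/lin_mulr/lin_spa.
  by apply: linZ; apply: lin_mulr; exact: lin_dma.
have [Lnu /(_ _ (simple_root i))[k hk]] := hnu.
have ek : geom_term i (kk i (nu + x)) * e (nu + x) =
    e (sS i nu) * (geom_term i (kk i x) * e x) + geom_term i k * e nu * e x.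
  by rewrite -dma_ex -exM (d_mulex _ hk) dma_ex (ss_bet hk).
rewrite exM !Ta_ex (gB_shift P (simple_root i) Lx Lnu hk) ek linearD /=.
rewrite [d i (e nu)]dma_ex (kk_eq hk) s_ex // -(exM X (sS i nu)).
by rewrite scalerDr addrA mulrDr -!scalerAr.
Qed.

Lemma supp_T i f : supp L f -> supp L (T i f).
Proof.
apply: supp_lin => [|x hx]; first exact: lin_Ta.
rewrite Ta_ex; apply: suppD; apply: suppZ.
  by apply: supp_ex; exact: lattice_reflection (simple_root i) hx.
apply: (suppM (G := Lm) (H := L)) => [y t [Ly _]||]; first exact: latticeD.
  exact: supp_gma.
exact: supp_ex.
Qed.

Lemma T_quad i f : supp L f -> T i (T i f) = f + z *: T i f.
Proof.
have lT := lin_Ta X i; have lid := @lin_id F A.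
move: f; apply: supp_lin_eq => [||x Lx]; first exact: lin_comp.
  by apply: linD => //; apply: linZ.
have ri := simple_root i; have [n hn] := lattice_int ri Lx.
have Lsx : L (sS i x) := lattice_reflection ri Lx.
have hs : sr i (sS i x) = (- n)%:~R :> R.
  by rewrite -comp_lfunE simple_comp_self opp_lfunE hn rmorphN.
set k := kk i x; have [TD TZ] := lin_Ta X i.
have e0 := T_mul i (supp_gma X i k) (supp_ex X Lx).
have ssx : sS i (sS i x) = x by rewrite -comp_lfunE simpleK id_lfunE.
have e2 := Ta_ex X i (sS i x); rewrite ssx in e2.
rewrite {1}Ta_ex TD !TZ e2 e0 Ta_ex -/k.
have gk : s i (geom_term i k) * (1 - e (- bet i)) = 1 - e (bet i *~ k).
  have := congr1 (s i) (gmaP X i k).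
  rewrite mulrBr mulr1 sB [geom_term i k * _]mulrC s_Y sB s_1.
  rewrite [s i (geom_term i k) * (1 - _)]mulrC mulrBl mul1r => ->; congr (1 - _).
  have h1 : sr i (- (bet i *~ k)) = ((- (2 * k)) * (m (sr i))%:Z)%:~R :> R.
    by rewrite linearN /= raddfMz /= simple_bet -mulrzl -intrM -rmorphN /=; congr (_%:~R); ring.
  rewrite spa_ex (kk_eq h1); congr (e _).
  by rewrite -!mulrNz -mulrzDr; congr (_ *~ _); ring.
apply: (quadratic_aux (Y_inv i) (Y_reg i) (qq_neq0 P)
  (u := e (bet i *~ k)) _ (gmaP X i k) gk (dP _ _)).
  by rewrite exM addrN ex0.
have fl : Num.floor (sr i x : R) = n by rewrite hn intrKfloor.
have fls : Num.floor (sr i (sS i x) : R) = - n by rewrite hs intrKfloor.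
have m0 := mult_gt0 M (sr i).
have hk : k = (n %/ (m (sr i))%:Z)%Z by rewrite /k /root_quotient fl.
have hk' : kk i (sS i x) = ((- n) %/ (m (sr i))%:Z)%Z by rewrite /root_quotient fls.
have mz : (m (sr i))%:Z != 0 by rewrite eqz_nat gtn_eqF.
have [dn|nd] := boolP ((m (sr i))%:Z %| n)%Z.
  have en : n = k * (m (sr i))%:Z by rewrite hk divzK.
  have hk2 : kk i (sS i x) = - k by rewrite hk' en -mulNr mulzK.
  left; split; first by apply: (@gB_one _ _ _ _ _ _ _ _ _ k) => //; rewrite -en.
  split; first by apply: (@gB_one _ _ _ _ _ _ _ _ _ (- k)) => //; rewrite mulNr -en.
  split; last by rewrite gmaP hk2 mulrNz opprK.
  by rewrite exM addrC (ss_bet (k := k)) // -en.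
right; split; first exact: (gB_inv P Lx hn nd).
rewrite gmaP; congr (1 - _); rewrite exM; congr (e _).
(* For t not an integer, the integer part of - t is one less than minus that of t. *)
have -> : kk i (sS i x) = - k - 1.
  rewrite hk' hk.
  have h1 := divz_eq n (m (sr i))%:Z.
  have h2 := modz_ge0 n mz; have h3 : ((n %% (m (sr i))%:Z)%Z < (m (sr i))%:Z)%R by apply: ltz_pmod.
  have h4 : (n %% (m (sr i))%:Z)%Z != 0 by apply: contra nd => /eqP h4; apply/dvdz_mod0P.
  have -> : - n = (- (n %/ (m (sr i))%:Z)%Z - 1) * (m (sr i))%:Z + ((m (sr i))%:Z - (n %% (m (sr
    i))%:Z)%Z).
    by rewrite {1}h1; ring.
  rewrite divzMDl // [X in _ + X]divz_small ?addr0 //.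
  by rewrite absz_nat; lia.
by rewrite -mulrNz opprD !opprK mulrzDr mulr1z addrC.
Qed.

End AbstractOperators.

(** * The Hecke module and the braid relations *)

Section HeckeModule.
Implicit Types (x y nu : E) (c : F).
Local Notation s := (spa X).
Local Notation d := (dma X).
Local Notation geom_term := (gma X).
Implicit Types (w u v : W).

Definition lrefl i w : W := mkW (sS i \o wv w)%VF.
Definition ascent i w : bool := (sr i \o wv w)%VF \in pos.

Lemma wv_lw i w : wv (lrefl i w) = (sS i \o wv w)%VF.
Proof. by rewrite mkWK //; apply: isW_simpleM; exact: isW_wv. Qed.

Lemma lwK i : involutive (lrefl i).
Proof. by move=> w; apply: wv_inj; rewrite !wv_lw simpleKl. Qed.

Lemma up_lw i w : ascent i (lrefl i w) = ~~ ascent i w.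
Proof.
rewrite /ascent wv_lw comp_lfunA simple_comp_self comp_lfunNl posN //.
exact: isW_root (isW_wv w) (simple_root i).
Qed.

Lemma len_lw i w : ascent i w -> len (wv (lrefl i w)) = (len (wv w)).+1.
Proof. by move=> h; rewrite wv_lw len_up //; exact: isW_wv. Qed.

(* F[E] (x) H, with H the finite Hecke algebra and basis T_w; the value at w is the
   coefficient of T_w, and T_i acts by the Bernstein relation. *)
Definition heckeMod := {ffun W -> A}.
Implicit Types (phi psi : heckeMod).

(** The coefficient of T_w in T_i phi. The terms with s_i come from T_i T_u: it equals T_(s_i u) if
    s_i raises u and T_(s_i u) + z T_u otherwise, so [lrefl i w] always contributes and w itself
    only when s_i is a left descent of w. *)
Definition heckeT i phi : heckeMod := locked [ffun w =>
  z *: d i (phi w) + s i (phi (lrefl i w)) + (if ascent i w then 0 else z *: s i (phi w))].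

Definition heckeTinv i phi : heckeMod := locked (heckeT i phi - z *: phi).

Definition scale_coefs f phi : heckeMod := locked [ffun w => f * phi w].

Definition heckeB u : heckeMod := locked [ffun w => (w == u)%:R].

Lemma IIE i phi : heckeTinv i phi = heckeT i phi - z *: phi.
Proof. by rewrite /heckeTinv -lock. Qed.

(** Turns scaling into multiplication, so that identities between operators become ring
    identities. *)
Lemma scale_mul c : exists C : A, forall f, c *: f = C * f.
Proof. by exists c%:A => f; rewrite mulr_algl. Qed.

Lemma TTE i phi w : heckeT i phi w =
  z *: d i (phi w) + s i (phi (lrefl i w)) + (if ascent i w then 0 else z *: s i (phi w)).
Proof. by rewrite /heckeT -lock ffunE. Qed.

Lemma mulNE f phi w : scale_coefs f phi w = f * phi w.
Proof. by rewrite /scale_coefs -lock ffunE. Qed.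

Lemma HMD phi psi w : (phi + psi) w = phi w + psi w.
Proof. exact: ffunE. Qed.

Lemma HMN phi w : (- phi) w = - phi w.
Proof. exact: ffunE. Qed.

Lemma HMZ c phi w : (c *: phi) w = c *: phi w.
Proof. exact: ffunE. Qed.

Definition HME := (TTE, mulNE, HMD, HMN, HMZ).

Lemma beE u w : heckeB u w = (w == u)%:R.
Proof. by rewrite /heckeB -lock ffunE. Qed.

Lemma lin_TT i : lin (heckeT i).
Proof.
split=> [phi psi|c phi]; apply/ffunP => w; rewrite !HME.
  rewrite dD !sD [z *: (_ + _)]scalerDr.
  by case: (ascent i w); have [Z zE] := scale_mul z; rewrite !zE; ring.
rewrite dZ !sZ; have [Z zE] := scale_mul z; have [C cE] := scale_mul c.
by case: (ascent i w); rewrite !zE !cE; ring.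
Qed.

Lemma lin_mulN f : lin (scale_coefs f).
Proof.
split=> [phi psi|c phi]; apply/ffunP => w; rewrite !HME; first by rewrite mulrDr.
by rewrite scalerAr.
Qed.

Lemma lin_II i : lin (heckeTinv i).
Proof.
have [TD TZ] := lin_TT i; split=> [phi psi|c phi]; rewrite !IIE.
  by rewrite TD scalerDr opprD addrACA.
by rewrite TZ scalerBr !scalerA mulrC.
Qed.

Lemma TT_quad i phi : heckeT i (heckeT i phi) = phi + z *: heckeT i phi.
Proof.
apply/ffunP => w; rewrite !HME lwK up_lw.
have sE f : s i f = f - d i f * (1 - e (bet i)) by rewrite dP subKr.
have [Z zE] := scale_mul z.
case: (ascent i w) => /=; rewrite ?addr0 !(dD, sD, dZ, sZ, d_s, s_d, d_d, sK) !sE !zE; ring.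
Qed.

Lemma IITT i phi : heckeTinv i (heckeT i phi) = phi.
Proof. by rewrite !IIE TT_quad addrK. Qed.

Lemma TTII i phi : heckeT i (heckeTinv i phi) = phi.
Proof. by rewrite !IIE (linB _ _ (lin_TT i)) (proj2 (lin_TT i)) TT_quad addrK. Qed.

Lemma TT_E i phi : heckeT i phi = heckeTinv i phi + z *: phi.
Proof. by rewrite IIE subrK. Qed.

Lemma mulNA f g phi : scale_coefs f (scale_coefs g phi) = scale_coefs (f * g) phi.
Proof. by apply/ffunP => w; rewrite !HME mulrA. Qed.

Lemma mulN1 phi : scale_coefs 1 phi = phi.
Proof. by apply/ffunP => w; rewrite !HME mul1r. Qed.

Lemma mulNDl f g phi : scale_coefs (f + g) phi = scale_coefs f phi + scale_coefs g phi.
Proof. by apply/ffunP => w; rewrite !HME mulrDl. Qed.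

Lemma mulNNl f phi : scale_coefs (- f) phi = - scale_coefs f phi.
Proof. by apply/ffunP => w; rewrite !HME mulNr. Qed.

Definition has_quotient i nu (n : int) := sr i nu = (n * (m (sr i))%:Z)%:~R :> R.
Local Notation Kv := has_quotient.

Lemma Bernstein i nu (n : int) phi : Kv i nu n ->
  heckeT i (scale_coefs (e nu) phi) =
  scale_coefs (e (nu - bet i *~ n)) (heckeT i phi) + z *: scale_coefs (geom_term i n * e nu) phi.
Proof.
move=> h; apply/ffunP => w; rewrite !HME (d_mulex _ h) !(s_mulex _ h).
have [Z zE] := scale_mul z; case: (ascent i w); rewrite ?addr0 !zE; ring.
Qed.

Lemma Bernstein0 i nu phi : Kv i nu 0 -> heckeT i (scale_coefs (e nu) phi) = scale_coefs (e nu)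
  (heckeT i phi).
Proof.
move=> h; rewrite (Bernstein _ h) mulr0z subr0 gm0 mul0r.
by rewrite [scale_coefs 0 _](_ : _ = 0) ?scaler0 ?addr0 //; apply/ffunP => w; rewrite mulNE mul0r
  ffunE.
Qed.

(** For pairing one the quotient is (1 - Y^-1) / (1 - Y) = - Y^-1, and the correction term is
    exactly what turns T_i into T_i - z, its inverse. *)
Lemma Bernstein1 i nu phi : Kv i nu 1 ->
  heckeT i (scale_coefs (e nu) phi) = scale_coefs (e (nu - bet i)) (heckeTinv i phi).
Proof.
move=> h; rewrite (Bernstein _ h) mulr1z gm1 mulNr exM mulNNl [- _ + nu]addrC scalerN.
by rewrite !IIE (linB _ _ (lin_mulN _)) (proj2 (lin_mulN _)).
Qed.

(** Here the quotient has two terms; the additional one is a plain translation. This case arises in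
    the braid relation of length six. *)
Lemma Bernstein2 i nu phi : Kv i nu 2 ->
  heckeT i (scale_coefs (e nu) phi) =
  scale_coefs (e (nu - bet i *~ 2)) (heckeTinv i phi) - z *: scale_coefs (e (nu - bet i)) phi.
Proof.
move=> h; rewrite (Bernstein _ h) gm2 mulrBl mulNr !exM mulNDl !mulNNl.
rewrite !IIE (linB _ _ (lin_mulN _)) (proj2 (lin_mulN _)) scalerDr !scalerN.
by rewrite [- _ + nu]addrC [- (bet i *~ 2) + nu]addrC -addrA [- _ - _]addrC.
Qed.

Lemma TT_be i u : ascent i u -> heckeT i (heckeB u) = heckeB (lrefl i u).
Proof.
move=> hu; apply/ffunP => w; rewrite TTE !beE.
have e1 : (lrefl i w == u) = (w == lrefl i u) by rewrite -{1}(lwK i u) (inj_eq (inv_inj (lwK i))).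
have d01 (b : bool) : d i b%:R = 0 by case: b; rewrite ?d_1 ?d0.
have s01 (b : bool) : s i b%:R = b%:R by case: b; rewrite ?s_1 ?s0.
rewrite d01 scaler0 add0r !s01 e1.
have [->|_] := eqVneq w u; first by rewrite hu addr0.
by case: (ascent i w); rewrite ?scaler0 addr0.
Qed.

Lemma HM_decomp phi : phi = \sum_u scale_coefs (phi u) (heckeB u).
Proof.
apply/ffunP => w; rewrite sum_ffunE (bigD1 w) //= mulNE beE eqxx mulr1 big1 ?addr0 // => u uw.
by rewrite mulNE beE eq_sym (negbTE uw) mulr0.
Qed.

Definition lattice_coefs phi := forall w, supp Lm (phi w).

Lemma HMm_TT i phi : lattice_coefs phi -> lattice_coefs (heckeT i phi).
Proof.
move=> h w; rewrite TTE; apply: suppD; first apply: suppD.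
- exact/suppZ/supp_d.
- exact: supp_s.
by case: (ascent i w); [exact: supp0|exact/suppZ/supp_s].
Qed.

Lemma HMm_lin_eq (U V : heckeMod -> heckeMod) : lin U -> lin V ->
  (forall nu u, Lm nu -> U (scale_coefs (e nu) (heckeB u)) = V (scale_coefs (e nu) (heckeB u))) ->
  forall phi, lattice_coefs phi -> U phi = V phi.
Proof.
move=> lU lV h phi hphi; rewrite (HM_decomp phi) (lin_sum _ _ _ lU) (lin_sum _ _ _ lV).
apply: eq_bigr => u _; apply/ffunP => w; move: (phi u) (hphi u).
apply: supp_lin_eq => [||nu hnu]; last by rewrite h.
- split=> [f g|c f].
    by rewrite mulNDl (proj1 lU) HMD.
  have -> : scale_coefs (c *: f) (heckeB u) = c *: scale_coefs f (heckeB u) by apply/ffunP => v;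
    rewrite !HME scalerAl.
  by rewrite (proj2 lU) HMZ.
split=> [f g|c f].
  by rewrite mulNDl (proj1 lV) HMD.
have -> : scale_coefs (c *: f) (heckeB u) = c *: scale_coefs f (heckeB u) by apply/ffunP => v;
  rewrite !HME scalerAl.
by rewrite (proj2 lV) HMZ.
Qed.

End HeckeModule.

Local Notation T := heckeT.
Local Notation I := heckeTinv.
Local Notation N nu := (scale_coefs (e nu)).
Local Notation Kv := has_quotient.

Section BraidRelation.
Implicit Types (x y nu : E) (phi psi : heckeMod) (w u v : W) (D U V : heckeMod -> heckeMod).

Lemma KvD i x y (a b : int) : Kv i x a -> Kv i y b -> Kv i (x + y) (a + b).
Proof. by rewrite /Kv linearD /= => -> ->; rewrite mulrDl intrD. Qed.

Lemma KvN i x (a : int) : Kv i x a -> Kv i (- x) (- a).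
Proof. by rewrite /Kv linearN /= => ->; rewrite mulNr rmorphN. Qed.

Lemma KvB i x y (a b : int) : Kv i x a -> Kv i y b -> Kv i (x - y) (a - b).
Proof. by move=> hx hy; apply: KvD hx (KvN hy). Qed.

Lemma KvZ i x (a n : int) : Kv i x a -> Kv i (x *~ n) (a * n).
Proof. by rewrite /Kv raddfMz /= => ->; rewrite -mulrzl -intrM; congr (_%:~R); ring. Qed.

Lemma Kv_bet i : Kv i (bet i) 2.
Proof. exact: simple_bet. Qed.

Lemma Kv_eq i x (a b : int) : Kv i x a -> a = b -> Kv i x b.
Proof. by move=> h <-. Qed.

(** The value of nu' is left open: once D kills 1 (x) T_w, any translation of that zero will do. *)
Definition translates D nu := exists nu', forall phi, D (N nu phi) = N nu' (D phi).

Lemma N_D nu nu' phi : N (nu + nu') phi = N nu (N nu' phi).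
Proof. by rewrite mulNA exM. Qed.

Lemma N_0 phi : N 0 phi = phi.
Proof. by rewrite ex0 mulN1. Qed.

Lemma N_NK nu phi : N (- nu) (N nu phi) = phi.
Proof. by rewrite -N_D addNr N_0. Qed.

Lemma N_KN nu phi : N nu (N (- nu) phi) = phi.
Proof. by rewrite -N_D addrN N_0. Qed.

Lemma translatesD D x y : translates D x -> translates D y -> translates D (x + y).
Proof. by move=> [x' hx] [y' hy]; exists (x' + y') => phi; rewrite N_D hx hy N_D. Qed.

Lemma translatesN D x : translates D x -> translates D (- x).
Proof.
move=> [x' hx]; exists (- x') => phi.
by rewrite -[in RHS](N_KN x phi) hx N_NK.
Qed.

Lemma translates0 D : translates D 0.
Proof. by exists 0 => phi; rewrite !N_0. Qed.

Lemma translatesZ D x (n : int) : translates D x -> translates D (x *~ n).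
Proof.
move=> h; case: n => n; last rewrite NegzE mulrNz; last apply: translatesN; rewrite -pmulrn.
  by elim: n => [|n IH]; [exact: translates0|rewrite mulrS; exact: translatesD].
by elim: n => [|n IH] //; rewrite mulrS; exact: translatesD.
Qed.

(* If D carries omega to omega' and T_i to - T_l^-1, then it carries s_i omega to s_l omega'. *)
Lemma translates_bet D i l om om' : lin D ->
  (forall phi, D (T i phi) = - I l (D phi)) ->
  (forall phi, D (N om phi) = N om' (D phi)) ->
  Kv i om 1 -> Kv l om' (-1) -> translates D (bet i).
Proof.
move=> lD DT DN hi hl.
have hs : translates D (om - bet i).
  exists (om' + bet l) => phi.
  have e1 psi : N (om - bet i) psi = T i (N om (T i psi)) by rewrite (Bernstein1 _ hi) IITT.
  have hl1 : Kv l (om' + bet l) 1 by apply: Kv_eq (KvD hl (Kv_bet l)) _.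
  have e2 psi : N (om' + bet l) psi = I l (N om' (I l psi)).
    have := Bernstein1 (T l (I l psi)) hl1; rewrite addrK TTII => h.
    by rewrite -h IITT.
  by rewrite e1 DT DN DT e2 (linN _ (lin_mulN _)) (linN _ (lin_II l)) opprK.
have -> : bet i = om - (om - bet i) by rewrite opprB addrC subrK.
by apply: translatesD; [exists om'|exact: translatesN].
Qed.

(** Replace T by T^-1 + z at both ends; the two terms with z cancel. A braid defect has the form T_l
    U - U T_j, so this is the rule D T_j = - T_l^-1 D. *)
Lemma comm_T U l j : lin U -> forall phi,
  T l (U (T j phi)) - U (T j (T j phi)) = - I l (T l (U phi) - U (T j phi)).
Proof.
move=> lU phi; rewrite (linB _ _ (lin_II l)) IITT TT_quad (proj1 lU) (proj2 lU).
by rewrite [T l _]TT_E opprB opprD addrACA subrr addr0.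
Qed.

(** A weight moved through U replaces U by its inverse U'. The last hypothesis, D U = - U' D for the
    defect D of U against T_j, evaluated at U' phi, shows that this replacement leaves D
    unchanged. *)
Lemma bar_even U U' j : lin U' ->
  (forall phi, U (U' phi) = phi) -> (forall phi, U' (U phi) = phi) ->
  (forall phi, T j (U (U phi)) - U (T j (U phi)) = - U' (T j (U phi) - U (T j phi))) ->
  forall phi, T j (U' phi) - U' (T j phi) = T j (U phi) - U (T j phi).
Proof.
move=> lU' UK KU DU phi; have := DU (U' phi); rewrite !UK => ->.
by rewrite (linB _ _ lU') opprB KU.
Qed.

Section Pair.
Variables (i k : 'I_(rank Phi)) (a b : nat).
Hypotheses (hik : Kv i (bet k) (- a%:Z)) (hki : Kv k (bet i) (- b%:Z)).

(** The inverse of the 2 by 2 matrix of pairings, whose determinant is 4 - a b. *)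
Lemma fund_coweight : (a * b < 4)%N -> exists2 om, Kv i om 1 & Kv k om 0.
Proof.
move=> ab; pose del : R := 4 - a%:R * b%:R.
have d0 : del != 0 by rewrite subr_eq0 -natrM eqr_nat; lia.
have Kr i' x (n : int) : Kv i' x n -> sr i' x = n%:~R * (m (sr i'))%:R :> R.
  by rewrite /has_quotient => ->; rewrite intrM.
have [hi hk] := (Kr _ _ _ (Kv_bet i), Kr _ _ _ (Kv_bet k)).
have [hik' hki'] := (Kr _ _ _ hik, Kr _ _ _ hki).
move: hi hk hik' hki'; set mi := (m (sr i))%:R; set mk := (m (sr k))%:R.
rewrite !rmorphN /= => hi hk hik' hki'.
exists ((2 / del) *: bet i + (b%:R / del) *: bet k);
  rewrite /Kv linearD !linearZ /= ?hi ?hk ?hik' ?hki' /GRing.scale /= intrM -/mi -/mk.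
  by rewrite -!pmulrn /del; field; exact: d0.
by rewrite mul0r -!pmulrn; ring.
Qed.

Lemma translates_all D om1 om2 :
  (forall nu0, Kv i nu0 0 -> Kv k nu0 0 -> translates D nu0) ->
  Kv i om1 1 -> Kv k om1 0 -> translates D om1 ->
  Kv i om2 0 -> Kv k om2 1 -> translates D om2 ->
  forall nu (n1 n2 : int), Kv i nu n1 -> Kv k nu n2 -> translates D nu.
Proof.
move=> D0 i1 k1 D1 i2 k2 D2 nu n1 n2 hi hk.
have -> : nu = (nu - om1 *~ n1 - om2 *~ n2) + om2 *~ n2 + om1 *~ n1.
  by rewrite !subrK.
apply: translatesD; last exact: translatesZ.
apply: translatesD; last exact: translatesZ.
apply: D0.
  apply: Kv_eq (KvB (KvB hi (KvZ n1 i1)) (KvZ n2 i2)) _; ring.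
apply: Kv_eq (KvB (KvB hk (KvZ n1 k1)) (KvZ n2 k2)) _; ring.
Qed.

End Pair.

Definition heckeT_word (t : seq 'I_(rank Phi)) phi := foldr T phi t.

Fixpoint alt n i k := if n is n'.+1 then i :: alt n' k i else [::].

Definition braid_defect n i k phi := heckeT_word (alt n i k) phi - heckeT_word (alt n k i) phi.

Lemma lin_TTs t : lin (heckeT_word t).
Proof.
elim: t => [|i t IH]; first exact: lin_id.
by apply: (lin_comp (lin_TT i)) IH.
Qed.

Lemma lin_DD n i k : lin (braid_defect n i k).
Proof.
have [D1 Z1] := lin_TTs (alt n i k); have [D2 Z2] := lin_TTs (alt n k i).
split=> [phi psi|c phi]; rewrite /braid_defect; first by rewrite D1 D2 opprD addrACA.
by rewrite Z1 Z2 scalerBr.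
Qed.

Lemma DDN n i k phi : braid_defect n i k phi = - braid_defect n k i phi.
Proof. by rewrite /braid_defect opprB. Qed.

Lemma translates_DDN n i k nu : translates (braid_defect n i k) nu -> translates (braid_defect n k
  i) nu.
Proof.
move=> [nu' h]; exists nu' => phi.
by rewrite DDN h [in RHS]DDN (linN _ (lin_mulN _)).
Qed.

Lemma translates_DD0 n i k nu : Kv i nu 0 -> Kv k nu 0 -> translates (braid_defect n i k) nu.
Proof.
move=> hi hk; exists nu.
have h phi n' i' k' : Kv i' nu 0 -> Kv k' nu 0 ->
    heckeT_word (alt n' i' k') (N nu phi) = N nu (heckeT_word (alt n' i' k') phi).
  by elim: n' i' k' => [|n' IH] i' k' h1 h2 //=; rewrite IH // Bernstein0.
by move=> phi; rewrite /braid_defect !h // (linB _ _ (lin_mulN _)).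
Qed.

(** In even length both ends of the defect carry the same letter, so the rule keeps it; in length
    three it exchanges i and k. *)
Lemma DD_T2 i k phi : braid_defect 2%N i k (T k phi) = - I k (braid_defect 2%N i k phi).
Proof.
by rewrite [in LHS]DDN [in RHS]DDN (linN _ (lin_II k)); congr (- _); exact: (comm_T k k (lin_TT
  i)).
Qed.

Lemma DD_T3 i k phi : braid_defect 3%N i k (T k phi) = - I i (braid_defect 3%N i k phi).
Proof. exact: (comm_T i k (lin_TTs [:: k; i])). Qed.

Lemma DD_T4 i k phi : braid_defect 4%N i k (T i phi) = - I i (braid_defect 4%N i k phi).
Proof. exact: (comm_T i i (lin_TTs [:: k; i; k])). Qed.

Lemma DD_T6 i k phi : braid_defect 6%N i k (T i phi) = - I i (braid_defect 6%N i k phi).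
Proof. exact: (comm_T i i (lin_TTs [:: k; i; k; i; k])). Qed.

Lemma DD_swap n i k j l phi : braid_defect n i k (T j phi) = - I l (braid_defect n i k phi) ->
  braid_defect n k i (T j phi) = - I l (braid_defect n k i phi).
Proof. by move=> h; rewrite DDN h [in RHS]DDN (linN _ (lin_II l)). Qed.

Lemma DD_T3' i k phi : braid_defect 3%N i k (T i phi) = - I k (braid_defect 3%N i k phi).
Proof. by apply: DD_swap; exact: DD_T3. Qed.

Lemma DD_T4' i k phi : braid_defect 4%N i k (T k phi) = - I k (braid_defect 4%N i k phi).
Proof. by apply: DD_swap; exact: DD_T4. Qed.

Lemma DD_T6' i k phi : braid_defect 6%N i k (T k phi) = - I k (braid_defect 6%N i k phi).
Proof. by apply: DD_swap; exact: DD_T6. Qed.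

Section Fundamental.
Variables (i k : 'I_(rank Phi)) (om : E).
Hypotheses (omi : Kv i om 1) (omk : Kv k om 0).

Lemma translates2 : Kv k (bet i) 0 ->
  exists2 om', Kv i om' (-1) & forall phi, braid_defect 2%N i k (N om phi) = N om' (braid_defect
    2%N i k phi).
Proof.
move=> b0; exists (om - bet i) => [|phi].
  exact: Kv_eq (KvB omi (Kv_bet i)) _.
have k1 : Kv k (om - bet i) 0 by exact: Kv_eq (KvB omk b0) _.
have TE psi : T i (N om psi) = N (om - bet i) (I i psi) by rewrite (Bernstein1 _ omi).
have := @bar_even (T i) (I i) k (lin_II i) (TTII i) (IITT i).
rewrite /braid_defect /= => bE; rewrite TE (Bernstein0 _ omk) TE (Bernstein0 _ k1).
rewrite -!(linB _ _ (lin_mulN _)); congr (scale_coefs _ _); rewrite -[LHS]opprB bE ?opprB // => psi.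
exact: (DD_T2 k i psi).
Qed.

(** Moving the weight out leaves T_i T_k^-1 T_i^-1 - T_k^-1 T_i^-1 T_k, which is D again because D
    T_i T_k = T_k^-1 T_i^-1 D. *)
Lemma translates3 : Kv k (bet i) (-1) -> Kv i (bet k) (-1) ->
  exists2 om', Kv k om' (-1) & forall phi, braid_defect 3%N i k (N om phi) = N om' (braid_defect
    3%N i k phi).
Proof.
move=> hki hik; pose n1 := om - bet i; pose n2 := n1 - bet k.
have n1k : Kv k n1 1 by exact: Kv_eq (KvB omk hki) _.
have n1i : Kv i n1 (-1) by exact: Kv_eq (KvB omi (Kv_bet i)) _.
have n2k : Kv k n2 (-1) by exact: Kv_eq (KvB n1k (Kv_bet k)) _.
have n2i : Kv i n2 0 by exact: Kv_eq (KvB n1i hik) _.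
exists n2 => // phi.
have TE psi : T k (T i (N om psi)) = N n2 (I k (I i psi)).
  by rewrite (Bernstein1 _ omi) (Bernstein1 _ n1k).
have DT psi : braid_defect 3%N i k (T i (T k psi)) = I k (I i (braid_defect 3%N i k psi)).
  by rewrite DD_T3' DD_T3 (linN _ (lin_II k)) opprK.
rewrite /braid_defect /= in DT *; rewrite TE (Bernstein0 _ omk) TE (Bernstein0 _ n2i).
rewrite -!(linB _ _ (lin_mulN _)); congr (scale_coefs _ _).
have := DT (I k (I i phi)); rewrite !TTII => ->.
by rewrite (linB _ _ (lin_II i)) (linB _ _ (lin_II k)) !IITT.
Qed.

Lemma translates4 : Kv k (bet i) (-1) -> Kv i (bet k) (-2) ->
  exists2 om', Kv i om' (-1) & forall phi, braid_defect 4%N i k (N om phi) = N om' (braid_defect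
    4%N i k phi).
Proof.
move=> hki hik; pose n1 := om - bet i; pose n2 := n1 - bet k; pose n3 := n2 - bet i.
have n1k : Kv k n1 1 by exact: Kv_eq (KvB omk hki) _.
have n1i : Kv i n1 (-1) by exact: Kv_eq (KvB omi (Kv_bet i)) _.
have n2k : Kv k n2 (-1) by exact: Kv_eq (KvB n1k (Kv_bet k)) _.
have n2i : Kv i n2 1 by exact: Kv_eq (KvB n1i hik) _.
have n3k : Kv k n3 0 by exact: Kv_eq (KvB n2k hki) _.
have n3i : Kv i n3 (-1) by exact: Kv_eq (KvB n2i (Kv_bet i)) _.
exists n3 => // phi; rewrite [in LHS]DDN [in RHS]DDN (linN _ (lin_mulN _)); congr (- _).
have TE psi : T i (T k (T i (N om psi))) = N n3 (I i (I k (I i psi))).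
  by rewrite (Bernstein1 _ omi) (Bernstein1 _ n1k) (Bernstein1 _ n2i).
rewrite /braid_defect /= TE (Bernstein0 _ omk) TE (Bernstein0 _ n3k).
rewrite -!(linB _ _ (lin_mulN _)); congr (scale_coefs _ _).
apply: (@bar_even (heckeT_word [:: i; k; i]) (fun psi => I i (I k (I i psi))) k).
- exact: lin_comp (lin_II i) (lin_comp (lin_II k) (lin_II i)).
- by move=> psi /=; rewrite !TTII.
- by move=> psi /=; rewrite !IITT.
move=> psi; have DT (x : heckeMod) : braid_defect 4%N k i (T i (T k (T i x))) = - I i (I k (I i
  (braid_defect 4%N k i x))).
  by rewrite !(DD_T4', DD_T4) !(linN _ (lin_II k), linN _ (lin_II i)) ?opprK.
exact: DT.
Qed.

Lemma translates6 : Kv k (bet i) (-1) -> Kv i (bet k) (-3) ->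
  exists2 om', Kv i om' (-1) & forall phi, braid_defect 6%N i k (N om phi) = N om' (braid_defect
    6%N i k phi).
Proof.
move=> hki hik; pose n1 := om - bet i; pose n2 := n1 - bet k; pose n3 := n2 - bet i *~ 2.
pose n4 := n3 - bet k; pose n5 := n4 - bet i; pose n2' := n2 - bet i.
have n1k : Kv k n1 1 by exact: Kv_eq (KvB omk hki) _.
have n1i : Kv i n1 (-1) by exact: Kv_eq (KvB omi (Kv_bet i)) _.
have n2k : Kv k n2 (-1) by exact: Kv_eq (KvB n1k (Kv_bet k)) _.
have n2i : Kv i n2 2 by exact: Kv_eq (KvB n1i hik) _.
have n2'k : Kv k n2' 0 by exact: Kv_eq (KvB n2k hki) _.
have n2'i : Kv i n2' 0 by exact: Kv_eq (KvB n2i (Kv_bet i)) _.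
have n3k : Kv k n3 1 by exact: Kv_eq (KvB n2k (KvZ 2 hki)) _.
have n3i : Kv i n3 (-2) by exact: Kv_eq (KvB n2i (KvZ 2 (Kv_bet i))) _.
have n4k : Kv k n4 (-1) by exact: Kv_eq (KvB n3k (Kv_bet k)) _.
have n4i : Kv i n4 1 by exact: Kv_eq (KvB n3i hik) _.
have n5k : Kv k n5 0 by exact: Kv_eq (KvB n4k hki) _.
have n5i : Kv i n5 (-1) by exact: Kv_eq (KvB n4i (Kv_bet i)) _.
pose U psi := T i (T k (T i (T k (T i psi)))).
pose U' psi := I i (I k (I i (I k (I i psi)))).
have DE psi : braid_defect 6%N k i psi = T k (U psi) - U (T k psi) by [].
have DU psi : braid_defect 6%N k i (U psi) = - U' (braid_defect 6%N k i psi).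
  by rewrite /U !(DD_T6', DD_T6) !(linN _ (lin_II k), linN _ (lin_II i)) ?opprK.
(* At [n2] the pairing with alpha_i is 2, which leaves an extra translation by [n2']. That weight
   pairs to zero with both roots, so it commutes with T_k and cancels in the defect. *)
have TE psi : U (N om psi) = N n5 (U' psi) - z *: N n2' psi.
  rewrite /U (Bernstein1 _ omi) (Bernstein1 _ n1k) (Bernstein2 _ n2i).
  rewrite (linB _ _ (lin_TT k)) (linB _ _ (lin_TT i)) (Bernstein1 _ n3k) (Bernstein1 _ n4i).
  by rewrite !(proj2 (lin_TT _)) (Bernstein0 _ n2'k) (Bernstein0 _ n2'i) !TTII.
have lU' : lin U'.
  have [li lk] := (lin_II i, lin_II k).
  exact: lin_comp li (lin_comp lk (lin_comp li (lin_comp lk li))).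
have UK psi : U (U' psi) = psi by rewrite /U /U' !TTII.
have KU psi : U' (U psi) = psi by rewrite /U /U' !IITT.
exists n5 => // phi; rewrite [in LHS]DDN [in RHS]DDN (linN _ (lin_mulN _)); congr (- _).
move: DE DU; move: (braid_defect 6%N k i : heckeMod -> heckeMod) => D DE DU.
have := @bar_even U U' k lU' UK KU; move: U U' {lU' UK KU} TE DE DU => U U' TE DE DU bE.
have {}bE psi : T k (U' psi) - U' (T k psi) = D psi.
  by rewrite DE; apply: bE => x; rewrite -!DE.
rewrite DE (Bernstein0 _ omk) !TE (linB _ _ (lin_TT k)) (Bernstein0 _ n5k).
rewrite (proj2 (lin_TT _)) (Bernstein0 _ n2'k) opprB addrA subrK.
by rewrite -!(linB _ _ (lin_mulN _)) bE.
Qed.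

End Fundamental.

End BraidRelation.

Section BraidTheorem.
Implicit Types (x y nu : E) (phi psi : heckeMod) (w u v : W).

(** Rescaling multiplies one Cartan integer by m(k) / m(i) and the other by the inverse ratio; the
    product, which governs the order of s_i s_k, is kept. *)
Lemma Kv_cart i k (p q : nat) : cartan i k = - p%:R -> cartan k i = - q%:R ->
  exists a b : nat, [/\ Kv i (bet k) (- a%:Z), Kv k (bet i) (- b%:Z) & (a * b = p * q)%N].
Proof.
have key i' k' (p' : nat) : cartan i' k' = - p'%:R ->
    exists2 a : nat, Kv i' (bet k') (- a%:Z) & (a * m (sr i') = m (sr k') * p')%N.
  move=> h; have [n] := mult_coroot M (simple_root k') (simple_root i').
  change (sr i' (coroot dot (sr k')) : R) with (cartan i' k'); rewrite h mulNrn -mulrnA => hn.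
  have e1 : n * (m (sr i'))%:Z = - (p' * m (sr k'))%:Z.
    by apply: (@intr_inj R); rewrite -hn rmorphN /= -pmulrn.
  exists `|n|%N; last by apply/eqP; rewrite -eqz_nat; nia.
  rewrite /has_quotient /rescaled_coroot raddfMn /=.
  change (sr i' (coroot dot (sr k')) : R) with (cartan i' k'); rewrite h mulNrn -mulrnA hn.
  by congr (_%:~R); have := mult_gt0 M (sr i'); nia.
move=> /key[a ha ea] /key[b hb eb]; exists a, b; split=> //.
have mi := mult_gt0 M (sr i); have mk := mult_gt0 M (sr k).
apply/eqP; rewrite -(eqn_pmul2r mi) -(eqn_pmul2r mk); apply/eqP.
transitivity ((a * m (sr i)) * (b * m (sr k)))%N; first by ring.
by rewrite ea eb; ring.
Qed.

(** The order of s_i s_k as a function of p q; the value 6 at p q = 3 is the default of [nth]. *)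
Definition braid_order (n : nat) : nat := nth 6%N [:: 2; 3; 4]%N n.

Lemma DD_T i k (c : nat) : (c < 4)%N -> exists l,
  forall phi, braid_defect (braid_order c) i k (T i phi) = - I l (braid_defect (braid_order c) i k
    phi).
Proof.
case: c => [|[|[|[|]]]] // _; rewrite /braid_order /=; eexists => phi.
- by apply: DD_swap; exact: DD_T2.
- exact: DD_T3'.
- exact: DD_T4.
exact: DD_T6.
Qed.

Lemma braid_translates i k (a b : nat) nu :
  Kv i (bet k) (- a%:Z) -> Kv k (bet i) (- b%:Z) -> (a = 0 <-> b = 0)%N -> (a * b < 4)%N ->
  Lm nu -> translates (braid_defect (braid_order (a * b)) i k) nu.
Proof.
wlog le : i k a b / (b <= a)%N => [hw hik hki ab0 ab Lnu|].
  have [le|lt] := leqP b a; first exact: hw.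
  apply: translates_DDN; rewrite mulnC; apply: hw => //; first exact: ltnW.
    by split=> /ab0.
  by rewrite mulnC.
move=> hik hki ab0 ab [_ Lnu].
have Kn i' : exists n : int, Kv i' nu n by apply: Lnu; exact: simple_root.
have [[n1 hn1] [n2 hn2]] := (Kn i, Kn k).
have D0 n nu0 : Kv i nu0 0 -> Kv k nu0 0 -> translates (braid_defect n i k) nu0 by exact:
  translates_DD0.
have [om omi omk] := fund_coweight hik hki ab.
have b1 : b = 0%N \/ b = 1%N by nia.
case: b1 => eb; subst b; rewrite ?muln0 ?muln1 in ab *.
  have a0 : a = 0%N by apply/ab0.
  subst a; have [om2 om2k om2i] := fund_coweight hki hik ab.
  have [om' _ h] := translates2 omi omk hki.
  have [om2' _ h2] := translates2 om2k om2i hik.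
  apply: (translates_all (D0 2) omi omk _ om2i om2k _ hn1 hn2); first by exists om'.
  by apply: translates_DDN; exists om2'.
have key n l om' : (forall phi, braid_defect n i k (T i phi) = - I l (braid_defect n i k phi)) ->
    (forall phi, braid_defect n i k (N om phi) = N om' (braid_defect n i k phi)) -> Kv l om' (-1) ->
    translates (braid_defect n i k) nu.
  move=> DT DN hl; have tb := translates_bet (lin_DD n i k) DT DN omi hl.
  (* For b = 1 the second fundamental coweight is 2 om - bet i, so [translates_bet] replaces a
     second computation. *)
  have om2i : Kv i (om *~ 2 - bet i) 0 by exact: Kv_eq (KvB (KvZ 2 omi) (Kv_bet i)) _.
  have om2k : Kv k (om *~ 2 - bet i) 1 by exact: Kv_eq (KvB (KvZ 2 omk) hki) _.
  apply: (translates_all (D0 n) omi omk _ om2i om2k _ hn1 hn2); first by exists om'.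
  by apply: translatesD; [apply: translatesZ; exists om'|exact: translatesN].
have a0 : a <> 0%N by move=> /ab0.
case: a a0 ab hik {le ab0} => [|[|[|[|a]]]] // _ _ hik; rewrite /braid_order /=.
- have [om' hl h] := translates3 omi omk hki hik.
  exact: (key 3%N k om' (@DD_T3' i k) h hl).
- have [om' hl h] := translates4 omi omk hki hik.
  exact: (key 4%N i om' (@DD_T4 i k) h hl).
have [om' hl h] := translates6 omi omk hki hik.
exact: (key 6%N i om' (@DD_T6 i k) h hl).
Qed.

(** * Roots in the plane of two simple roots *)

Section RankTwo.
Variables (i k : 'I_(rank Phi)) (p q : nat).
Hypotheses (cik : cartan i k = - p%:R) (cki : cartan k i = - q%:R).

Local Notation lt b := (if b then i else k).

Definition plane_root (y : int * int) : 'Hom(E, R^o) := y.1%:~R *: sr i + y.2%:~R *: sr k.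

(* Coordinates with respect to the two simple roots of [a \o s] from those of [a]. *)
Definition plane_refl (y : int * int) (b : bool) : int * int :=
  if b then (q%:Z * y.2 - y.1, y.2) else (y.1, p%:Z * y.1 - y.2).

Definition plane_simple (b : bool) : int * int := if b then (1, 0) else (0, 1).

Lemma rr_unit b : plane_root (plane_simple b) = sr (lt b).
Proof. by case: b; rewrite /plane_root /= scale1r scale0r ?addr0 ?add0r. Qed.

Lemma rr_act (y : int * int) (b : bool) : (plane_root y \o sS (lt b))%VF = plane_root (plane_refl y
  b).
Proof.
rewrite /plane_root comp_lfunDl -!comp_lfunZl; case: b => /=; rewrite !simple_comp ?cart_self ?cik
  ?cki.
  rewrite !scalerBr !scalerA.
  have -> : (q%:Z * y.2 - y.1)%:~R = y.1%:~R - y.1%:~R * 2 - y.2%:~R * - q%:R :> R.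
    by rewrite rmorphB rmorphM /= -pmulrn; ring.
  by rewrite !scalerBl addrCA addrC.
rewrite !scalerBr !scalerA.
have -> : (p%:Z * y.1 - y.2)%:~R = - (y.1%:~R * - p%:R) + (y.2%:~R - y.2%:~R * 2) :> R.
  by rewrite rmorphB rmorphM /= -pmulrn; ring.
by rewrite scalerDl scaleNr scalerBl !addrA.
Qed.

Lemma rr_word (y : int * int) (t : seq bool) : (plane_root y \o word [seq lt b | b <- t])%VF =
  plane_root (foldl plane_refl y t).
Proof.
elim: t y => [|b t IH] y /=; first by rewrite comp_lfun1r.
by rewrite comp_lfunA rr_act IH.
Qed.

Lemma rr_pos (y : int * int) (u : 'End(E)) : (sr i \o u)%VF \in pos -> (sr k \o u)%VF \in pos ->
  0 <= y.1 -> 0 <= y.2 -> (plane_root y \o u)%VF \in rootset Phi -> (plane_root y \o u)%VF \in pos.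
Proof.
move=> ui uk y1 y2 ry; have := ui; have := uk.
rewrite (pos_ht Phi (sr k \o u)%VF) (pos_ht Phi (sr i \o u)%VF) => /andP[_ h2] /andP[_ h1].
rewrite pos_ht ry /=; have := root_ht ry => /orP[//|]; rewrite ltNge => /negP[].
by rewrite /plane_root comp_lfunDl -!comp_lfunZl htD !htZ addr_ge0 // mulr_ge0 ?ler0z // ltW.
Qed.

(** Each letter must be an ascent of what follows: its simple root, carried through the tail, keeps
    nonnegative coordinates. For given p and q this is decided by evaluation. *)
Fixpoint plane_reduced (t : seq bool) := if t is b :: t' then
  let y := foldl plane_refl (plane_simple b) t' in [&& plane_reduced t', 0 <= y.1 & 0 <= y.2] else
    true.

Lemma TTs_be u (t : seq bool) : ascent i u -> ascent k u -> plane_reduced t ->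
  heckeT_word [seq lt b | b <- t] (heckeB u) = heckeB (mkW (word [seq lt b | b <- t] \o wv u)%VF).
Proof.
move=> ui uk; elim: t => [|b t IH] /=; first by rewrite comp_lfun1l wvK.
move=> /and3P[/IH e1 y1 y2]; rewrite e1 TT_be /lrefl.
  by rewrite mkWK ?comp_lfunA //; apply: isWM; [exact: isW_word|exact: isW_wv].
rewrite /ascent mkWK; last by apply: isWM; [exact: isW_word|exact: isW_wv].
rewrite comp_lfunA -rr_unit rr_word; apply: rr_pos y1 y2 _; rewrite ?isW_wv //.
rewrite -rr_word -comp_lfunA rr_unit; apply: isW_root; last exact: simple_root.
by apply: isWM; [exact: isW_word|exact: isW_wv].
Qed.

Lemma word_alt (b l : bool) (t : seq bool) : foldl plane_refl (plane_simple b) t = plane_simple l ->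
  word [seq lt b | b <- b :: t] = word [seq lt b | b <- rcons t l].
Proof.
move=> h; rewrite map_rcons word_rcons /=.
by apply: simple_word_conj; rewrite -!rr_unit rr_word h.
Qed.

End RankTwo.

Fixpoint altb n b := if n is n'.+1 then b :: altb n' (~~ b) else [::].

Lemma alt_altb i k n : alt n i k = [seq if b then i else k | b <- altb n true].
Proof.
have h b : alt n (if b then i else k) (if b then k else i) =
    [seq if b then i else k | b <- altb n b].
  by elim: n b => //= n IH b; rewrite -IH; case: b.
exact: (h true).
Qed.

(* n is the order of s_i s_k; the last clause says that words of length less than n in the
   two letters are reduced on the left of an element with neither letter as a descent. *)
Definition coxeter_pair n i k := [/\ (0 < n)%N, word (alt n i k) = word (alt n k i) &
  forall (l : nat) (u : 'End(E)), (l < n)%N -> isW u -> (sr i \o u)%VF \in pos ->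
    (sr k \o u)%VF \in pos -> (sr k \o word (alt l i k) \o u)%VF \in pos].

(** For each of the six pairs it is a computation with integer coordinates. The two alternating
    words agree because their common middle carries a simple root to a simple root ([word_alt]). *)
Lemma coxeter_cart i k (p q : nat) : cartan i k = - p%:R -> cartan k i = - q%:R ->
  (p, q) \in [:: (0, 0); (1, 1); (1, 2); (2, 1); (1, 3); (3, 1)]%N ->
  coxeter_pair (braid_order (p * q)) i k.
Proof.
move=> cik cki pq; have we := @word_alt i k p q cik cki.
have abE := alt_altb i k.
have fin n : (forall l : nat, (l < n)%N -> let y := foldl (plane_refl p q) (plane_simple false)
  (altb l true) in
    (0 <= y.1) && (0 <= y.2)) ->
  forall (l : nat) (u : 'End(E)), (l < n)%N -> isW u -> (sr i \o u)%VF \in pos ->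
    (sr k \o u)%VF \in pos -> (sr k \o word (alt l i k) \o u)%VF \in pos.
  move=> h l u ln Wu ui uk; have /andP[y1 y2] := h l ln.
  have e1 : (sr k \o word (alt l i k))%VF = plane_root i k (foldl (plane_refl p q) (plane_simple
    false) (altb l true)).
    by rewrite abE -(rr_word cik cki) /plane_root /= scale1r scale0r add0r.
  rewrite e1; apply: (rr_pos ui uk y1 y2); rewrite -e1 -comp_lfunA.
  by apply: isW_root; [apply: isWM => //; exact: isW_word|exact: simple_root].
move: pq; rewrite !inE => /orP[|/or4P[||| /orP[]]] /eqP[ep eq']; subst p q;
  split=> //; try (by apply: fin; do 8?[case=> //]).
- exact: (we true true [:: false] erefl).
- exact: (we true false [:: false; true] erefl).
- exact: (we true true [:: false; true; false] erefl).
- exact: (we true true [:: false; true; false] erefl).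
- exact: (we true true [:: false; true; false; true; false] erefl).
exact: (we true true [:: false; true; false; true; false] erefl).
Qed.

(** A descent of u among i and k splits off a T_j, which the rule moves to the other side of the
    defect, leaving a shorter element. With no such descent both words are reduced to the left of u
    and produce the same basis vector. *)
Lemma DD_be i k (p q : nat) : cartan i k = - p%:R -> cartan k i = - q%:R ->
  (p, q) \in [:: (0, 0); (1, 1); (1, 2); (2, 1); (1, 3); (3, 1)]%N ->
  forall u, braid_defect (braid_order (p * q)) i k (heckeB u) = 0.
Proof.
move=> cik cki pq u.
have pq4 : (p * q < 4)%N by move: pq; rewrite !inE => /orP[|/or4P[||| /orP[]]] /eqP[-> ->].
have [n hn] := ubnP (len (wv u)); elim: n u hn => // n IH u hn.
have down j l : ~~ ascent j u -> (forall phi, braid_defect (braid_order (p * q)) i k (T j phi) =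
    - I l (braid_defect (braid_order (p * q)) i k phi)) -> braid_defect (braid_order (p * q)) i k
      (heckeB u) = 0.
  move=> nu DT; have up' : ascent j (lrefl j u) by rewrite up_lw.
  have eu : heckeB u = T j (heckeB (lrefl j u)) by rewrite TT_be // lwK.
  rewrite eu DT IH ?(lin0 (lin_II l)) ?oppr0 //.
  by have := len_lw up'; rewrite lwK => el; rewrite el in hn; lia.
have [ui|nui] := boolP (ascent i u); last by have [l] := DD_T i k pq4; exact: down.
have [uk|nuk] := boolP (ascent k u); last first.
  by have [l DT] := DD_T k i pq4; apply: (down k l nuk) => phi; exact: DD_swap (DT phi).
have be1 (t : seq bool) := @TTs_be i k p q cik cki u t ui uk.
have we := @word_alt i k p q cik cki.
have fin (t1 t2 : seq bool) : plane_reduced p q t1 -> plane_reduced p q t2 ->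
    word [seq if b then i else k | b <- t1] = word [seq if b then i else k | b <- t2] ->
    heckeT_word [seq if b then i else k | b <- t1] (heckeB u) - heckeT_word [seq if b then i else k
      | b <- t2] (heckeB u) = 0.
  by move=> g1 g2 e12; rewrite !be1 // e12 subrr.
move: pq; rewrite !inE => /orP[|/or4P[||| /orP[]]] /eqP[ep eq']; subst p q.
- exact: (fin [:: true; false] [:: false; true] erefl erefl (we true true [:: false] erefl)).
- exact: (fin [:: true; false; true] [:: false; true; false] erefl erefl
     (we true false [:: false; true] erefl)).
- exact: (fin [:: true; false; true; false] [:: false; true; false; true] erefl erefl
     (we true true [:: false; true; false] erefl)).
- exact: (fin [:: true; false; true; false] [:: false; true; false; true] erefl erefl
     (we true true [:: false; true; false] erefl)).
- exact: (fin [:: true; false; true; false; true; false] [:: false; true; false; true; false; true]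
     erefl erefl (we true true [:: false; true; false; true; false] erefl)).
exact: (fin [:: true; false; true; false; true; false] [:: false; true; false; true; false; true]
     erefl erefl (we true true [:: false; true; false; true; false] erefl)).
Qed.

Lemma braid_relation i k : i != k -> exists2 n, coxeter_pair n i k &
  forall phi, lattice_coefs phi -> heckeT_word (alt n i k) phi = heckeT_word (alt n k i) phi.
Proof.
move=> ik; have [p [q [cik cki pq]]] := cart_pairs ik.
have [a [b [hik hki ab]]] := Kv_cart cik cki.
exists (braid_order (p * q)) => [|phi hphi]; first exact: coxeter_cart.
apply/eqP; rewrite -subr_eq0; apply/eqP.
have -> : 0 = (fun=> 0) phi :> heckeMod by [].
move: phi hphi; apply: HMm_lin_eq => [||nu u Lnu]; first exact: lin_DD.
  by split=> [*|c *]; rewrite ?addr0 ?scaler0.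
have lt4 : (a * b < 4)%N.
  by rewrite ab; move: pq; rewrite !inE => /orP[|/or4P[||| /orP[]]] /eqP[-> ->].
have ab0 : a = 0%N <-> b = 0%N.
  have K0 i' k' (p' a' : nat) : cartan i' k' = - p'%:R -> Kv i' (bet k') (- a'%:Z) ->
      a' = 0%N <-> p' = 0%N.
    move=> hc hK; have ri := mult_gt0 M (sr i'); have rk := mult_gt0 M (sr k').
    have : (m (sr k'))%:R * p'%:R = a'%:R * (m (sr i'))%:R :> R.
      move: hK; rewrite /has_quotient /rescaled_coroot raddfMn /=.
      change (sr i' (coroot dot (sr k')) : R) with (cartan i' k').
      rewrite hc mulNrn -mulrnA mulNr rmorphN /= -pmulrn => /oppr_inj.
      by rewrite !natrM mulrC.
    by rewrite -!natrM => /eqP; rewrite eqr_nat => /eqP; nia.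
  apply: iff_trans (K0 _ _ _ _ cik hik) (iff_trans _ (iff_sym (K0 _ _ _ _ cki hki))).
  by move: pq; rewrite !inE => /orP[|/or4P[||| /orP[]]] /eqP[-> ->].
have [nu'] := @braid_translates i k a b nu hik hki ab0 lt4 Lnu; rewrite ab => h.
by rewrite -[LHS]/(braid_defect _ i k _) h (DD_be cik cki pq) (lin0 (lin_mulN _)).
Qed.

End BraidTheorem.

(** * Independence of the reduced word *)

Section Matsumoto.
Implicit Types (w u : 'End(E)) (s : seq 'I_(rank Phi)).

Lemma alt_rcons n i k : alt n.+1 i k = rcons (alt n i k) (if odd n then k else i).
Proof.
elim: n i k => // n IH i k; rewrite [LHS]/= -/(alt n.+1 k i) IH /=.
by case: (odd n).
Qed.

Lemma size_alt n i k : size (alt n i k) = n.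
Proof. by elim: n i k => //= n IH i k; rewrite IH. Qed.

(** Letters are stripped alternately. If the next one were an ascent, the remaining factor would
    have neither letter as descent, and the last clause of [coxeter_pair] would make k an ascent of
    w. *)
Lemma peel_alt n i k w : coxeter_pair n i k -> isW w ->
  (sr i \o w)%VF \notin pos -> (sr k \o w)%VF \notin pos ->
  exists2 r, word (alt n i k ++ r) = w & is_reduced (alt n i k ++ r).
Proof.
move=> [n0 _ ascent] Ww ni nk.
have key (l : nat) : (l <= n)%N -> exists u, [/\ isW u, w = (word (alt l i k) \o u)%VF,
    len w = (l + len u)%N & (0 < l)%N -> (sr (if odd l then i else k) \o u)%VF \in pos].
  elim: l => [_|l IH ln]; first by exists w; split=> //; rewrite comp_lfun1l.
  have [u [Wu ew el ul]] := IH (ltnW ln).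
  set j := if odd l then k else i.
  have nj : (sr j \o u)%VF \notin pos.
    case: l @j ln ew ul {IH el} => [|l] /= ln ew ul; first by rewrite ew comp_lfun1l in ni.
    apply/negP => uj; move: nk; rewrite ew comp_lfunA (ascent l.+1 u) //; last first.
      by move: (ul isT) uj; rewrite /=; case: (odd l).
    by move: (ul isT) uj; rewrite /=; case: (odd l).
  exists (sS j \o u)%VF; split.
  - exact: isW_simpleM.
  - by rewrite alt_rcons -/j word_rcons -comp_lfunA simpleKl.
  - by rewrite el (len_down Wu nj) addnS.
  move=> _; rewrite /= if_neg -/j comp_lfunA simple_comp_self comp_lfunNl posN //.
  exact: isW_root Wu (simple_root j).
have [u [Wu ew el _]] := key n (leqnn n).
have eW : word (alt n i k ++ reduced_word Phi u) = w by rewrite word_cat word_reduced.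
exists (reduced_word Phi u) => //.
by apply/reduced_len; rewrite eW el size_cat size_alt.
Qed.

(** If the words begin with different letters i and k, both are left descents, so there are reduced
    words that begin with either alternating word. Induction compares tails behind a common first
    letter, and the braid relation joins the two alternating words. The predicate D marks the domain
    where that relation is known. *)
Lemma matsumoto (V : Type) (D : V -> Prop) (f : 'I_(rank Phi) -> V -> V) :
  (forall i x, D x -> D (f i x)) ->
  (forall i k, i != k -> exists2 n, coxeter_pair n i k &
    forall x, D x -> foldr f x (alt n i k) = foldr f x (alt n k i)) ->
  forall s t, is_reduced s -> is_reduced t -> word s = word t ->
  forall x, D x -> foldr f x s = foldr f x t.
Proof.
move=> Df br s t; have [n hn] := ubnP (size s).
have DF r x : D x -> D (foldr f x r) by elim: r => //= i r IH /IH; exact: Df.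
elim: n s t hn => // n IH [|i s] t hn rs rt est x Dx.
  have /size0nil -> // : size t = 0%N.
  by apply/eqP; rewrite (reduced_len _).1 // -est; exact/eqP/len1.
case: t rt est => [|k t] rt est.
  by have := (reduced_len _).1 rs; rewrite est /= len1.
have [eik|ik] := eqVneq i k.
  subst k; congr (f i _); apply: IH => //.
  - exact: (proj1 ((reduced_cons _ _).1 rs)).
  - exact: (proj1 ((reduced_cons _ _).1 rt)).
  by have := congr1 (fun w => sS i \o w)%VF est; rewrite !word_cons !simpleKl.
have [m cp bre] := br i k ik; have Ww := isW_word (i :: s).
have desc j r : is_reduced (j :: r) -> (sr j \o word (j :: r))%VF \notin pos.
  move=> /reduced_cons[_ h]; rewrite word_cons comp_lfunA simple_comp_self comp_lfunNl posN //.
    by rewrite h.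
  exact: isW_root (isW_word r) (simple_root j).
have := desc _ _ rt; rewrite -est => dk.
have [r er plane_root] := peel_alt cp Ww (desc _ _ rs) dk.
have [m0 ew _] := cp.
have er' : word (alt m k i ++ r) = word (i :: s) by rewrite -er !word_cat ew.
have rr' : is_reduced (alt m k i ++ r).
  apply/reduced_len; rewrite er' -er -(reduced_len _).1 //.
  by rewrite !size_cat !size_alt.
have el : size t = size s.
  by apply/eqP; rewrite -eqSS -[X in X == _]/(size (k :: t)) -[X in _ == X]/(size (i :: s))
    !(reduced_len _).1 // est.
case: m m0 {cp ew} bre er plane_root er' rr' => // m _ bre er plane_root er' rr'.
have cons_eq j r1 r2 : (size r1 < n)%N -> is_reduced (j :: r1) -> is_reduced (j :: r2) ->
    word (j :: r1) = word (j :: r2) -> foldr f x (j :: r1) = foldr f x (j :: r2).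
  move=> h h1 h2 e12; congr (f j _); apply: IH => //.
  - exact: (proj1 ((reduced_cons _ _).1 h1)).
  - exact: (proj1 ((reduced_cons _ _).1 h2)).
  by have := congr1 (fun w => sS j \o w)%VF e12; rewrite !word_cons !simpleKl.
rewrite (cons_eq i s (alt m k i ++ r)) // (cons_eq k t (alt m i k ++ r)) ?el //.
  rewrite -[LHS]/(foldr f x (alt m.+1 i k ++ r)) -[RHS]/(foldr f x (alt m.+1 k i ++ r)).
  by rewrite !foldr_cat; apply/bre/DF.
by rewrite -est -er'.
Qed.

End Matsumoto.

Section HeckeWords.
Implicit Types (phi psi : heckeMod).

Lemma TTs_word s t phi : is_reduced s -> is_reduced t -> word s = word t -> lattice_coefs phi ->
  heckeT_word s phi = heckeT_word t phi.
Proof.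
move=> rs rt e hphi; apply: (matsumoto (D := fun phi => lattice_coefs phi)) hphi => //.
  by move=> i x; exact: HMm_TT.
exact: braid_relation.
Qed.

Lemma HMm_TTs s phi : lattice_coefs phi -> lattice_coefs (heckeT_word s phi).
Proof. by move=> h; elim: s => //= i s IH; exact: HMm_TT. Qed.

End HeckeWords.

(** * The antisymmetrizer *)

Section Antisymmetrizer.
Implicit Types (x y nu : E) (c : F).
Local Notation s := (spa X).
Local Notation d := (dma X).
Implicit Types (phi psi : heckeMod) (w u v : W).

Definition heckeTinv_word t phi := foldr I phi t.

Lemma IIs_cat t r phi : heckeTinv_word (t ++ r) phi = heckeTinv_word t (heckeTinv_word r phi).
Proof. exact: foldr_cat. Qed.

Lemma IIs_TTs t phi : heckeTinv_word (rev t) (heckeT_word t phi) = phi.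
Proof.
elim: t phi => // i t IH phi; rewrite rev_cons -cats1 IIs_cat /= IITT.
exact: IH.
Qed.

Lemma TTs_IIs t phi : heckeT_word t (heckeTinv_word (rev t) phi) = phi.
Proof.
by elim: t phi => // i t IH phi; rewrite rev_cons -cats1 IIs_cat /= IH TTII.
Qed.

Lemma HMm_add phi psi : lattice_coefs phi -> lattice_coefs psi -> lattice_coefs (phi + psi).
Proof. by move=> h1 h2 w; rewrite HMD; apply: suppD. Qed.

Lemma HMm_scale c phi : lattice_coefs phi -> lattice_coefs (c *: phi).
Proof. by move=> h w; rewrite HMZ; apply: suppZ. Qed.

Lemma HMm0 : lattice_coefs (0 : heckeMod).
Proof. by move=> w; rewrite ffunE; exact: supp0. Qed.

Lemma HMm_II i phi : lattice_coefs phi -> lattice_coefs (I i phi).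
Proof.
move=> h; rewrite IIE -scaleNr; apply: HMm_add; first exact: HMm_TT.
exact: HMm_scale.
Qed.

Lemma HMm_IIs t phi : lattice_coefs phi -> lattice_coefs (heckeTinv_word t phi).
Proof. by move=> h; elim: t => //= i t; exact: HMm_II. Qed.

Lemma lin_IIs t : lin (heckeTinv_word t).
Proof.
elim: t => [|i t IH]; first exact: lin_id.
by apply: (lin_comp (lin_II i)) IH.
Qed.

Lemma rev_alt n i k : rev (alt n i k) = if odd n then alt n i k else alt n k i.
Proof.
elim: n i k => // n IH i k; rewrite [in LHS]alt_rcons rev_rcons IH /=.
by case: (odd n).
Qed.

(** Inverting a braid relation reverses both of its words, and by [rev_alt] the reversed pair is the
    same pair, possibly exchanged. *)
Lemma IIs_word r t phi : is_reduced r -> is_reduced t -> word r = word t -> lattice_coefs phi ->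
  heckeTinv_word r phi = heckeTinv_word t phi.
Proof.
move=> plane_root rt ert hphi; apply: (matsumoto (D := fun phi => lattice_coefs phi)) hphi => //.
  by move=> i x; exact: HMm_II.
move=> i k ik; have [n cp br] := braid_relation ik; exists n => // x hx.
have h a b : heckeT_word a (heckeTinv_word (rev a) x) = heckeT_word b (heckeTinv_word (rev a) x) ->
  heckeTinv_word (rev a) x = heckeTinv_word (rev b) x.
  by rewrite TTs_IIs => eab; rewrite -[LHS](IIs_TTs b) -eab.
have h1 := h _ _ (br _ (HMm_IIs (rev (alt n i k)) hx)).
rewrite -!/(heckeTinv_word _ _); move: h1; rewrite !rev_alt; case: (odd n) => // h1.
Qed.

Definition antisymmetrizer phi : heckeMod := \sum_(w : W) (- q) ^+ len (wv w) *: heckeTinv_word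
  (rword (wv w)) phi.
Local Notation SS := antisymmetrizer.

Lemma lin_SS : lin SS.
Proof.
split=> [phi psi|c phi].
  by rewrite -big_split; apply: eq_bigr => w _; rewrite (proj1 (lin_IIs _)) scalerDr.
rewrite scaler_sumr; apply: eq_bigr => w _.
by rewrite (proj2 (lin_IIs _)) !scalerA mulrC.
Qed.

Lemma HMm_sum (Q : pred W) (G : W -> heckeMod) : (forall w, lattice_coefs (G w)) -> lattice_coefs
  (\sum_(w | Q w) G w).
Proof.
move=> h; apply: big_ind => //; [exact: HMm0|by move=> *; exact: HMm_add].
Qed.

Lemma HMm_SS phi : lattice_coefs phi -> lattice_coefs (SS phi).
Proof. by move=> h; apply: HMm_sum => w; apply/HMm_scale/HMm_IIs. Qed.

Lemma sum_pairs (I : finType) (V : nmodType) (f : I -> I) (p : pred I) (G : I -> V) :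
  involutive f -> (forall a, p (f a) = ~~ p a) ->
  \sum_a G a = \sum_(a | p a) (G a + G (f a)).
Proof.
move=> fK pf; rewrite (bigID p) big_split /=; congr (_ + _).
rewrite (reindex f) /=; last by exists f => a _; rewrite fK.
by apply: eq_bigl => a; rewrite pf negbK.
Qed.

(** The contributions of w and of its product with s_i: here y arises from x by one more inverse
    letter, and T_i sends x to y + z x and y to x. *)
Lemma pair_aux (V : lmodType F) n (x y : V) : (- q) ^+ n *: (y + z *: x) + (- q) ^+ n.+1 *: x =
  - q^-1 *: ((- q) ^+ n *: x) + - q^-1 *: ((- q) ^+ n.+1 *: y).
Proof.
rewrite exprS !scalerDr !scalerA -addrA -scalerDl addrC.
have q0 := qq_neq0 P; congr (_ *: _ + _ *: _); field; exact: q0.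
Qed.

Lemma TT_SS i phi : lattice_coefs phi -> T i (SS phi) = - q^-1 *: SS phi.
Proof.
move=> hphi; rewrite /SS (lin_sum _ _ _ (lin_TT i)) scaler_sumr.
rewrite (sum_pairs _ (lwK i) (up_lw i)) [RHS](sum_pairs _ (lwK i) (up_lw i)).
apply: eq_bigr => w uw; rewrite !(proj2 (lin_TT i)).
have -> : heckeTinv_word (rword (wv (lrefl i w))) phi = I i (heckeTinv_word (rword (wv w)) phi).
  have Ww := isW_wv w; have Wl := isW_wv (lrefl i w).
  apply: (@IIs_word _ (i :: rword (wv w))) => //.
  - exact: reduced_reduced_word.
  - by apply/reduced_cons; split; [exact: reduced_reduced_word|rewrite word_reduced].
  by rewrite word_reduced // word_cons word_reduced // wv_lw.
rewrite len_lw //; rewrite TTII TT_E.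
exact: pair_aux.
Qed.

Definition rrefl i w : W := mkW (wv w \o sS i)%VF.
Definition right_ascent i w : bool := (sr i \o (wv w)^-1)%VF \in pos.

Lemma wv_rw i w : wv (rrefl i w) = (wv w \o sS i)%VF.
Proof. by rewrite mkWK //; apply: isWM; [exact: isW_wv|exact: isW_simple]. Qed.

Lemma rwK i : involutive (rrefl i).
Proof. by move=> w; apply: wv_inj; rewrite !wv_rw -comp_lfunA simpleK comp_lfun1r. Qed.

Lemma rup_rw i w : right_ascent i (rrefl i w) = ~~ right_ascent i w.
Proof.
have Ww := isW_wv w.
rewrite /right_ascent wv_rw (isW_invM Ww (isW_simple i)) simple_inv comp_lfunA simple_comp_self.
rewrite comp_lfunNl posN //; apply: isW_root (simple_root i); exact: isWV.
Qed.

Lemma rup_len i w : right_ascent i w -> len (wv (rrefl i w)) = (len (wv w)).+1.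
Proof.
move=> h; have Ww := isW_wv w; rewrite wv_rw -(lenV (isWM Ww (isW_simple i))).
by rewrite (isW_invM Ww (isW_simple i)) simple_inv len_up ?lenV //; exact: isWV.
Qed.

Lemma SS_TT i phi : lattice_coefs phi -> SS (T i phi) = - q^-1 *: SS phi.
Proof.
move=> hphi; rewrite /SS scaler_sumr.
rewrite (sum_pairs _ (rwK i) (rup_rw i)) [RHS](sum_pairs _ (rwK i) (rup_rw i)).
apply: eq_bigr => w uw; have el := rup_len uw.
have h psi : lattice_coefs psi -> heckeTinv_word (rword (wv (rrefl i w))) psi = heckeTinv_word
  (rword (wv w)) (I i psi).
  move=> hpsi; have Ww := isW_wv w; have Wl := isW_wv (rrefl i w).
  rewrite (@IIs_word _ (rcons (rword (wv w)) i) psi) //.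
  - by rewrite -cats1 IIs_cat.
  - exact: reduced_reduced_word.
  - apply/reduced_len; rewrite size_rcons word_rcons word_reduced // -wv_rw el.
    by congr _.+1; exact: (erefl : size (rword (wv w)) = len (wv w)).
  by rewrite word_rcons !word_reduced // wv_rw.
rewrite !h //; last exact: HMm_TT.
rewrite el IITT TT_E (proj1 (lin_IIs _)) (proj2 (lin_IIs _)).
exact: pair_aux.
Qed.

Definition refl_word t f := foldr s f t.

(** An inverse letter raises the length by at most one, so at an element at least as long as t only
    the leading term of every letter can contribute. *)
Lemma IIs_coef t w f : (size t <= len (wv w))%N ->
  heckeTinv_word t (scale_coefs f (heckeB (mkW \1%VF))) w = if word t == wv w then refl_word t f
    else 0.
Proof.
elim: t w => [|i t IH] w /= hw.
  rewrite mulNE beE -[RHS]/(if \1%VF == wv w then f else 0).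
  have -> : (w == mkW \1%VF) = (\1%VF == wv w).
    apply/eqP/eqP => [->|ew]; first by rewrite mkWK //; exact: isW1.
    by apply: wv_inj; rewrite -ew mkWK //; exact: isW1.
  by case: eqP; rewrite ?mulr1 ?mulr0.
have Ww := isW_wv w.
have e0 : heckeTinv_word t (scale_coefs f (heckeB (mkW \1%VF))) w = 0.
  rewrite IH ?(ltnW hw) //; case: eqP => // ew.
  by have := len_word t; rewrite ew leqNgt hw.
rewrite IIE HMD HMN HMZ TTE e0 d0 s0 !scaler0 add0r subr0.
rewrite IH; last first.
  have [uw|dw] := boolP (ascent i w); first by rewrite len_lw //; lia.
  have := @len_lw i (lrefl i w); rewrite up_lw lwK => /(_ dw) el.
  by move: hw; rewrite el.
have -> : (word t == wv (lrefl i w)) = (word (i :: t) == wv w).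
  rewrite wv_lw word_cons; apply/eqP/eqP => [->|<-]; by rewrite simpleKl.
rewrite if_same addr0; case: eqP => //; by rewrite s0.
Qed.

Definition antisym_coef f := SS (scale_coefs f (heckeB (mkW \1%VF))).

Lemma SSe_w0 f : antisym_coef f (mkW w0) = (- q) ^+ len w0 *: refl_word (rword w0) f.
Proof.
have W0 := isW_w0 Phi; have ew : wv (mkW w0) = w0 by rewrite mkWK.
rewrite /antisym_coef /SS sum_ffunE (bigD1 (mkW w0)) //= big1 ?addr0 => [|w ww0]; rewrite HMZ
  IIs_coef ew //.
- by rewrite word_reduced // eqxx.
- have Ww := isW_wv w; rewrite word_reduced //.
  case: eqP => [e1|]; last by rewrite scaler0.
  by case/eqP: ww0; apply: wv_inj; rewrite e1 ew.
by apply: (proj2 (w0P Phi)); exact: isW_wv.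
Qed.

(** This is pi(T_i) on F[L^m] ([Ta_pii]); the plus sign reflects g = -1 there. *)
Definition demazure_lusztig i f := q *: s i f + z *: d i f.
Local Notation pii := demazure_lusztig.

Lemma HMm_e f : supp Lm f -> lattice_coefs (scale_coefs f (heckeB (mkW \1%VF))).
Proof.
move=> hf w; rewrite mulNE beE; case: eqP => _ /=; rewrite ?mulr1 ?mulr0 //; exact: supp0.
Qed.

(** The eigenvector equation read at the longer element s_i w, solved for the coordinate at w. Thus
    every coordinate is determined by the one at w0. *)
Lemma SSe_up f i w : supp Lm f -> ascent i w -> antisym_coef f w = - pii i (antisym_coef f (lrefl
  i w)).
Proof.
move=> hf uw; have := TT_SS i (HMm_e hf); rewrite -/(antisym_coef f) => /ffunP/(_ (lrefl i w)).
rewrite TTE HMZ lwK up_lw uw /=; set a := antisym_coef f w; set b := antisym_coef f _ => eab.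
have ea : s i a = - q^-1 *: b - z *: d i b - z *: s i b by rewrite -eab; ring.
rewrite -[a](sK i) ea !sB !sZ s_d sK /pii.
have sE : s i b = b - d i b * (1 - e (rescaled_coroot M i)) by rewrite dP subKr.
have [Q qE] := scale_mul q; have [Q' q'E] := scale_mul q^-1.
rewrite sE !scalerBl !scaleNr !qE !q'E; ring.
Qed.

Lemma SSe_word f t : supp Lm f -> is_reduced t ->
  antisym_coef f (mkW (word t \o w0)%VF) = (-1) ^+ size t *: foldr pii (antisym_coef f (mkW w0)) t.
Proof.
move=> hf; elim: t => [|i t IH]; first by rewrite comp_lfun1l expr0 scale1r.
move=> /reduced_cons[/IH IHt ut]; have W0 := isW_w0 Phi; have Wt := isW_word t.
have Wtw := isWM Wt W0.
set w := mkW _; have ew : wv w = (word (i :: t) \o w0)%VF.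
  by rewrite mkWK //; apply: isWM => //; exact: isW_word.
have el : lrefl i w = mkW (word t \o w0)%VF.
  by apply: wv_inj; rewrite wv_lw ew mkWK // word_cons -comp_lfunA simpleKl.
rewrite (SSe_up (i := i)) // ?el ?IHt /=.
  have lp : lin (pii i) by apply: linD; apply: linZ; [exact: lin_spa|exact: lin_dma].
  by rewrite (proj2 lp) exprS mulN1r scaleNr.
have ru := isW_root Wt (simple_root i).
rewrite /ascent ew word_cons !comp_lfunA simple_comp_self !comp_lfunNl posN ?pos_w0 ?ut //.
exact: isW_root.
Qed.

End Antisymmetrizer.

Local Notation SS := antisymmetrizer.
Local Notation pii := demazure_lusztig.

(** * Transfer to the scalar side, inversion and w0 *)

Section Involutions.
Implicit Types (x y nu : E) (G : A) (c : F).
Local Notation s := (spa X).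
Local Notation d := (dma X).
Implicit Types (phi psi : heckeMod).

Lemma s_mul i f h : supp Lm f -> s i (f * h) = s i f * s i h.
Proof.
move: f; apply: supp_lin_eq => [||nu hnu].
- by apply: (lin_comp (lin_spa X i)); apply: lin_mulr; exact: lin_id.
- by apply: lin_mulr; exact: lin_spa.
have [_ /(_ _ (simple_root i))[k hk]] := hnu.
by rewrite (s_mulex _ hk) spa_ex (kk_eq hk).
Qed.

Lemma d_mul i f h : supp Lm f -> d i (f * h) = s i f * d i h + d i f * h.
Proof.
move=> hf; apply: (Y_reg i).
transitivity (s i f * (d i h * (1 - e (bet i))) + d i f * (1 - e (bet i)) * h); last by ring.
by rewrite !dP s_mul //; ring.
Qed.

Lemma BernsteinE i g phi : supp Lm g ->
  T i (scale_coefs g phi) = scale_coefs (s i g) (T i phi) + z *: scale_coefs (d i g) phi.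
Proof.
move=> hg; apply/ffunP => w; rewrite !HME d_mul // !s_mul //.
have [Z zE] := scale_mul z; case: (ascent i w); rewrite ?addr0 !zE; ring.
Qed.

Definition right_hecke i f := - q^-1 *: s i f + z *: d i f.
Definition demazure_lusztig_inv i f := pii i f - z *: f.
Local Notation piv := demazure_lusztig_inv.

(** Rewrite f T_i as T_i s_i(f) plus z times the divided difference of f; the outer T_i is absorbed
    as - q^-1. *)
Lemma SS_mulTT i f phi : supp Lm f -> lattice_coefs phi -> SS (scale_coefs f (T i phi)) = SS
  (scale_coefs (right_hecke i f) phi).
Proof.
move=> hf hphi; have hsf := supp_s i hf.
have hm g : supp Lm g -> lattice_coefs (scale_coefs g phi).
  move=> hg w; rewrite mulNE; apply: suppM hg (hphi w) => x y; exact: mlatticeD.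
have := BernsteinE i phi hsf; rewrite sK d_s mulNNl scalerN => /esym/eqP.
rewrite subr_eq => /eqP ->; have [SD SZ] := lin_SS.
rewrite SD SS_TT ?SZ; last exact: hm.
have mZ c g : scale_coefs (c *: g) phi = c *: scale_coefs g phi.
  by apply/ffunP => w; rewrite !HME scalerAl.
by rewrite /right_hecke mulNDl !mZ SD !SZ.
Qed.

Lemma Ta_pii i f : supp Lm f -> Ta X i f = pii i f.
Proof.
move=> hf; have h0 : supp (lattice M) 1 by rewrite -(ex0 X); apply/supp_ex/lattice0.
rewrite -{1}[f]mulr1 T_mul // mulr1; congr (_ + _).
have k0 : sr i 0 = (0 * (m (sr i))%:Z)%:~R :> R by rewrite linear0 mul0r.
rewrite -(ex0 X) Ta_ex (kk_eq k0) gm0 mul0r scaler0 addr0 linear0 ex0.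
have -> : gB P 0 (sr i) = -1 by apply: (gB_one _ _ _ k0); [exact: simple_root|exact: lattice0].
by rewrite mulrN1 opprK -scalerAr mulr1.
Qed.

Lemma supp_sub (G H : set E) f : (forall x, G x -> H x) -> supp G f -> supp H f.
Proof.
move=> GH; apply: (supp_lin (f := id)) => [|x Gx]; first exact: lin_id.
by apply/supp_ex/GH.
Qed.

Lemma supp_pii i f : supp Lm f -> supp Lm (pii i f).
Proof. by move=> hf; apply: suppD; apply: suppZ; [exact: supp_s|exact: supp_d]. Qed.

Lemma supp_piis t f : supp Lm f -> supp Lm (foldr pii f t).
Proof. by move=> hf; elim: t => //= i t; exact: supp_pii. Qed.

Lemma piv_pii i f : supp Lm f -> piv i (pii i f) = f.
Proof.
move=> hf; rewrite /piv -(Ta_pii i (supp_pii i hf)) -(Ta_pii i hf).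
rewrite T_quad ?addrK //; by apply: supp_sub hf => x [].
Qed.

Definition invert := wa X (fun x => - x).

Lemma lin_iot : lin invert. Proof. exact: lin_wa. Qed.

Lemma iot_ex x : invert (e x) = e (- x). Proof. exact: wa_ex. Qed.

Lemma iotK : involutive invert.
Proof.
by apply: lin_ext => [||x] //; [exact: lin_comp lin_iot lin_iot|rewrite !iot_ex opprK].
Qed.

Lemma wa_mul (t : E -> E) f g : (forall x y, t (x + y) = t x + t y) ->
  wa X t (f * g) = wa X t f * wa X t g.
Proof.
move=> tD; have lt := lin_wa X t; have lid := @lin_id F A.
move: f; apply: lin_ext => [||x]; [by apply: (lin_comp lt); exact: lin_mulr|exact: lin_mulr|].
move: g; apply: lin_ext => [||y]; [by apply: (lin_comp lt); exact: lin_mull|exact: lin_mull|].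
by rewrite exM !wa_ex exM tD.
Qed.

Lemma iotM f g : invert (f * g) = invert f * invert g.
Proof. by apply: wa_mul => x y; exact: opprD. Qed.

Lemma supp_iot f : supp Lm f -> supp Lm (invert f).
Proof.
apply: supp_lin => [|x hx]; first exact: lin_iot.
by rewrite iot_ex; apply/supp_ex/mlatticeN.
Qed.

Lemma iot_s i f : supp Lm f -> invert (s i f) = s i (invert f).
Proof.
move: f; apply: supp_lin_eq => [||x hx].
- exact: lin_comp lin_iot (lin_spa X i).
- exact: lin_comp (lin_spa X i) lin_iot.
by rewrite !(iot_ex, s_ex) // ?linearN //; exact: mlatticeN.
Qed.

Lemma iot_d i f : supp Lm f -> invert (d i (invert f)) = - (e (bet i) * d i f).
Proof.
move=> hf; apply: (Y_reg i); have hi := supp_iot hf.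
rewrite mulNr -mulrA dP; have := congr1 invert (dP i (invert f)).
rewrite iotM !(linB _ _ lin_iot) iot_s // iotK iot_ex -(ex0 X) iot_ex oppr0 ex0 => <-.
set a := invert _; transitivity (a * (e (bet i) * e (- bet i)) - e (bet i) * a); last by ring.
by rewrite Y_inv; ring.
Qed.

(** Conjugated by inversion, the scalar-side operator is minus the inverse of pi(T_i). Hence in
    [SS_TTs] each T_i cancels one pi(T_i) at the cost of a sign. *)
Lemma kap_iot i f : supp Lm f -> right_hecke i (invert f) = - invert (piv i f).
Proof.
move=> hf; have hi := supp_iot hf; apply: (can_inj iotK).
have [iD iZ] := lin_iot.
rewrite /right_hecke /piv /demazure_lusztig (linN _ lin_iot) iotK iD !iZ -iot_s // iotK iot_d //.
have sE : s i f = f - d i f * (1 - e (bet i)) by rewrite dP subKr.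
have [Q qE] := scale_mul q; have [Q' q'E] := scale_mul q^-1.
rewrite sE !scalerBl !scaleNr !qE !q'E; ring.
Qed.

Lemma SS_TTs t G phi : supp Lm G -> lattice_coefs phi ->
  SS (scale_coefs (invert (foldr pii G t)) (heckeT_word t phi)) = (-1) ^+ size t *: SS (scale_coefs
    (invert G) phi).
Proof.
move=> hG hphi; elim: t => [|i t IH] /=; first by rewrite scale1r.
rewrite SS_mulTT; last exact: HMm_TTs.
  rewrite kap_iot; last exact/supp_pii/supp_piis.
  by rewrite (piv_pii i (supp_piis t hG)) mulNNl (linN _ (lin_SS)) IH exprS mulN1r scaleNr.
by apply: supp_iot; exact/supp_pii/supp_piis.
Qed.

Lemma wacts_wa t f : supp Lm f -> refl_word t f = wa X (word t) f.
Proof.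
move: f; apply: supp_lin_eq => [||x hx]; [|exact: lin_wa|].
  by elim: t => [|i t IH]; [exact: lin_id|exact: lin_comp (lin_spa X i) IH].
elim: t => [|i t IH] /=; first by rewrite wa_ex id_lfunE.
rewrite IH !wa_ex s_ex ?comp_lfunE //; apply: mlattice_isW hx; exact: isW_word.
Qed.

(** The inversion iota and the outer w0 of the statement, taken together; [psi_pii] shows the
    compatibility with pi(T_i). *)
Definition psi f := wa X w0 (invert f).

Lemma psi_ex x : psi (e x) = e (- w0 x).
Proof. by rewrite /psi iot_ex wa_ex linearN. Qed.

Lemma lin_psi : lin psi.
Proof. exact: lin_comp (lin_wa X w0) lin_iot. Qed.

Lemma psiK : involutive psi.
Proof.
apply: lin_ext => [||x]; [exact: lin_comp lin_psi lin_psi|exact: lin_id|].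
by rewrite !psi_ex [w0 (- _)]linearN /= opprK w0Kx.
Qed.

Lemma psiM f g : psi (f * g) = psi f * psi g.
Proof. by rewrite /psi iotM wa_mul // => x y; exact: linearD. Qed.

Lemma supp_psi f : supp Lm f -> supp Lm (psi f).
Proof.
apply: supp_lin => [|x hx]; first exact: lin_psi.
rewrite psi_ex; apply/supp_ex/mlatticeN/mlattice_isW => //; exact: isW_w0.
Qed.

Lemma psi_s i f : supp Lm f -> psi (s i f) = s (star i) (psi f).
Proof.
move: f; apply: supp_lin_eq => [||x hx].
- exact: lin_comp lin_psi (lin_spa X i).
- exact: lin_comp (lin_spa X (star i)) lin_psi.
rewrite s_ex // !psi_ex s_ex; last by apply: mlatticeN; apply: mlattice_isW hx; exact: isW_w0.
by rewrite star_reflection !comp_lfunE !linearN /= w0Kx.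
Qed.

Lemma bet_star i : bet (star i) = - w0 (bet i).
Proof.
have W0 := isW_w0 Phi; have [t et] := W0; have ri := simple_root i.
rewrite /rescaled_coroot starE multN; last exact: isW_root.
rewrite mult_comp // corootN linearMn mulNrn; congr (- (_ *+ _)).
by rewrite -et coroot_word -(word_rev_inv et) w0V et.
Qed.

Lemma psi_pii i f : supp Lm f -> psi (pii i f) = pii (star i) (psi f).
Proof.
move=> hf; have [pD pZ] := lin_psi; rewrite /demazure_lusztig pD !pZ psi_s //; congr (_ + _ *: _).
apply: (Y_reg (star i)); rewrite dP -psi_s // -(linB _ _ lin_psi) -dP psiM.
by rewrite (linB _ _ lin_psi) -(ex0 X) !psi_ex linear0 oppr0 bet_star.
Qed.

Lemma psi_SSe G t : supp Lm G -> is_reduced t ->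
  psi (antisym_coef (invert G) (mkW (word t \o w0)%VF)) =
  ((-1) ^+ size t * (- q) ^+ len w0) *: foldr pii G [seq star i | i <- t].
Proof.
move=> hG rt; have hi := supp_iot hG; rewrite SSe_word // SSe_w0 wacts_wa //.
rewrite word_reduced; last exact: isW_w0.
have [pD pZ] := lin_psi; rewrite pZ -scalerA; congr (_ *: _).
rewrite -/(psi G); have := supp_psi hG => hp.
have -> : forall r, foldr pii ((- q) ^+ len w0 *: psi G) r = (- q) ^+ len w0 *: foldr pii (psi G) r.
  elim=> //= i r ->.
  have lp : lin (pii i) by apply: linD; apply: linZ; [exact: lin_spa|exact: lin_dma].
  by rewrite (proj2 lp).
rewrite pZ; congr (_ *: _); elim: t {rt} => [|i t IH] /=; first exact: psiK.
by rewrite psi_pii ?IH //; exact: supp_piis.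
Qed.

End Involutions.

Local Notation piv := demazure_lusztig_inv.

(** * Evaluation *)

Section Weights.
Implicit Types (x y nu : E) (u w : 'End(E)).

Lemma in_inversions w a : isW w ->
  (a \in inversions Phi w) = (a \in pos) && ((a \o w^-1)%VF \notin pos).
Proof.
move=> Ww; have -> : (a \in inversions Phi w) =
    (a \in pos) && ((a \o w^-1)%VF \in negroots Phi).
  by rewrite /inversions; move: pos (negroots Phi) => p n; rewrite !inE.
case pa: (a \in pos) => //=.
by rewrite negE //; apply: isW_root; [exact: isWV|exact: pos_root].
Qed.

Lemma inversions_up i u : isW u -> (sr i \o u)%VF \in pos ->
  inversions Phi (sS i \o u)%VF = ((sr i \o u)%VF |` inversions Phi u)%fset /\
  (sr i \o u)%VF \notin inversions Phi u.
Proof.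
move=> Wu ui; have Wv := isWV Wu.
have au a : (a \o u^-1 \o u)%VF = a by rewrite -comp_lfunA (isW_VK Wu) comp_lfun1r.
have ua a : (a \o u \o u^-1)%VF = a by rewrite -comp_lfunA (isW_KV Wu) comp_lfun1r.
have ni : (sr i \o u)%VF \notin inversions Phi u.
  by rewrite in_inversions // ui ua pos_simple.
split=> //; apply/fsetP => a; rewrite in_fset1U !in_inversions //; last exact: isW_simpleM.
rewrite (isW_invM (isW_simple i) Wu) simple_inv comp_lfunA.
have [pa|na] := boolP (a \in pos) => /=; last first.
  by rewrite orbF; apply/esym/eqP => ea; rewrite ea ui in na.
have ra := isW_root Wv (pos_root pa).
have [->|ne] := eqVneq a (sr i \o u)%VF.
  by rewrite ua simple_comp_self posN ?simple_root // pos_simple.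
rewrite pos_simple_comp_eq //.
  by apply: contra ne => /eqP h; rewrite -h au.
apply/eqP => h; have : - a = (sr i \o u)%VF by rewrite -[a in LHS]au h comp_lfunNl opprK.
by move=> h2; have := ui; rewrite -h2 posN ?pa // pos_root.
Qed.

Section AtPoint.
Variables (c : E).
Hypothesis Lc : L c.

Lemma hh1 : hh c \1%VF = 1.
Proof.
rewrite /Defs.hh len1 !expr0 !mul1r.
have -> : inversions Phi \1%VF = fset0.
  apply/fsetP => a; rewrite in_fset0 in_inversions; last exact: isW1.
  have -> : (\1^-1)%VF = \1%VF :> 'End(E) by rewrite (word_rev_inv (erefl (word [::]))).
  by rewrite comp_lfun1r andbN.
by rewrite big_seq_fset0.
Qed.

(** The one new inversion contributes precisely the coefficient of y^(s_i u c) in pi(T_i) y^(u c),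
    which is why h is the weight of the evaluation. *)
Lemma hh_up i u : isW u -> (sr i \o u)%VF \in pos ->
  hh c (sS i \o u)%VF = - q * gB P (u c) (sr i) * hh c u.
Proof.
move=> Wu ui; have [ei ni] := inversions_up Wu ui.
rewrite /Defs.hh ei len_up // !exprS big_fsetU1 //= (gB_comp P Wu (simple_root i) Lc).
have gen (x y a b : F) : -1 * x * (q * y) * (a * b) = - q * a * (x * y * b) by ring.
exact: gen.
Qed.

Hypothesis cdom : forall i, 0 <= (sr i c : R).

Lemma hh_stab (x : 'End(E)) : stab c x -> hh c x = q ^+ len x.
Proof.
move: x; apply: (stab_ind cdom) => [|i u ci su ui IH]; first by rewrite hh1 len1.
have [Wu uc] := (stabE Phi c u).1 su.
rewrite hh_up // uc len_up // IH exprS.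
rewrite (@gB_one _ _ _ _ _ _ _ _ _ 0) ?simple_root ?ci ?mul0r //.
by rewrite mulrN1 opprK.
Qed.

Lemma hhM t (x : 'End(E)) : stab c x -> len (word t \o x)%VF = (size t + len x)%N ->
  hh c (word t \o x)%VF = hh c (word t) * q ^+ len x.
Proof.
move=> sx; have [Wx xc] := (stabE Phi c x).1 sx.
elim: t => [|i t IH] /= el; first by rewrite comp_lfun1l hh1 mul1r hh_stab.
have Wt := isW_word t; have Wtx := isWM Wt Wx; rewrite -!comp_lfunA in el *.
have le : (len (word t \o x)%VF <= size t + len x)%N.
  by rewrite -{1}(word_reduced Wx) -word_cat (leq_trans (len_word _)) // size_cat.
have up1 : (sr i \o (word t \o x))%VF \in pos.
  by rewrite pos_up // el; lia.
have el' : len (word t \o x)%VF = (size t + len x)%N by move: el; rewrite len_up //; lia.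
have up2 : (sr i \o word t)%VF \in pos.
  apply: contraLR up1 => dn; have := len_down Wt dn; have := len_word t => h1 h2.
  rewrite pos_up // -leqNgt comp_lfunA -{1}(word_reduced (isWM (isW_simple i) Wt)).
  rewrite -{1}(word_reduced Wx) -word_cat (leq_trans (len_word _)) // size_cat el'.
  by rewrite -!/(len _); lia.
by rewrite !hh_up // comp_lfunE xc IH // mulrA.
Qed.

End AtPoint.

End Weights.

Section Evaluation.
Implicit Types (x y nu : E).
Local Notation s := (spa X).
Local Notation d := (dma X).
Local Notation geom_term := (gma X).
Implicit Types (phi psi : heckeMod) (w u : W).

Variable c : E.
Hypothesis Lc : L c.
Hypothesis cbound : forall a, a \in pos -> 0 <= (a c : R) < (m a)%:R.

Definition evaluation phi : A := \sum_(w : W) hh c (wv w) *: (phi w * e (wv w c)).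
Local Notation ev := evaluation.

Lemma gm_N1 i : geom_term i (-1) = 1.
Proof.
by apply: (Y_reg i); rewrite gmaP mul1r mulrN1z opprK.
Qed.

(** The bound on c puts alpha_i(w c) into [0, m) at an ascent and into (-m, 0] at a descent. So the
    integer part is 0 or -1, and the fraction in pi(T_i) is 0 or 1. *)
Lemma Ta_point i w : hh c (wv w) *: Ta X i (e (wv w c)) =
  hh c (wv (lrefl i w)) *: e (wv (lrefl i w) c) + (if ascent i w then 0 else (z * hh c (wv w)) *: e
    (wv w c)).
Proof.
have Ww := isW_wv w; have ri := isW_root Ww (simple_root i); have q0 := qq_neq0 P.
have Lwc := lattice_isW Ww Lc; have mi := mult_comp M Ww (simple_root i).
have [n hn] := lattice_int (simple_root i) Lwc.
rewrite Ta_ex wv_lw comp_lfunE; case uw: (ascent i w).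
  have := cbound uw; rewrite mi comp_lfunE => /andP[h1 h2].
  have k0 : kk i (wv w c) = 0.
    rewrite /root_quotient hn intrKfloor divz_small //; move: h1 h2; rewrite hn ler0z pmulrn
      ltr_int.
    by move=> -> h; rewrite absz_nat.
  rewrite k0 gm0 mul0r scaler0 !addr0 scalerA (hh_up Lc) //.
  by congr (_ *: _); ring.
have ul : ascent i (lrefl i w) by rewrite up_lw uw.
have := cbound ul; rewrite (mult_comp M (isW_wv (lrefl i w)) (simple_root i)) wv_lw.
rewrite !comp_lfunE -comp_lfunE simple_comp_self opp_lfunE hn -rmorphN /= ler0z pmulrn ltr_int.
move=> /andP[h1 h2].
have eh : hh c (wv w) = - q * gB P (sS i (wv w c)) (sr i) * hh c (sS i \o wv w)%VF.
  rewrite -{1}(lwK i w) wv_lw (hh_up Lc) //; last exact: isW_wv.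
  by rewrite wv_lw comp_lfunE.
(* On the wall s_i fixes w c, and pi(T_i) acts by q = q^-1 + z. *)
have [n0|n0] := eqVneq n 0.
  have a0 : sr i (wv w c) = (0 * (m (sr i))%:Z)%:~R :> R by rewrite hn n0 mul0r.
  have sE : sS i (wv w c) = wv w c by rewrite reflectionE hn n0 scale0r subr0.
  rewrite sE (kk_eq a0) gm0 mul0r scaler0 addr0 -scalerDl scalerA.
  rewrite (gB_one _ _ Lwc a0) ?simple_root // in eh *.
  congr (_ *: _); rewrite eh sE (gB_one _ _ Lwc a0) ?simple_root //; field; exact: q0.
have k1 : kk i (wv w c) = -1.
  rewrite /root_quotient hn intrKfloor.
  have -> : n = -1 * (m (sr i))%:Z + ((m (sr i))%:Z + n) by ring.
  rewrite divzMDl; last by rewrite eqz_nat gtn_eqF // mult_gt0.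
  by rewrite divz_small ?addr0 // absz_nat; lia.
have nd : ~~ ((m (sr i))%:Z %| n)%Z.
  apply/negP => /dvdzP[k hk]; move: n0 h1 h2; rewrite hk; have := mult_gt0 M (sr i).
  by case: k {hk} => k; nia.
rewrite k1 gm_N1 mul1r scalerDr !scalerA; congr (_ *: _ + _ *: _); last exact: mulrC.
have := gB_inv P Lwc hn nd; rewrite eh.
set a := gB P _ _; set b := gB P _ _ => ab.
transitivity (q ^+ 2 * (a * b) * hh c (sS i \o wv w)%VF); first by ring.
by rewrite ab mulfV ?mul1r // expf_neq0.
Qed.

Lemma ev_TT i phi : lattice_coefs phi -> ev (T i phi) = Ta X i (ev phi).
Proof.
move=> hphi; have lT := lin_Ta X i; have Lsupp w : supp L (e (wv w c)).
  by apply/supp_ex/lattice_isW => //; exact: isW_wv.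
rewrite /ev (lin_sum _ _ _ lT).
transitivity (\sum_w (s i (phi w) * (hh c (wv w) *: Ta X i (e (wv w c))) +
    (z * hh c (wv w)) *: (d i (phi w) * e (wv w c)))); last first.
  apply: eq_bigr => w _; rewrite (proj2 lT) T_mul // scalerDr !scalerA -scalerAr.
  by congr (_ + _ *: _); exact: mulrC.
under [RHS]eq_bigr => w _ do rewrite Ta_point mulrDr -addrA.
rewrite big_split /= [X in _ = X + _](reindex_inj (inv_inj (lwK i))) /= -big_split /=.
apply: eq_bigr => w _; rewrite lwK TTE; move: (e _) (hh c _) => y h.
have [Z zE] := scale_mul z; have [H hE] := scale_mul h; rewrite -!scalerA !zE !hE.
by case: (ascent i w); rewrite ?zE ?hE; ring.
Qed.

End Evaluation.

Local Notation ev := evaluation.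

(** * Stabilizers and alcoves *)

Section LongestStabilizer.
Variable c : E.
Implicit Types (u w x : 'End(E)).
Hypothesis cdom : forall i, 0 <= (sr i c : R).
Local Notation x0 := (longest Phi (stab c)).

Lemma longest_stab : stab c x0 /\ forall u, stab c u -> (len u <= len x0)%N.
Proof.
by apply: longestP => [w /stabE[]//|]; exists \1%VF; exact: stab1.
Qed.

Lemma longest_stab_neg a : a \in pos -> (a c : R) = 0 -> (a \o x0)%VF \notin pos.
Proof.
have [sx xmax] := longest_stab; have [Wx xc] := (stabE Phi c x0).1 sx.
move=> pa ac; rewrite pos_ht isW_root ?pos_root //= -leNgt.
case/posrootP: pa => _ [k ek]; rewrite ek ht_natcomp.
have k0 j : (k j != 0)%N -> (sr j c : R) = 0.
  move=> kj; move: ac; rewrite ek sum_lfunE => /eqP; rewrite psumr_eq0 => [/allP/(_ j)|l _].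
    rewrite mem_index_enum => /(_ isT) /=; rewrite -scaler_nat scale_lfunE.
    by rewrite /GRing.scale /= mulf_eq0 pnatr_eq0 (negbTE kj) => /eqP.
  by rewrite -scaler_nat scale_lfunE mulr_ge0.
apply: sumr_le0 => j _; have [->|kj] := eqVneq (k j) 0%N; first by rewrite mul0r.
rewrite mulr_ge0_le0 // leNgt; apply/negP => h.
have pj : (sr j \o x0)%VF \in pos by rewrite pos_ht h andbT isW_root // simple_root.
have := xmax _ (stabM (stab_simple (k0 j kj)) sx).
by rewrite len_up // ltnn.
Qed.

(** A letter that raises u lowers u x0, because x0 makes negative every positive root that vanishes
    at c. *)
Lemma longest_stab_len x : stab c x -> (len (x0^-1 \o x)%VF + len x)%N = len x0.
Proof.
have [sx0 xmax] := longest_stab; have [Wx0 x0c] := (stabE Phi c x0).1 sx0.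
have key y : stab c y -> (len (y \o x0)%VF + len y)%N = len x0.
  move: y; apply: (stab_ind cdom) => [|i u ci su ui IH]; first by rewrite comp_lfun1l len1 addn0.
  have [Wu uc] := (stabE Phi c u).1 su; have Wux := isWM Wu Wx0.
  have ni : (sr i \o (u \o x0))%VF \notin pos.
    by rewrite comp_lfunA; apply: longest_stab_neg => //; rewrite comp_lfunE uc.
  by rewrite len_up // -comp_lfunA -IH (len_down Wux ni) addnS.
move=> sx; have [Wx xc] := (stabE Phi c x).1 sx; have := key _ (stabV sx).
by rewrite -(lenV (isWM (isWV Wx) Wx0)) (isW_invM (isWV Wx) Wx0) (isW_invV Wx) (lenV Wx).
Qed.

End LongestStabilizer.

Section Words.
Implicit Types (x w u : 'End(E)) (G : A) (phi psi : heckeMod).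

Lemma lin_pii i : lin (pii i).
Proof. by apply: linD; apply: linZ; [exact: lin_spa|exact: lin_dma]. Qed.

Definition pw (w : 'End(E)) f := foldr pii f (rword w).

Lemma lin_piis t : lin (fun f => foldr pii f t).
Proof. by elim: t => [|i t IH]; [exact: lin_id|exact: lin_comp (lin_pii i) IH]. Qed.

Lemma lin_pw w : lin (pw w).
Proof. exact: lin_piis. Qed.

Lemma supp_pw w f : supp Lm f -> supp Lm (pw w f).
Proof. exact: supp_piis. Qed.

Lemma mcbound0 a : a \in pos -> 0 <= (a 0 : R) < (m a)%:R.
Proof. by move=> _; rewrite linear0 lexx ltr0n mult_gt0. Qed.

Lemma ev_TTs c t phi : L c -> (forall a, a \in pos -> 0 <= (a c : R) < (m a)%:R) -> lattice_coefs
  phi ->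
  ev c (heckeT_word t phi) = foldr (Ta X) (ev c phi) t.
Proof.
by move=> Lc hc hphi; elim: t => //= i t <-; rewrite ev_TT //; exact: HMm_TTs.
Qed.

Lemma Ta_piis t f : supp Lm f -> foldr (Ta X) f t = foldr pii f t.
Proof. by move=> hf; elim: t => //= i t ->; rewrite Ta_pii //; exact: supp_piis. Qed.

Lemma ev_be c f (w : 'End(E)) : isW w -> ev c (scale_coefs f (heckeB (mkW w))) = hh c w *: (f *
  e (w c)).
Proof.
move=> Ww; rewrite /evaluation (bigD1 (mkW w)) //= big1 ?addr0 => [|u uw].
  by rewrite mkWK // mulNE beE eqxx mulr1.
by rewrite mulNE beE (negbTE uw) mulr0 mul0r scaler0.
Qed.

(** Evaluation at the point 0 returns f from f (x) 1, so the braid relations of the module descend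
    to pi on F[L^m]. *)
Lemma piis_word r t f : is_reduced r -> is_reduced t -> word r = word t -> supp Lm f ->
  foldr pii f r = foldr pii f t.
Proof.
move=> plane_root rt ert hf; have L0 := lattice0 M.
have fE : f = ev 0 (scale_coefs f (heckeB (mkW \1%VF))).
  by rewrite ev_be ?hh1 ?linear0 ?ex0 ?mulr1 ?scale1r //; exact: isW1.
have key p : foldr pii f p = ev 0 (heckeT_word p (scale_coefs f (heckeB (mkW \1%VF)))).
  by rewrite ev_TTs -?fE ?Ta_piis //; [exact: mcbound0|exact: HMm_e].
by rewrite !key (TTs_word plane_root rt ert) //; exact: HMm_e.
Qed.

Lemma pw_word t f : is_reduced t -> supp Lm f -> pw (word t) f = foldr pii f t.
Proof.
move=> rt hf; have Wt := isW_word t; apply: piis_word => //; last exact: word_reduced.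
exact: reduced_reduced_word.
Qed.

Lemma pw1 f : supp Lm f -> pw \1%VF f = f.
Proof. by move=> hf; rewrite -[\1%VF]/(word [::]) pw_word //; apply/reduced_len; rewrite len1. Qed.

Lemma pwM (w u : 'End(E)) f : isW w -> isW u -> len (w \o u)%VF = (len w + len u)%N ->
  supp Lm f -> pw (w \o u)%VF f = pw w (pw u f).
Proof.
move=> Ww Wu el hf; rewrite [RHS]/pw /pw -foldr_cat -[foldr _ _ (reduced_word _ _)]/(pw _ f).
have ew : word (rword w ++ rword u) = (w \o u)%VF by rewrite word_cat !word_reduced.
by rewrite -{1}ew pw_word //; apply/reduced_len; rewrite ew el size_cat.
Qed.

Lemma pw_simple i (w : 'End(E)) f : isW w -> (sr i \o w)%VF \in pos -> supp Lm f ->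
  pw (sS i \o w)%VF f = pii i (pw w f).
Proof.
move=> Ww ui hf; rewrite -{1}(word_reduced Ww) -word_cons pw_word //.
by apply/reduced_cons; split; [exact: reduced_reduced_word|rewrite word_reduced].
Qed.

Lemma pii_quad i f : supp Lm f -> pii i (pii i f) = f + z *: pii i f.
Proof.
by move=> hf; apply/eqP; rewrite -subr_eq; apply/eqP; exact: piv_pii.
Qed.

Section AtPoint.
Variable c : E.
Hypothesis cdom : forall i, 0 <= (sr i c : R).
Local Notation x0 := (longest Phi (stab c)).

Definition antisymmetrize f : A := \sum_(x : W | wv x c == c) ((-1) ^+ len (wv x) * q ^- len (wv
  x)) *: pw (wv x) f.

Lemma supp_sum (J : finType) (Q : pred J) (B : J -> A) :
  (forall j : J, Q j -> supp Lm (B j)) -> supp Lm (\sum_(j | Q j) B j).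
Proof. by move=> h; apply: big_ind => //; [exact: supp0|move=> *; exact: suppD]. Qed.

Lemma supp_antis f : supp Lm f -> supp Lm (antisymmetrize f).
Proof. by move=> hf; apply: supp_sum => x _; apply/suppZ/supp_pw. Qed.

Lemma pii_antis i f : (sr i c : R) = 0 -> supp Lm f -> pii i (antisymmetrize f) = - q^-1 *:
  antisymmetrize f.
Proof.
move=> ci hf; rewrite /antisymmetrize (lin_sum _ _ _ (lin_pii i)) scaler_sumr.
have Qi (x : W) : (wv (lrefl i x) c == c) = (wv x c == c).
  have sc : sS i c = c by rewrite reflectionE ci scale0r subr0.
  rewrite wv_lw comp_lfunE; apply/eqP/eqP => [h|->//].
  by rewrite -[LHS]id_lfunE -(simpleK i) comp_lfunE h sc.
have sp2 (B : W -> A) : \sum_(x | wv x c == c) B x =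
    \sum_(x | (wv x c == c) && ascent i x) (B x + B (lrefl i x)).
  rewrite big_mkcond (sum_pairs _ (lwK i) (up_lw i)) [RHS]big_mkcondl.
  by apply: eq_bigr => x _; rewrite Qi; case: ifP; rewrite ?addr0.
rewrite sp2 [RHS]sp2; apply: eq_bigr => x /andP[_ ux]; have Wx := isW_wv x.
rewrite len_lw // !(proj2 (lin_pii i)) wv_lw pw_simple // pii_quad; last exact: supp_pw.
move: (pw _ f) => a; move: (pii i a) => b; move: (len _) => n; have q0 := qq_neq0 P.
rewrite !scalerDr !scalerA addrCA -scalerDl; congr (_ *: _ + _ *: _).
  by rewrite -!exprVn !exprS; ring.
by rewrite -!exprVn !exprS; field; exact: q0.
Qed.

Lemma pw_antis x f : stab c x -> supp Lm f -> pw x (antisymmetrize f) = (- q^-1) ^+ len x *: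
  antisymmetrize f.
Proof.
move=> sx hf; move: x sx; apply: (stab_ind cdom) => [|i u ci su ui IH].
  by rewrite (pw1 (supp_antis hf)) (len1 Phi) expr0 scale1r.
have [Wu uc] := (stabE Phi c u).1 su.
rewrite (pw_simple Wu ui (supp_antis hf)) IH (proj2 (lin_pii i)) pii_antis // len_up //.
by rewrite scalerA exprSr.
Qed.

(* Both sides are pushed to p with w0 u = p x0^-1. *)
Lemma sum_coset (u : 'End(E)) f : isW u ->
  (forall x, stab c x -> len (u \o x)%VF = (len u + len x)%N) -> supp Lm f ->
  \sum_(x : W | wv x c == c) (- q) ^+ len (wv x) *: pw (w0 \o (u \o wv x))%VF f =
  (q ^+ 2) ^+ len x0 *: pw (w0 \o u)%VF (antisymmetrize f).
Proof.
move=> Wu ulen hf; have W0 := isW_w0 Phi; have q0 := qq_neq0 P.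
have [sx0 _] := longest_stab c; have [Wx0 x0c] := (stabE Phi c x0).1 sx0.
have WX := isWV Wx0; have sX := stabV sx0.
pose p := (w0 \o (u \o x0))%VF; have Wp : isW p by do 2!apply: isWM => //.
have split_ x : stab c x ->
    forall g, supp Lm g -> pw (w0 \o (u \o x))%VF g = pw p (pw (x0^-1 \o x)%VF g).
  move=> sx g hg; have [Wx xc] := (stabE Phi c x).1 sx.
  have e1 : (w0 \o (u \o x))%VF = (p \o (x0^-1 \o x))%VF.
    by rewrite /p !comp_lfunA; congr (_ \o _)%VF; rewrite -!comp_lfunA (isW_KV Wx0) comp_lfun1r.
  rewrite e1 pwM //; first exact: isWM.
  have h1 := len_w0M (isWM Wu Wx); have h2 := len_w0M (isWM Wu Wx0); have h3 := longest_stab_len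
    cdom sx.
  by rewrite -e1; rewrite !ulen // in h1 h2; rewrite -/p in h2; lia.
(* Split off x0^-1 from w0 u = p x0^-1 and use that the antisymmetrizer of the stabilizer is an
   eigenvector. *)
have -> : pw (w0 \o u)%VF (antisymmetrize f) = (- q^-1) ^+ len x0 *: pw p (antisymmetrize f).
  rewrite -{1}[u]comp_lfun1r (split_ _ (stab1 _ _) _ (supp_antis hf)).
  rewrite comp_lfun1r pw_antis // (proj2 (lin_pw p)).
  by rewrite (lenV Wx0).
rewrite scalerA -exprMn.
have -> : q ^+ 2 * - q^-1 = - q by field.
rewrite -(proj2 (lin_pw p)) /antisymmetrize scaler_sumr (lin_sum _ _ _ (lin_pw p)).
pose h (x : W) := mkW (x0^-1 \o wv x)%VF; pose h' (x : W) := mkW (x0 \o wv x)%VF.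
have hE (x : W) : wv (h x) = (x0^-1 \o wv x)%VF by rewrite mkWK //; apply: isWM => //; exact:
  isW_wv.
have h'E (x : W) : wv (h' x) = (x0 \o wv x)%VF by rewrite mkWK //; apply: isWM => //; exact: isW_wv.
have hK : cancel h h' by move=> x; apply: wv_inj; rewrite h'E hE comp_lfunA (isW_KV Wx0)
  comp_lfun1l.
have h'K : cancel h' h by move=> x; apply: wv_inj; rewrite hE h'E comp_lfunA (isW_VK Wx0)
  comp_lfun1l.
rewrite [RHS](reindex h) /=; last by exists h' => x _; [exact: hK|exact: h'K].
have XC : (x0^-1)%VF c = c by have [] := (stabE Phi c (x0^-1)%VF).1 sX.
rewrite [RHS](eq_bigl (fun x : W => wv x c == c)) => [|x]; last first.
  rewrite hE comp_lfunE; apply/eqP/eqP => [ex|->//].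
  by rewrite -[LHS]id_lfunE -(isW_KV Wx0) comp_lfunE ex x0c.
apply: eq_bigr => x /eqP xc.
have sx : stab c (wv x) by apply/stabE; split=> //; exact: isW_wv.
rewrite split_ // hE !(proj2 (lin_pw p)) scalerA; congr (_ *: _).
have := longest_stab_len cdom sx; set a := len _; set b := len _ => <-.
rewrite -exprVn -exprMn exprD mulrAC mulN1r -exprMn.
have -> : - q * - q^-1 = 1 by field.
by rewrite expr1n mul1r.
Qed.

End AtPoint.

End Words.

Section Alcove.
Implicit Types (x y c : E) (u w p : 'End(E)) (a b : 'Hom(E, R^o)).

Lemma C0_dom c : C0 M c -> forall i, 0 <= (sr i c : R).
Proof. by case=> _ h _ i; have /andP[] := h _ (pos_simple i). Qed.

Lemma C0_stab c (w : 'End(E)) x : C0 M c -> isW w -> Lm x -> w c + x = c -> x = 0 /\ w c = c.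
Proof.
case=> _ _ h Ww Lx e; have : [set t | affweyl M t /\ affact t c = c] (w, x).
  by split=> //; split=> //; apply/weylE.
by rewrite h => -[u /stabE[_ uc] [<- <-]].
Qed.

(** At a(c) = m(a), the reflection in a followed by translation by m(a) a^v would fix c, against the
    stabilizer condition. *)
Lemma C0_bound c a : C0 M c -> a \in pos -> 0 <= (a c : R) < (m a)%:R.
Proof.
move=> hc pa; have [_ h _] := hc; have /andP[-> le] /= := h _ pa.
have ra := pos_root pa; have a0 := root_neq0 ra.
rewrite lt_neqAle le andbT; apply/eqP => e.
have [] := @C0_stab c (reflection dot a) (coroot dot a *+ m a) hc.
- exact: isW_reflection.
- exact: mlattice_coroot.
- by rewrite reflectionE e scaler_nat subrK.
move=> /(congr1 a); rewrite linearMn linear0 /= coroot_self // => /eqP.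
by rewrite -mulrnA pnatr_eq0; have := mult_gt0 M a; lia.
Qed.

Lemma C0_opp_bound c a : C0 M c -> a \in pos -> 0 <= (a (- w0 c) : R) < (m a)%:R.
Proof.
move=> hc pa; have W0 := isW_w0 Phi; have ra := pos_root pa.
have rrefl := isW_root W0 ra.
have := @C0_bound c (- (a \o w0)%VF) hc; rewrite posN // pos_w0 // pa => /(_ isT).
by rewrite multN // mult_comp // opp_lfunE comp_lfunE linearN.
Qed.

Lemma mlattice_pair_eq c w w' : C0 M c -> isW w -> isW w' -> Lm (w c - w' c) -> w c = w' c.
Proof.
move=> hc Ww Ww' h; have Wv := isWV Ww'.
have [||| e _] := @C0_stab c (w'^-1 \o w)%VF (- ((w'^-1)%VF (w c - w' c))) hc.
- exact: isWM.
- by apply: mlatticeN; exact: mlattice_isW h.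
- rewrite comp_lfunE linearB /= -[(w'^-1)%VF (w' c)]comp_lfunE (isW_VK Ww') id_lfunE.
  by rewrite opprB addrC subrK.
apply/eqP; rewrite -subr_eq0; apply/eqP.
rewrite -[LHS]id_lfunE -(isW_KV Ww') comp_lfunE.
by move/eqP: e; rewrite oppr_eq0 => /eqP ->; rewrite linear0.
Qed.

(** Adjusted by the stabilizer of c2, the linear part p has minimal length in its coset. The bounds
    on both points then leave a(x') only the values 0 and m(a), according to the sign of a p, and
    such a map preserves the alcove. *)
Lemma alcove_Omega c c2 w x : C0 M c -> C0 M c2 -> isW w -> Lm x -> w c + x = c2 ->
  exists2 t, Omega M t & affact t c = c2.
Proof.
move=> hc hc2 Ww Lx e; have dom2 := C0_dom hc2.
have [y sy ymin] : exists2 y, stab c2 y &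
    forall u, stab c2 u -> (len (y \o w)%VF <= len (u \o (y \o w)))%N.
  have [v [sv hv]] : exists v, stab c2 v /\
      forall u, stab c2 u -> (len (v \o w)%VF <= len (u \o w)%VF)%N.
    pose Q n := `[< exists v, stab c2 v /\ len (v \o w)%VF = n >].
    have exQ : exists n, Q n.
      by exists (len (\1 \o w)%VF); apply/asboolP; exists \1%VF; split=> //; exact: stab1.
    case: (ex_minnP exQ) => n /asboolP[v [sv ev]] hn; exists v; split=> // u su.
    by rewrite ev; apply: hn; apply/asboolP; exists u.
  exists v => // u su; rewrite comp_lfunA; apply: hv; exact: stabM.
have [Wy yc2] := (stabE Phi c2 y).1 sy.
pose p := (y \o w)%VF; pose x' := y x.
have Wp : isW p by apply: isWM.
have Lx' : Lm x' by apply: mlattice_isW Lx.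
have e' : p c + x' = c2 by rewrite /p /x' comp_lfunE -linearD /= e yc2.
have key a : a \in pos -> ((a \o p)%VF \in pos /\ a x' = 0) \/
    (- (a \o p)%VF \in pos /\ a x' = (m a)%:R).
  move=> pa; have ra := pos_root pa; have rp := isW_root Wp ra; have mp := mult_comp M Wp ra.
  have [_ /(_ a ra)[k hk]] := Lx'; have := C0_bound hc2 pa.
  have ma : 0 < (m a)%:R :> R by rewrite ltr0n mult_gt0.
  rewrite -e' linearD /= hk intrM -pmulrn => /andP[h1 h2].
  have [pp|np] := boolP ((a \o p)%VF \in pos).
    left; split=> //; have := C0_bound hc pp; rewrite mp comp_lfunE => /andP[h3 h4].
    suff : k = 0 by move=> ->; rewrite mul0r.
    have k1 : k < 1.
      by rewrite -(ltr_int R) -(ltr_pM2r ma) mul1r; lra.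
    have k2 : -1 < k.
      rewrite -(ltr_int R) -(ltr_pM2r ma) rmorphN mulN1r; lra.
    by move: k1 k2; clear; lia.
  right; have pN : - (a \o p)%VF \in pos by rewrite posN.
  split=> //; have := C0_bound hc pN; rewrite multN // mp opp_lfunE comp_lfunE => /andP[h3 h4].
  (* Otherwise a would vanish at c2, and minimality of p would make a p positive. *)
  have b0 : a (p c) != 0 :> R.
    apply/eqP => b0; move: h1 h2; rewrite b0 !add0r => h1 h2.
    have k1 : k < 1 by rewrite -(ltr_int R) -(ltr_pM2r ma) mul1r.
    have k2 : 0 <= k by rewrite -(ler_int R) -(ler_pM2r ma) mul0r.
    have k0 : k = 0 by move: k1 k2; clear; lia.
    case/negP: np; apply: (lmin_pos dom2 Wp ymin pa).
    by rewrite -e' linearD /= b0 hk k0 mul0r mulr0z addr0.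
  suff : k = 1 by move=> ->; rewrite mul1r.
  have b1 : a (p c) < 0 :> R by rewrite lt_neqAle b0 -oppr_ge0.
  have k1 : k < 2.
    rewrite -(ltr_int R) -(ltr_pM2r ma); have -> : 2%:~R = 1 + 1 :> R by [].
    by rewrite mulrDl mul1r; lra.
  have k2 : 0 < k by rewrite -(ltr_int R) -(ltr_pM2r ma) mul0r; lra.
  by move: k1 k2; clear; lia.
have e'' : affact (p, x') c = c2 by [].
exists (p, x') => //; split; first by split=> //; apply/weylE.
apply/seteqP; split=> [_ [y' hy <-]|y' hy].
  move=> a pa; rewrite /affact linearD /=; case: (key a pa) => -[pp ->].
    by rewrite addr0; have := hy _ pp; rewrite mult_comp ?pos_root // comp_lfunE.
  have := hy _ pp; have ra := pos_root pa; rewrite multN ?isW_root // mult_comp //.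
  by rewrite opp_lfunE comp_lfunE => /andP[h1 h2]; apply/andP; split; lra.
exists ((p^-1)%VF (y' - x')); last first.
  by rewrite /affact /= -[p _]comp_lfunE (isW_KV Wp) id_lfunE subrK.
move=> b pb; have rb := pos_root pb; have Wv := isWV Wp; pose a := (b \o p^-1)%VF.
have ra : a \in rootset Phi by exact: isW_root.
have mb : m b = m a by rewrite /a mult_comp.
have ab : (a \o p)%VF = b by rewrite /a -comp_lfunA (isW_VK Wp) comp_lfun1r.
have -> : b ((p^-1)%VF (y' - x')) = a (y' - x') by rewrite /a comp_lfunE.
rewrite mb linearB /=; have [pa|na] := boolP (a \in pos).
  case: (key a pa) => -[pp ->]; first by rewrite subr0; exact: hy.
  by move: pp; rewrite ab posN ?pb.
have pNa : - a \in pos by rewrite posN.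
have := hy _ pNa; rewrite multN // opp_lfunE => /andP[h1 h2].
have := key _ pNa; rewrite comp_lfunNl ab multN // !opp_lfunE opprK => -[[]|[_ h3]].
  by rewrite posN ?pb.
by apply/andP; split; lra.
Qed.

Lemma representatives_eq (Ct : set E) c c2 w x : orbit_representatives M Ct ->
  Ct c -> Ct c2 -> isW w -> Lm x -> w c + x = c2 -> c = c2.
Proof.
move=> [sub rep] hc hc2 Ww Lx e; have [c' [_ uniq]] := rep _ (sub _ hc).
have [t Ot tc] := alcove_Omega (sub _ hc) (sub _ hc2) Ww Lx e.
rewrite -(uniq c2); last by split=> //; exists t.
symmetry; apply: uniq; split=> //; exists (\1%VF, 0).
  split; first by split; [apply/weylE/isW1|exact: mlattice0].
  have id1 y : affact (\1%VF, 0) y = y by rewrite /affact /= id_lfunE addr0.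
  by apply/seteqP; split=> [_ [y hy <-]|y hy]; [rewrite id1|exists y; rewrite ?id1].
by rewrite /affact /= id_lfunE addr0.
Qed.

End Alcove.

(** * Whittaker functions *)

Section WhittakerSum.
Implicit Types (x w u : 'End(E)) (G : A) (phi : heckeMod).

Definition Ta_inv i f : A := Ta X i f - z *: f.
Local Notation Tinv := Ta_inv.

Lemma lin_Tinv i : lin (Tinv i).
Proof.
have [TD TZ] := lin_Ta X i; split=> [f g|c f]; rewrite /Tinv.
  by rewrite TD scalerDr opprD addrACA.
by rewrite TZ scalerBr !scalerA mulrC.
Qed.

Lemma lin_Tinvs t : lin (fun f => foldr Tinv f t).
Proof. by elim: t => [|i t IH]; [exact: lin_id|exact: lin_comp (lin_Tinv i) IH]. Qed.

Lemma hh_neq0 (x : E) w : hh x w != 0.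
Proof.
rewrite /Defs.hh !mulf_neq0 ?expf_neq0 ?qq_neq0 // ?oppr_eq0 ?oner_eq0 //.
by rewrite prodf_seq_neq0; apply/allP => a _; exact: gg_neq0.
Qed.

Lemma TTs_be1 t : is_reduced t -> heckeT_word t (heckeB (mkW \1%VF)) = heckeB (mkW (word t)).
Proof.
elim: t => // i t IH /reduced_cons[/IH e1 ui]; have Wt := isW_word t.
rewrite [LHS]/= -/(heckeT_word t _) e1 TT_be; last by rewrite /ascent mkWK.
by rewrite /lrefl mkWK.
Qed.

Section AtPoint.
Variables (c : E).
Hypothesis Lc : L c.
Hypothesis cbound : forall a, a \in pos -> 0 <= (a c : R) < (m a)%:R.

Lemma lin_ev : lin (ev c).
Proof.
split=> [phi phi'|b phi]; rewrite /evaluation.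
  by rewrite -big_split; apply: eq_bigr => w _; rewrite HMD mulrDl scalerDr.
rewrite scaler_sumr; apply: eq_bigr => w _.
by rewrite HMZ -scalerAl !scalerA mulrC.
Qed.

Lemma ev_IIs t phi : lattice_coefs phi -> ev c (heckeTinv_word t phi) = foldr Tinv (ev c phi) t.
Proof.
move=> hphi; elim: t => //= i t <-; rewrite -/(heckeTinv_word t phi).
by rewrite IIE (linB _ _ lin_ev) (proj2 lin_ev) ev_TT //; exact: HMm_IIs.
Qed.

(** Write y^(-eta) as the inversion of pi(T_w) G; then [SS_TTs] trades pi(T_w) against the basis
    element T_w. The division by h undoes the weight at w. *)
Lemma whittaker_sum (eta : E) (w : 'End(E)) G : Lm eta -> isW w -> supp Lm G ->
  pw w G = e eta ->
  \sum_(u : W) (- q) ^+ len (wv u) *: foldr Tinv (e (w c - eta)) (rword (wv u)) =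
  ((-1) ^+ len w / hh c w) *: ev c (antisym_coef (invert G)).
Proof.
move=> he Ww hG eG; have h0 := hh_neq0 c w.
have hb : lattice_coefs (scale_coefs (e (- eta)) (heckeB (mkW w))).
  move=> u; rewrite mulNE beE; case: eqP => _ /=; rewrite ?mulr1 ?mulr0; last exact: supp0.
  exact/supp_ex/mlatticeN.
have e1 : e (w c - eta) = (hh c w)^-1 *: ev c (scale_coefs (e (- eta)) (heckeB (mkW w))).
  by rewrite ev_be // scalerA mulVf // scale1r exM addrC.
have e2 : SS (scale_coefs (e (- eta)) (heckeB (mkW w))) = (-1) ^+ len w *: antisym_coef (invert G).
  rewrite -iot_ex -eG -{2}(word_reduced Ww) -TTs_be1; last exact: reduced_reduced_word.
  rewrite SS_TTs // => u; rewrite beE; case: eqP => _ /=; last exact: supp0.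
  by rewrite -(ex0 X); apply/supp_ex/mlattice0.
transitivity ((hh c w)^-1 *: ev c (SS (scale_coefs (e (- eta)) (heckeB (mkW w))))).
  rewrite /antisymmetrizer (lin_sum _ _ _ lin_ev) scaler_sumr; apply: eq_bigr => u _.
  rewrite (proj2 lin_ev) ev_IIs // e1 (proj2 (lin_Tinvs _)) !scalerA mulrC //.
by rewrite e2 (proj2 lin_ev) scalerA mulrC.
Qed.

Lemma comp_mul (x0 x : E) f : supp Lm f ->
  comp X [set x0 + y | y in Lm] (f * e x) = if `[< Lm (x - x0) >] then f * e x else 0.
Proof.
move: f; have lc := lin_compo X; apply: supp_lin_eq => [||nu hnu].
- by apply: (lin_comp (lc _)); apply: lin_mulr; exact: lin_id.
- case: (`[< _ >]); first by apply: lin_mulr; exact: lin_id.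
  by split=> *; rewrite ?addr0 ?scaler0.
rewrite exM comp_ex; congr (if _ then _ else _); apply: asbool_equiv_eq.
split=> [[y Ly ey]|h].
  have exy : x = x0 + y - nu by rewrite ey addrAC subrr add0r.
  have -> : x - x0 = y - nu by rewrite exy addrAC [x0 + y]addrC addrK.
  exact: mlatticeB.
by exists (nu + (x - x0)); [exact: mlatticeD|rewrite addrC -addrA subrK].
Qed.

(** The coset condition forces w c = - theta, so all surviving terms carry the same power of y,
    which the prefactor cancels. *)
Lemma component_sum (theta rho' : E) phi : lattice_coefs phi ->
  (forall w, isW w -> Lm (theta + w c) -> w c = - theta) ->
  wa X w0 (e (rho' - theta) * comp X [set theta - rho' + x | x in Lm] (invert (e rho' * ev c phi)))
    =
  \sum_(w : W | wv w c == - theta) hh c (wv w) *: psi (phi w).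
Proof.
move=> hphi hth; have li := lin_iot; have lc := lin_compo X [set theta - rho' + x | x in Lm].
have -> : invert (e rho' * ev c phi) =
    \sum_(w : W) hh c (wv w) *: (invert (phi w) * e (- (wv w c) - rho')).
  rewrite /evaluation mulr_sumr (lin_sum _ _ _ li); apply: eq_bigr => w _.
  rewrite -scalerAr (proj2 li) !iotM !iot_ex; congr (_ *: _).
  by rewrite mulrCA exM [_ - rho']addrC.
rewrite (lin_sum _ _ _ lc) mulr_sumr (lin_sum _ _ _ (lin_wa X w0)) [RHS]big_mkcond.
apply: eq_bigr => w _; have Ww := isW_wv w.
rewrite (proj2 lc) comp_mul; last exact: supp_iot.
have -> : `[< Lm (- (wv w c) - rho' - (theta - rho')) >] = (wv w c == - theta).
  have -> : - (wv w c) - rho' - (theta - rho') = - (theta + wv w c).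
    by rewrite opprB addrA subrK addrC opprD.
  apply/asboolP/eqP => [/mlatticeN|->]; first by rewrite opprK; exact: hth.
  by rewrite subrr oppr0; exact: mlattice0.
case: eqP => [ew|_]; last by rewrite scaler0 mulr0 (lin0 (lin_wa X w0)).
rewrite ew opprK -scalerAr (proj2 (lin_wa X w0)); congr (_ *: _).
have -> : e (rho' - theta) * (invert (phi w) * e (theta - rho')) = invert (phi w).
  by rewrite mulrCA exM addrA subrK subrr ex0 mulr1.
by [].
Qed.

Lemma psi_SSe_coef G w : isW w -> supp Lm G ->
  psi (antisym_coef (invert G) (mkW w)) = ((-1) ^+ len w * q ^+ len w0) *: pw (w0 \o w)%VF G.
Proof.
move=> Ww hG; have W0 := isW_w0 Phi; have Www := isWM Ww W0.
have ew : w = (word (rword (w \o w0)) \o w0)%VF.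
  by rewrite word_reduced // -comp_lfunA w0K comp_lfun1r.
rewrite {1}ew psi_SSe //; last exact: reduced_reduced_word.
have -> : (w0 \o w)%VF = word [seq star i | i <- rword (w \o w0)].
  by rewrite word_star word_reduced // -!comp_lfunA w0K comp_lfun1r.
rewrite pw_word //; last by apply: reduced_star; exact: reduced_reduced_word.
congr (_ *: _); rewrite -/(len _) -(len_Mw0 Ww).
by rewrite [(- q) ^+ _]exprNn [(-1) ^+ (_ + _)]exprD !mulrA -expr2 sqrr_sign mul1r.
Qed.

(** The elements carrying c to - theta form the coset of u modulo the stabilizer; [hhM] and
    additivity of length bring each summand to the form of [sum_coset]. *)
Lemma coset_sum (theta : E) (u : 'End(E)) G : isW u -> u c = - theta ->
  (forall x, stab c x -> len (u \o x)%VF = (len u + len x)%N) -> supp Lm G ->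
  \sum_(w : W | wv w c == - theta) hh c (wv w) *: psi (antisym_coef (invert G) w) =
  (hh c u * (-1) ^+ len u * q ^+ len w0 * (q ^+ 2) ^+ len (longest Phi (stab c))) *:
    pw (w0 \o u)%VF (antisymmetrize c G).
Proof.
move=> Wu uc ulen hG; have cdom i : 0 <= (sr i c : R) by have /andP[] := cbound (pos_simple i).
rewrite -scalerA -sum_coset // scaler_sumr.
pose h (x : W) := mkW (u \o wv x)%VF; pose h' (x : W) := mkW (u^-1 \o wv x)%VF.
have Wv := isWV Wu.
have hE (x : W) : wv (h x) = (u \o wv x)%VF by rewrite mkWK //; apply: isWM => //; exact: isW_wv.
have h'E (x : W) : wv (h' x) = (u^-1 \o wv x)%VF by rewrite mkWK //; apply: isWM => //; exact:
  isW_wv.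
have hK : cancel h h' by move=> x; apply: wv_inj; rewrite h'E hE comp_lfunA (isW_VK Wu) comp_lfun1l.
have h'K : cancel h' h by move=> x; apply: wv_inj; rewrite hE h'E comp_lfunA (isW_KV Wu)
  comp_lfun1l.
rewrite (reindex h) /=; last by exists h' => x _; [exact: hK|exact: h'K].
rewrite (eq_bigl (fun x : W => wv x c == c)) => [|x]; last first.
  rewrite hE comp_lfunE -uc; apply/eqP/eqP => [ex|->//].
  by rewrite -[LHS]id_lfunE -(isW_VK Wu) comp_lfunE ex -[LHS]comp_lfunE (isW_VK Wu) id_lfunE.
apply: eq_bigr => x /eqP xc; have Wx := isW_wv x.
have sx : stab c (wv x) by apply/stabE.
have el := ulen _ sx; rewrite hE -[h x]wvK hE psi_SSe_coef //; last exact: isWM.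
rewrite -{1}(word_reduced Wu) hhM // word_reduced //.
rewrite el !scalerA; congr (_ *: _); rewrite [(- q) ^+ _]exprNn exprD.
have gen (a1 a2 a3 a4 a5 : F) : a1 * a2 * (a3 * a4 * a5) = a1 * a3 * a5 * (a4 * a2) by ring.
exact: gen.
Qed.

End AtPoint.

End WhittakerSum.

Local Notation Tinv := Ta_inv.

(** * The formula over the interface *)

Section AbstractTheorem.
Implicit Types (x w u : 'End(E)) (G : A).
Local Notation FF := (FF P).
Implicit Types (phi : heckeMod).

(** This and the next three repeat the operators of the statement over the interface, so that they
    unfold to the originals at [concreteAlgebra]. *)
Definition opinvX (U : A -> A) f : A := xget 0 [set f' : A | supp L f' /\ U f' = f].

Definition TauX (rho' : E) i f : A := - q *: (e rho' * opinvX (Ta X i) (e (- rho') * f)).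

Definition piTwX w f : A := foldr (Ta X) f (rword w).

Definition antisymX (c : E) f : A :=
  \sum_(w \in stab c) ((-1) ^+ len w * q ^- len w) *: piTwX w f.

Lemma opinvXE (U : A -> A) f g : (forall g g', supp L g -> supp L g' -> U g = U g' -> g = g') ->
  supp L g -> U g = f -> opinvX U f = g.
Proof.
move=> inj hg eg; have := xgetI 0 (conj hg eg : [set f' : A | supp L f' /\ U f' = f] g).
by rewrite -/(opinvX U f) => -[h1 h2]; apply: inj => //; rewrite h2.
Qed.

Lemma TaK i f : supp L f -> Tinv i (Ta X i f) = f.
Proof. by move=> hf; rewrite /Ta_inv T_quad // addrK. Qed.

Lemma TinvK i f : supp L f -> Ta X i (Tinv i f) = f.
Proof.
move=> hf; have [TD TZ] := lin_Ta X i.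
by rewrite /Ta_inv (linB _ _ (lin_Ta X i)) TZ T_quad // addrK.
Qed.

Lemma supp_Tinv i f : supp L f -> supp L (Tinv i f).
Proof. by move=> hf; rewrite /Ta_inv -scaleNr; apply: suppD; [exact: supp_T|exact: suppZ]. Qed.

Lemma supp_Tinvs t f : supp L f -> supp L (foldr Tinv f t).
Proof. by move=> hf; elim: t => //= i t; exact: supp_Tinv. Qed.

Lemma opinvX_Ta i f : supp L f -> opinvX (Ta X i) f = Tinv i f.
Proof.
move=> hf; apply: opinvXE; [|exact: supp_Tinv|exact: TinvK].
by move=> g g' hg hg' /(congr1 (Tinv i)); rewrite !TaK.
Qed.

(** The conjugations by y^rho' telescope along the word, leaving one factor - q for each letter. *)
Lemma TauX_word (rho' : E) t h : supp L h ->
  foldr (TauX rho') (e rho' * h) t = (- q) ^+ size t *: (e rho' * foldr Tinv h t).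
Proof.
move=> hh; elim: t => [|i t IH] /=; first by rewrite scale1r.
have hs := supp_Tinvs t hh.
rewrite IH /TauX -scalerAr ex_mulVK opinvX_Ta; last exact: suppZ.
by rewrite (proj2 (lin_Tinv i)) -scalerAr scalerA exprS.
Qed.

Lemma pii_piv i f : supp Lm f -> pii i (piv i f) = f.
Proof.
move=> hf; rewrite /demazure_lusztig_inv (linB _ _ (lin_pii i)) (proj2 (lin_pii i)).
by rewrite pii_quad // addrK.
Qed.

Lemma supp_Lm_L f : supp Lm f -> supp L f.
Proof. by apply: supp_sub => x []. Qed.

(** The inverse is sought in F[L], but each pi(T_i) is already invertible on F[L^m]; by injectivity
    on F[L] the value lies there. *)
Lemma opinvX_piTw w f : supp Lm f ->
  supp Lm (opinvX (piTwX w) f) /\ pw w (opinvX (piTwX w) f) = f.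
Proof.
move=> hf.
have inj t g g' : supp L g -> supp L g' -> foldr (Ta X) g t = foldr (Ta X) g' t -> g = g'.
  move=> hg hg'; have hT g1 r : supp L g1 -> supp L (foldr (Ta X) g1 r).
    by move=> h1; elim: r => //= j r; exact: supp_T.
  elim: t => //= i t IH /(congr1 (Tinv i)); rewrite !TaK //; exact: hT.
have [g hg eg] : exists2 g, supp Lm g & foldr pii g (rword w) = f.
  elim: (rword w) f hf => [|i t IH] f hf; first by exists f.
  have hp : supp Lm (piv i f).
    by rewrite /demazure_lusztig_inv -scaleNr; apply: suppD; [exact: supp_pii|exact: suppZ].
  by have [g hg eg] := IH _ hp; exists g => //=; rewrite eg pii_piv.
have -> : opinvX (piTwX w) f = g.
  apply: opinvXE; [exact: inj|exact: supp_Lm_L|].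
  by rewrite /piTwX Ta_piis.
by split.
Qed.

Lemma piTwXE w f : supp Lm f -> piTwX w f = pw w f.
Proof. exact: Ta_piis. Qed.

Lemma antisymXE c f : supp Lm f -> antisymX c f = antisymmetrize c f.
Proof.
move=> hf; rewrite /antisymX (@sum_subW R E dot Phi) => [|w /stabE[]//].
apply: eq_big => [x|x _]; last by rewrite piTwXE.
by apply/asboolP/eqP => [/stabE[]//|h]; apply/stabE; split=> //; exact: isW_wv.
Qed.

Theorem theorem6p4X
    (Ct : set E) (hCt : orbit_representatives M Ct) (rho' : E)
    (mu : E) (eta : E) (heta : Lm eta) (c : E) (hc : Ct c)
    (wh : 'End(E)) (hwh : minreps Phi c wh)
    (hdec : w0 mu = eta + wh c) (theta : E)
    (htheta : exists w c', [/\ weyl Phi w, Ct c' & theta = w c']) :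
  let v := q ^+ 2 in
  let lhs := wa X w0 (e (rho' - theta) * comp X [set theta - rho' + x | x in Lm]
    (\sum_(w \in weyl Phi) invert (foldr (TauX rho') (invert (e (mu - rho'))) (rword w)))) in
  let wh' := (w0 \o wh \o w0)%VF in
  [/\ supp Lm lhs,
      (~ exists wt, [/\ weyl Phi wt, w0 theta = wt c & minreps Phi c (w0 \o wt)%VF]) -> lhs = 0
    & forall wt, weyl Phi wt -> w0 theta = wt c ->
        let wtc := minrep Phi c wt in
        lhs = (v ^+ len w0 * (-1) ^+ len wh'
                 * FF (- w0 c) (w0 \o wtc \o w0)%VF / hh (- w0 c) wh')
              *: piTwX (wtc \o w0)%VF
                   (antisymX (- w0 c) (opinvX (piTwX wh') (e (w0 eta))))].
Proof.
move=> v lhs wh'; have W0 := isW_w0 Phi; have [sub _] := hCt; have C0c := sub _ hc.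
have [Wwh _] := (minrepsE Phi c wh).1 hwh.
have Wwh' : isW wh' by do 2?apply: isWM.
pose c' := - w0 c.
have [Lc _ _] := C0c.
have Lc' : L c' by apply/latticeN/lattice_isW.
have cb a : a \in pos -> 0 <= (a c' : R) < (m a)%:R by exact: C0_opp_bound.
(* The congruence first identifies the representative of theta with c, and then equality follows
   from the stabilizer condition. *)
have hth w : isW w -> Lm (theta + w c') -> w c' = - theta.
  case: htheta => w2 [c2 [/weylE W2 hc2 ->]] Ww h.
  have Wv := isWV W2; have Wx : isW (w2^-1 \o (w \o w0))%VF by do 2!apply: isWM => //.
  have ec : c = c2.
    apply: (@representatives_eq _ _ _ _ _ hCt hc hc2 Wx (mlattice_isW Wv h)).
    rewrite !comp_lfunE -linearD /c' linearN addrCA subrr addr0 -[LHS]comp_lfunE.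
    by rewrite (isW_VK W2) id_lfunE.
  rewrite -ec in h *; rewrite /c' linearN /=; congr (- _).
  have := mlattice_pair_eq C0c W2 (isWM Ww W0); rewrite comp_lfunE => -> //.
  by move: h; rewrite /c' linearN.
have hy : supp Lm (e (w0 eta)) by apply/supp_ex/mlattice_isW.
have [hG eG] := opinvX_piTw wh' hy.
set G := opinvX _ _ in hG eG *; pose K := (-1) ^+ len wh' / hh c' wh'.
have sumE : \sum_(w \in weyl Phi) invert (foldr (TauX rho') (invert (e (mu - rho'))) (rword w)) =
    invert (e rho' * ev c' (K *: antisym_coef (invert G))).
  rewrite (@sum_subW R E dot Phi) => [|w /weylE //]; rewrite (proj2 (lin_ev c')).
  have -> : \sum_(w : W | `[< weyl Phi (wv w) >]) invert (foldr (TauX rho') (invert (e (mu -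
    rho'))) (rword (wv w))) =
      \sum_(w : W) invert (foldr (TauX rho') (invert (e (mu - rho'))) (rword (wv w))).
    by apply: eq_bigl => w; apply/asboolP/weylE/isW_wv.
  (* The decomposition of w0 mu, transported by - w0. *)
  have emu : - mu = wh' c' - w0 eta.
    rewrite -[mu](w0Kx Phi) hdec linearD /= opprD addrC /wh' /c' !comp_lfunE !linearN /= w0Kx //.
  have hmu : supp L (e (- mu)).
    rewrite emu; apply/supp_ex/latticeB; apply: lattice_isW => //; by case: heta.
  rewrite iot_ex opprB -(exM X).
  rewrite -(whittaker_sum Lc' cb (mlattice_isW W0 heta) Wwh' hG eG).
  rewrite mulr_sumr (lin_sum _ _ _ (lin_iot)); apply: eq_bigr => w _.
  by rewrite TauX_word // emu -scalerAr.
have lhsE : lhs = K *: \sum_(w : W | wv w c' == - theta) hh c' (wv w) *: psi (antisym_coef (invert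
  G) w).
  rewrite /lhs sumE component_sum //; last first.
    by apply/HMm_scale/HMm_SS/HMm_e/supp_iot.
  rewrite [RHS]scaler_sumr; apply: eq_bigr => w _.
  by rewrite HMZ (proj2 (lin_psi)) !scalerA mulrC.
split.
- rewrite lhsE; apply: suppZ; apply: supp_sum => w _; apply: suppZ; apply: supp_psi.
  by apply: HMm_SS; apply: HMm_e; exact: supp_iot.
(* A nonzero summand w yields the excluded element: w0 w w0, corrected on the right by the
   stabilizer of c. *)
- move=> nex; rewrite lhsE big1 ?scaler0 // => w /eqP ew; case: nex.
  have Ww := isW_wv w; have Wt0 : isW (w0 \o (wv w \o w0))%VF by do 2?apply: isWM.
  have [x sx hx] := minreps_exists c (isWM W0 Wt0).
  have [Wx xc] := (stabE Phi c x).1 sx.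
  exists ((w0 \o (wv w \o w0)) \o x)%VF; split.
  - by apply/weylE; exact: isWM.
  - have -> : theta = - (wv w c') by rewrite ew opprK.
    by rewrite !comp_lfunE xc /c' !linearN /= opprK.
  - by move: hx; rewrite -!comp_lfunA.
move=> wt /weylE Wwt ewt wtc.
have dom := C0_dom C0c.
have [hmin [x sx ex]] := minrepP c Wwt; rewrite -/wtc in hmin ex.
have [Wwtc _] := (minrepsE Phi c wtc).1 hmin; have [Wx xc] := (stabE Phi c x).1 sx.
set u := (w0 \o wtc \o w0)%VF; have Wu : isW u by do 2?apply: isWM.
have uc : u c' = - theta.
  rewrite /u /c' !comp_lfunE !linearN /= w0Kx; congr (- _).
  by rewrite -[theta](w0Kx Phi) ewt ex comp_lfunE xc.
(* Conjugation by w0 preserves length and carries the stabilizer of - w0 c to that of c. *)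
have ulen y : stab c' y -> len (u \o y)%VF = (len u + len y)%N.
  move=> /stabE[Wy yc]; have e1 : y = (w0 \o (w0 \o y \o w0) \o w0)%VF.
    by rewrite !comp_lfunA w0K comp_lfun1l -comp_lfunA w0K comp_lfun1r.
  have sy : stab c (w0 \o y \o w0)%VF.
    apply/stabE; split; first by do 2?apply: isWM.
    move: yc; rewrite /c' linearN => /oppr_inj yc.
    by rewrite !comp_lfunE yc w0Kx.
  have e2 : (u \o y)%VF = (w0 \o (wtc \o (w0 \o y \o w0)) \o w0)%VF.
    rewrite /u -!comp_lfunA w0K comp_lfun1r //.
  have Wz := (stabE _ _ _).1 sy; rewrite e2 !len_conj_w0 ?(minreps_len dom hmin sy) ?len_conj_w0 //.
  by apply: isWM => //; case: Wz.
rewrite lhsE (coset_sum Lc' cb Wu uc ulen hG) scalerA.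
rewrite (antisymXE _ hG) (piTwXE _ (supp_antis _ hG)).
have -> : (w0 \o u)%VF = (wtc \o w0)%VF by rewrite /u !comp_lfunA w0K comp_lfun1l.
congr (_ *: _); rewrite /K /Defs.FF -/c' /v (exprAC q 2 (len w0)); have q0 := qq_neq0 P.
set a := q ^+ len w0; have a0 : a != 0 by rewrite expf_neq0.
(* The power of q: the factor v^(l(w0)) against the q^(- l(w0)) inside [FF] leaves the single
   q^(l(w0)) of [coset_sum]. *)
have gen (b h h' s1 s2 : F) : h' != 0 -> s1 / h' * (h * s2 * a * b) =
    a ^+ 2 * s1 * (h * (a^-1 * b) * s2) / h' by move=> h0; field; rewrite a0 h0.
exact/gen/hh_neq0.
Qed.

End AbstractTheorem.

End HeckeAlgebra.

Theorem theorem6p4 (R : realType) (E : vectType R) (dot : {dot E for idfun})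
    (Phi : rootSystem dot) (M : metaplecticDatum Phi)
    (F : fieldType) (P : parameters M F)
    (Ct : set E) (hCt : orbit_representatives M Ct)
    (rho' : E) (hrho' : lattice M rho') (hrho : Eco Phi (rho Phi - rho'))
    (mu : E) (hmu : lattice M mu) (hmu_dom : dominant M (mu - rho'))
    (eta : E) (heta : mlattice M eta)
    (c : E) (hc : Ct c)
    (wh : 'End(E)) (hwh : minreps Phi c wh)
    (hdec : w0 Phi mu = eta + wh c)
    (theta : E)
    (htheta : exists w c', [/\ weyl Phi w, Ct c' & theta = w c']) :
  let w0 := w0 Phi in
  let v := qq P ^+ 2 in
  let lhs := wact w0 (expo F (rho' - theta) * whittaker P rho' theta mu) in
  let wh' := (w0 \o wh \o w0)%VF in
  [/\ supported (mlattice M) lhs,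
      (~ exists wt, [/\ weyl Phi wt, w0 theta = wt c
                      & minreps Phi c (w0 \o wt)%VF]) -> lhs = 0
    & forall wt, weyl Phi wt -> w0 theta = wt c ->
        minreps Phi c (w0 \o wt)%VF ->
        let wtc := minrep Phi c wt in
        lhs = (v ^+ len Phi w0 * (-1) ^+ len Phi wh'
                 * FF P (- w0 c) (w0 \o wtc \o w0)%VF / hh P (- w0 c) wh')
              *: piTw P (wtc \o w0)%VF
                   (antisym P (- w0 c)
                     (opinv M (piTw P wh') (expo F (w0 eta))))].
Proof.
have [h1 h2 h3] := @theorem6p4X R E dot Phi M F P (concreteAlgebra P) Ct hCt rho' mu eta heta c hc
  wh hwh hdec theta htheta.
split.
- exact: h1.
- exact: h2.
by move=> wt Wwt ewt _; exact: h3 Wwt ewt.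
Qed.
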